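(* Let $r=4$ and $p=3$, and let $X^{\mathrm{gen}}$ be the geometric generic $4$-marked curve of genus $0$ in characteristic $3$. Let $\Sigma$ be a nonempty set of local generating systems for $\pi_1^{\mathrm{tame}}(X^{\mathrm{gen}})$ which is closed under pure-braid operations. For $\gamma=(\gamma_1,\dots,\gamma_4)\in\Sigma$, let $H(\gamma)$ be the set of all Hurwitz factorizations $(\sigma_1,\dots,\sigma_4)$ (with the degree $d$ and the cycle lengths $e_i$ allowed to vary arbitrarily) which arise as the monodromy around $(\gamma_1,\dots,\gamma_4)$ of a tame cover of $X^{\mathrm{gen}}$ branched only over the marked points. Then $H(\gamma)$ depends on the choice of $\gamma\in\Sigma$, i.e. there exist $\gamma,\gamma'\in\Sigma$ with $H(\gamma)\ne H(\gamma')$. In particular, there is no group-theoretic criterion for recognizing when a Hurwitz factorization occurs as monodromy of a tame cover around a local generating system which works simultaneously for all systems in $\Sigma$; that is, there is no single set $H$ of Hurwitz factorizations with $H(\gamma)=H$ for all $\gamma\in\Sigma$.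
   Context: **Geometric generic curve.** $X^{\mathrm{gen}}$ is the geometric generic fiber of the universal smooth $r$-marked curve of genus $0$ over the moduli space $M_{0,r}$ over an algebraically closed field of characteristic $p$; it is a projective line over an algebraic closure of the function field of $M_{0,r}$, with $r$ distinct marked points $Q_1,\dots,Q_r$. For a marked curve $X$, $\pi_1^{\mathrm{tame}}(X)$ denotes the tame fundamental group of $X$ with the marked points removed. **Local generating system.** For an $r$-marked curve $X$ of genus $0$ over an algebraically closed field, with marked points $Q_1,\dots,Q_r$, a tuple $(\gamma_1,\dots,\gamma_r)\in(\pi_1^{\mathrm{tame}}(X))^r$ is a local generating system if (i) the $\gamma_i$ (topologically) generate $\pi_1^{\mathrm{tame}}(X)$; (ii) $\gamma_1\cdots\gamma_r=1$; (iii) each $\gamma_i$ is a (topological) generator of an inertia group at $Q_i$. **Hurwitz factorization.** An $r$-tuple of cycles $(\sigma_1,\dots,\sigma_r)\in(S_d)^r$ is a Hurwitz factorization if $\sigma_1\cdots\sigma_r=1$ and the $\sigma_i$ generate a transitive subgroup of $S_d$; it is a Hurwitz factorization for $(d,r,\{e_1,\dots,e_r\})$ if moreover $\sigma_i$ has length $e_i$ for all $i$. **Monodromy.** Given a tame (connected) cover $f$ of $X$ of degree $d$ branched only over the $Q_i$, and a local generating system $(\gamma_i)$, one labels the fiber over the base point by $\{1,\dots,d\}$ and lets $\sigma_i\in S_d$ be the monodromy permutation induced by $\gamma_i$. All labelings of the fiber are allowed. **Pure braid action.** The $i$-th standard generator of the braid group $B_r$ acts on local generating systems-like tuples by replacing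 $(\gamma_i,\gamma_{i+1})$ with $(\gamma_{i+1},\gamma_{i+1}^{-1}\gamma_i\gamma_{i+1})$. The pure braid group is the kernel of $B_r\to S_r$; it acts on the set of local generating systems. *)

(* Defs.v *)
From HB Require Import structures.
From mathcomp Require Import all_boot all_order all_algebra all_fingroup all_field.
From mathcomp Require Import boolp classical_sets.

Set Implicit Arguments.
Unset Strict Implicit.
Unset Printing Implicit Defensive.

Import GRing.Theory.
Local Open Scope classical_set_scope.
Local Open Scope ring_scope.

Local Notation "x %:F" := (@FracField.tofrac _ x) : ring_scope.

(* The projective line over an algebraically closed field K is handled through
   its function field K(x) = {fraction {poly K}}.  A closed point is an element
   of [option K], with [None] the point at infinity; a connected cover of P^1
   is a finite separable extension L of K(x), and the points of the smooth
   projective model of L are the places of L trivial on K. *)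

Definition local_param (K : fieldType) (P : option K) : {fraction {poly K}} :=
  if P is Some a then ('X - a%:P)%:F else ('X%:F)^-1.

Section Places.

Variables (K E : fieldType) (phi : {rmorphism {fraction {poly K}} -> E}).

Record is_place (V : set E) : Prop := IsPlace {
  place_const : forall a : K, V (phi (a%:P)%:F);
  place_sub : forall x y, V x -> V y -> V (x - y);
  place_mul : forall x y, V x -> V y -> V (x * y);
  place_val : forall x, V x \/ V x^-1;
  place_proper : V <> setT }.

Definition place_units (V : set E) : set E :=
  [set x | [/\ x != 0, V x & V x^-1]].

Definition place_ideal (V : set E) : set E := V `\` place_units V.

Definition lies_over (V : set E) (P : option K) : Prop :=
  place_ideal V (phi (local_param P)).

Definition ram_index (V : set E) (P : option K) (e : nat) : Prop :=
  exists t : E,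
    [/\ place_ideal V t,
        forall y, place_ideal V y -> exists2 z, V z & y = z * t
      & exists2 u, place_units V u & phi (local_param P) = u * t ^+ e].

End Places.

(* K being algebraically closed, residue extensions are trivial: tameness over
   a branch point only asks that p not divide the ramification index. *)
Definition tame_cover (K : fieldType) (r : nat) (Q : 'I_r -> option K)
    (L : fieldExtType {fraction {poly K}}) : Prop :=
  separable 1%VS {:L} /\
  forall (V : set L) (P : option K),
    is_place (in_alg L) V -> lies_over (in_alg L) V P ->
    exists2 e, ram_index (in_alg L) V P e &
      if `[< range Q P >] then forall p, p \in [pchar K] -> ~~ (p %| e)%N
      else e = 1%N.

Definition field_hom_over (F E1 E2 : fieldType) (phi1 : F -> E1) (phi2 : F -> E2)
    (f : E1 -> E2) : Prop :=
  [/\ zmod_morphism f, monoid_morphism f & forall c, f (phi1 c) = phi2 c].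

Definition is_subfield (E : fieldType) (S : set E) : Prop :=
  [/\ S 1, forall x y, S x -> S y -> S (x - y)
    & forall x y, S x -> S y -> S (x / y)].

(* Compositum, inside an algebraic closure Omega of K(x), of all covers which
   are tame over the marked points Q and unramified elsewhere. *)
Section TameClosure.

Variables (K : fieldType) (r : nat) (Q : 'I_r -> option K).
Variables (Omega : fieldType) (phi : {rmorphism {fraction {poly K}} -> Omega}).

Definition tame_elements : set Omega :=
  range phi `|`
  [set z | exists (L : fieldExtType {fraction {poly K}}) (f : L -> Omega),
     [/\ tame_cover Q L, field_hom_over (in_alg L) phi f & range f z]].

Definition tame_compositum : {pred Omega} :=
  fun z => `[< smallest (@is_subfield Omega) tame_elements z >].

Fact tame_compositum_divring : divring_closed tame_compositum.
Proof.
split=> [|x y /asboolP Sx /asboolP Sy|x y /asboolP Sx /asboolP Sy];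
  apply/asboolP => S [subS sS]; have [S1 SB SF] := subS.
- exact: S1.
- by apply: SB; [apply: Sx | apply: Sy].
- by apply: SF; [apply: Sx | apply: Sy].
Qed.

HB.instance Definition _ :=
  GRing.isDivringClosed.Build Omega tame_compositum tame_compositum_divring.

Record tame_closure := TameClosure
  { tame_val : Omega; tame_valP : tame_val \in tame_compositum }.

HB.instance Definition _ := [isSub for tame_val].
HB.instance Definition _ := [Choice of tame_closure by <:].
HB.instance Definition _ :=
  [SubChoice_isSubComUnitRing of tame_closure by <:].
HB.instance Definition _ :=
  [SubComUnitRing_isSubIntegralDomain of tame_closure by <:].
HB.instance Definition _ := [SubIntegralDomain_isSubField of tame_closure by <:].

Fact tame_inP c : phi c \in tame_compositum.
Proof. by apply/asboolP => S [_ sS]; apply: sS; left; exists c. Qed.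

Definition tame_in (c : {fraction {poly K}}) : tame_closure :=
  TameClosure (tame_inP c).

Fact tame_in_zmod_morphism : zmod_morphism tame_in.
Proof. by move=> c d; apply: val_inj; rewrite /= rmorphB. Qed.

Fact tame_in_monoid_morphism : monoid_morphism tame_in.
Proof.
by split=> [|c d]; apply: val_inj; rewrite /= ?rmorph1 ?rmorphM.
Qed.

HB.instance Definition _ :=
  GRing.isZmodMorphism.Build {fraction {poly K}} tame_closure tame_in
    tame_in_zmod_morphism.
HB.instance Definition _ :=
  GRing.isMonoidMorphism.Build {fraction {poly K}} tame_closure tame_in
    tame_in_monoid_morphism.

End TameClosure.

(* The product g * h of automorphisms is "g, then h", as for permutations in
   the library, so that the monodromy [label (sigma a) = gamma \o label a]
   below is a homomorphism gamma |-> sigma. *)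
Section Automorphisms.

Variables (F E : fieldType) (phi : F -> E).

Definition is_aut_over (g : E -> E) : Prop :=
  field_hom_over phi phi g /\ bijective g.

Record aut_over := AutOver
  { aut_fun :> E -> E; aut_funP : `[< is_aut_over aut_fun >] }.

HB.instance Definition _ := [isSub for aut_fun].
HB.instance Definition _ := [Choice of aut_over by <:].

Fact aut_one_subproof : `[< is_aut_over id >].
Proof. by apply/asboolP; split=> //; exists id. Qed.

Fact aut_mul_subproof (g h : aut_over) : `[< is_aut_over (h \o g) >].
Proof.
have /asboolP[[gB [g1 gM] gF] gb] := aut_funP g.
have /asboolP[[hB [h1 hM] hF] hb] := aut_funP h.
apply/asboolP; split; last exact: bij_comp.
by split=> [x y||c]; [|split=> [|x y]|]; rewrite /= ?gB ?hB ?g1 ?h1 ?gM ?hM ?gF ?hF.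
Qed.

Fact aut_inv_ex (g : aut_over) : exists h : E -> E, cancel g h /\ cancel h g.
Proof. by have /asboolP[_ [h gK hK]] := aut_funP g; exists h. Qed.

Definition aut_inv_fun (g : aut_over) : E -> E := projT1 (cid (aut_inv_ex g)).

Fact aut_inv_funK (g : aut_over) :
  cancel g (aut_inv_fun g) /\ cancel (aut_inv_fun g) g.
Proof. by rewrite /aut_inv_fun; case: cid. Qed.

Fact aut_inv_subproof (g : aut_over) : `[< is_aut_over (aut_inv_fun g) >].
Proof.
have [gK Kg] := aut_inv_funK g.
have /asboolP[[gB [g1 gM] gF] _] := aut_funP g.
apply/asboolP; split; last by exists g.
split=> [x y||c]; [|split=> [|x y]|]; apply: (can_inj gK).
- by rewrite gB !Kg.
- by rewrite g1 Kg.
- by rewrite gM !Kg.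
- by rewrite gF Kg.
Qed.

Definition aut_one : aut_over := AutOver aut_one_subproof.
Definition aut_mul (g h : aut_over) : aut_over := AutOver (aut_mul_subproof g h).
Definition aut_inv (g : aut_over) : aut_over := AutOver (aut_inv_subproof g).

Fact aut_mulA : associative aut_mul.
Proof. by move=> f g h; apply: val_inj. Qed.
Fact aut_mul1 : left_id aut_one aut_mul.
Proof. by move=> f; apply: val_inj. Qed.
Fact aut_1mul : right_id aut_one aut_mul.
Proof. by move=> f; apply: val_inj. Qed.
Fact aut_mulV : left_inverse aut_one aut_inv aut_mul.
Proof.
by move=> f; apply: val_inj; apply/funext => x /=; rewrite (aut_inv_funK f).2.
Qed.
Fact aut_Vmul : right_inverse aut_one aut_inv aut_mul.
Proof.
by move=> f; apply: val_inj; apply/funext => x /=; rewrite (aut_inv_funK f).1.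
Qed.

HB.instance Definition _ :=
  isGroup.Build aut_over aut_mulA aut_mul1 aut_1mul aut_mulV aut_Vmul.

(* Closure for the Krull topology. *)
Definition krull_closure (A : set aut_over) : set aut_over :=
  [set g | forall s : seq E, exists2 h, A h & {in s, aut_fun h =1 aut_fun g}].

End Automorphisms.

Definition is_subgroup (G : groupType) (H : set G) : Prop :=
  H 1%g /\ forall x y, H x -> H y -> H (x * y^-1)%g.

Definition inertia (K E : fieldType) (phi : {rmorphism {fraction {poly K}} -> E})
    (V : set E) : set (aut_over phi) :=
  [set g : aut_over phi | (forall x, V (g x) <-> V x) /\
           forall x, V x -> place_ideal V (g x - x)].
Arguments inertia {K E} phi V _.

(* The base point is the geometric generic point Spec Omega -> P^1. *)
Definition pi1_tame (K : fieldType) (r : nat) (Q : 'I_r -> option K)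
    (Omega : fieldType) (phi : {rmorphism {fraction {poly K}} -> Omega}) :=
  aut_over (tame_in Q phi).

Section Monodromy.

Variables (K : fieldType) (r : nat) (Q : 'I_r -> option K).
Variables (Omega : fieldType) (phi : {rmorphism {fraction {poly K}} -> Omega}).

Definition local_generating_system (gamma : 'I_r -> pi1_tame Q phi) : Prop :=
  [/\ krull_closure (smallest (@is_subgroup (pi1_tame Q phi)) (range gamma)) = setT,
      (\prod_(i < r) gamma i)%g = 1%g
    & forall i, exists V : set (tame_closure Q phi),
        [/\ is_place (tame_in Q phi) V, lies_over (tame_in Q phi) V (Q i)
          & krull_closure (smallest (@is_subgroup (pi1_tame Q phi)) [set gamma i])
            = inertia (tame_in Q phi) V]].

(* The fiber of the cover L over the base point is the set of K(x)-embeddings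
   of L into the tame closure. *)
Definition is_labeling (L : fieldExtType {fraction {poly K}}) (d : nat)
    (label : 'I_d -> (L -> tame_closure Q phi)) : Prop :=
  injective label /\
  range label = [set f | field_hom_over (in_alg L) (tame_in Q phi) f].

Definition is_monodromy (gamma : 'I_r -> pi1_tame Q phi)
    (d : nat) (sigma : 'I_r -> 'S_d) : Prop :=
  exists (L : fieldExtType {fraction {poly K}})
         (label : 'I_d -> (L -> tame_closure Q phi)),
    [/\ tame_cover Q L, \dim {:L} = d, is_labeling label
      & forall i a, label (sigma i a) = gamma i \o label a].

End Monodromy.

(* The identity counts as a cycle of length 1. *)
Definition is_cycle (d : nat) (s : 'S_d) (e : nat) : Prop :=
  exists2 x, #|porbit s x| = e & forall y, y \notin porbit s x -> s y = y.

Definition permutation_tuple (r : nat) : Type :=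
  {d : nat & 'I_r -> 'S_d}.

Definition hurwitz_factorization (r : nat) : set (permutation_tuple r) :=
  [set h | let sigma : 'I_r -> 'S_(projT1 h) := projT2 h in
     [/\ forall i, exists e, is_cycle (sigma i) e,
         (\prod_(i < r) sigma i)%g = 1%g
       & [transitive <<[set sigma i | i : 'I_r]>>%g,
            on [set: 'I_(projT1 h)]%SET | 'P] ]].

Definition occurring_hurwitz (K : fieldType) (r : nat) (Q : 'I_r -> option K)
    (Omega : fieldType) (phi : {rmorphism {fraction {poly K}} -> Omega})
    (gamma : 'I_r -> pi1_tame Q phi) : set (permutation_tuple r) :=
  [set h | hurwitz_factorization h /\ is_monodromy gamma (projT2 h)].

Section Braids.

Variables (G : groupType) (r : nat).
Implicit Types (gamma : 'I_r -> G) (a b : 'I_r).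

Definition braid_move a b gamma : 'I_r -> G :=
  fun k => if k == a then gamma b
           else if k == b then ((gamma b)^-1 * gamma a * gamma b)%g
           else gamma k.

Definition braid_move_inv a b gamma : 'I_r -> G :=
  fun k => if k == a then (gamma a * gamma b * (gamma a)^-1)%g
           else if k == b then gamma a
           else gamma k.

(* [braid_related s gamma gamma'] : some braid with image s in S_r carries
   gamma to gamma'. *)
Inductive braid_related : 'S_r -> ('I_r -> G) -> ('I_r -> G) -> Prop :=
| braid_refl gamma : braid_related 1%g gamma gamma
| braid_step s gamma gamma' a b : b = a.+1 :> nat ->
    braid_related s gamma gamma' ->
    braid_related (s * tperm a b)%g gamma (braid_move a b gamma')
| braid_step_inv s gamma gamma' a b : b = a.+1 :> nat ->
    braid_related s gamma gamma' ->
    braid_related (s * tperm a b)%g gamma (braid_move_inv a b gamma').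

Definition pure_braid_closed (Sigma : set ('I_r -> G)) : Prop :=
  forall gamma gamma',
    Sigma gamma -> braid_related 1%g gamma gamma' -> Sigma gamma'.

End Braids.

(* M_{0,4} is P^1 minus {0, 1, oo}, with function field k(lambda), and the
   universal marked curve over it is P^1 marked by the sections
   0, 1, oo, lambda; K is an algebraic closure of k(lambda) through j. *)
Definition generic_points (k K : fieldType)
    (j : {rmorphism {fraction {poly k}} -> K}) : 'I_4 -> option K :=
  tnth [tuple Some 0; Some 1; None; Some (j 'X%:F)].

(* Main.v *)
(* The example has p = 3 and d = 3, with four transpositions.  Over F = K(x) put
   f = x (x - 1) (x - lambda).  In characteristic 3 a cubic cover which is tame
   over 0, 1, oo, lambda, unramified elsewhere, and on which every gamma_i acts
   by a transposition, has an equation u^3 - f u = h; replacing u by u + r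
   changes h into h + r^3 - f r.  Tameness forbids a pole of h of order prime to
   3 at any place where it dominates f, and clearing poles one after the other
   leaves only h = kappa^3 f^2 with kappa^2 (1 + lambda) = -1.  Thus there is
   exactly one such cover, although there are four conjugacy classes of
   generating 4-tuples of transpositions with product 1 in S_3.  (The Galois
   closure is the unique etale Z/3-cover of the ordinary elliptic curve
   y^2 = f; in characteristic 0 there are four of them.)

   The cover exists: it is the projective line with coordinate t, where
   t^3 - t^2 - c x t + c b x = 0, c = kappa^2, b = lambda c^2.  Its monodromy
   around any local generating system is transitive with product 1, and each
   gamma_i fixes a point of the fiber, because the fiber over Q_i contains one
   simple point; in S_3 this forces four transpositions.  A suitable square of a
   standard braid generator, which is a pure braid, moves this tuple to a
   non-conjugate one.  If H(gamma) were constant on Sigma, the moved tuple would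
   also occur around gamma, contradicting uniqueness. *)

From HB Require Import structures.
Require Import Defs.
From mathcomp Require Import all_boot all_order all_algebra all_fingroup all_field.
From mathcomp Require Import ring zify.
From mathcomp Require Import boolp classical_sets.

Set Implicit Arguments.
Unset Strict Implicit.
Unset Printing Implicit Defensive.

Import Order.TTheory GRing.Theory Num.Theory.
Local Open Scope classical_set_scope.
Local Open Scope ring_scope.

Local Notation "x %:F" := (@FracField.tofrac _ x) : ring_scope.

(** * Places of extensions of K(x) *)

(** Monodromy has to be turned into equations and back, for covers given only as abstract field
    extensions. In characteristic 3 this passes through depressed cubics [u^3 - p u = q]: the map
    [u |-> u^3 - p u] is additive, so the three roots form an arithmetic progression whose step is a
    square root of [p]. A transposition negates the step, and comparing steps recovers [p] up to
    squares from the monodromy alone. The condition on [kappa] has two origins. In the uniqueness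
    argument it is the vanishing of the coefficient of [x^5], whose degree is a forbidden pole order
    at infinity. In the existence argument it cancels the [x^2] term after the substitution defining
    [t]; the equation becomes linear in [x], so the cover is rational and its ramification can be
    read off from [t]. The pure braid is a full twist of two distinct reflections: it conjugates
    them by a 3-cycle and leaves two other distinct reflections in place, which no relabeling can
    undo. *)

Section PlaceTheory.

Variables (K E : fieldType) (phi : {rmorphism {fraction {poly K}} -> E}).
Variables (V : set E) (placeV : is_place phi V).

Definition const_emb : {rmorphism K -> E} :=
  GRing.RMorphism.clone _ _ (phi \o (@FracField.tofrac _ \o polyC)) _.

Let iota := const_emb.

Lemma place_const0 : V 0.
Proof. by have := place_const placeV 0; rewrite polyC0 !rmorph0. Qed.

Lemma place_const1 : V 1.
Proof. by have := place_const placeV 1; rewrite polyC1 !rmorph1. Qed.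

Lemma place_opp x : V x -> V (- x).
Proof. by move=> Vx; rewrite -sub0r; apply: (place_sub placeV) place_const0 Vx. Qed.

Lemma place_add x y : V x -> V y -> V (x + y).
Proof.
by move=> Vx Vy; rewrite -[y]opprK; apply: (place_sub placeV) Vx (place_opp Vy).
Qed.

Lemma place_exp x n : V x -> V (x ^+ n).
Proof.
move=> Vx; elim: n => [|n IHn]; first exact: place_const1.
by rewrite exprS; apply: (place_mul placeV) IHn.
Qed.

Lemma place_ideal_sub x : place_ideal V x -> V x.
Proof. by case. Qed.

Lemma place_ideal0 : place_ideal V 0.
Proof. by split; [exact: place_const0 | case; rewrite eqxx]. Qed.

Lemma place_unit_or_ideal x : V x -> place_units V x \/ place_ideal V x.
Proof. by move=> Vx; have [] := pselect (place_units V x); [left | right]. Qed.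

Lemma place_unit_not_ideal x : place_units V x -> ~ place_ideal V x.
Proof. by move=> Ux []. Qed.

Lemma place_idealV x : ~ V x -> place_ideal V x^-1.
Proof.
move=> nVx; have [//|VxV] := place_val placeV x; split=> // -[_ _].
by rewrite invrK.
Qed.

Lemma place_unitM x y : place_units V x -> place_units V y -> place_units V (x * y).
Proof.
move=> [nx Vx VxV] [ny Vy VyV]; split; first by rewrite mulf_neq0.
  exact: (place_mul placeV).
by rewrite invfM; apply: (place_mul placeV).
Qed.

Lemma place_unitV x : place_units V x -> place_units V x^-1.
Proof. by move=> [nx Vx VxV]; split; rewrite ?invr_eq0 ?invrK. Qed.

Lemma place_unit1 : place_units V 1.
Proof. by split; rewrite ?oner_eq0 ?invr1 //; apply: place_const1. Qed.

Lemma place_unitX x n : place_units V x -> place_units V (x ^+ n).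
Proof.
move=> Ux; elim: n => [|n IHn]; first exact: place_unit1.
by rewrite exprS; apply: place_unitM.
Qed.

Lemma place_unitXz x (n : int) : place_units V x -> place_units V (x ^ n).
Proof.
by move=> Ux; case: n => n; [|apply: place_unitV]; apply: place_unitX.
Qed.

Lemma place_unit_const a : a != 0 -> place_units V (iota a).
Proof.
move=> na; split; first by rewrite fmorph_eq0.
  exact: (place_const placeV).
by rewrite -fmorphV; apply: (place_const placeV).
Qed.

Lemma place_idealMr x y : place_ideal V x -> V y -> place_ideal V (x * y).
Proof.
move=> [Vx nUx] Vy; split; first exact: (place_mul placeV).
move=> [+ _ Vxy]; rewrite mulf_eq0 negb_or => /andP[nx ny]; apply: nUx; split=> //.
suff -> : x^-1 = (x * y)^-1 * y by apply: (place_mul placeV).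
by rewrite invfM mulfVK.
Qed.

Lemma place_idealMl x y : V x -> place_ideal V y -> place_ideal V (x * y).
Proof. by move=> Vx my; rewrite mulrC; apply: place_idealMr. Qed.

(** The dichotomy [place_val] is applied to [(1 + x) / x = x^-1 + 1]: the first case would put
    [x^-1] in [V], the second gives [(1 + x)^-1 = 1 - (x^-1 + 1)^-1]. *)
Lemma place_unit1D x : place_ideal V x -> place_units V (1 + x).
Proof.
move=> [Vx nUx]; have [x0|nx] := eqVneq x 0.
  by rewrite x0 addr0; apply: place_unit1.
have V1x : V (1 + x) by apply: place_add => //; apply: place_const1.
have nVxV : ~ V x^-1 by move=> VxV; apply: nUx; split.
have n1x : 1 + x != 0.
  apply/eqP => /eqP; rewrite addr_eq0 => /eqP x1; apply: nVxV.
  have -> : x = -1 by rewrite -[x]opprK -x1.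
  by rewrite invrN invr1; apply/place_opp/place_const1.
split=> //; have [//|nVi] := pselect (V (1 + x)^-1); exfalso.
have [_ nU] := place_idealV nVi; rewrite invrK in nU.
have Vq : V (x^-1 * (1 + x)) \/ V (x^-1 * (1 + x))^-1 by exact: (place_val placeV).
have e : x^-1 * (1 + x) = x^-1 + 1 by rewrite mulrDr mulVf // mulr1.
case: Vq; rewrite ?e => Vq.
  apply: nVxV; rewrite -[x^-1](addrK 1); apply: (place_sub placeV) Vq _ => //.
  exact: place_const1.
apply: nVi; suff -> : (1 + x)^-1 = 1 - (x^-1 + 1)^-1.
  by apply: (place_sub placeV) => //; apply: place_const1.
rewrite -e invfM invrK -[X in X - _](divff n1x) -mulrBl addrK.
by rewrite mul1r.
Qed.

Lemma place_idealD x y : place_ideal V x -> place_ideal V y -> place_ideal V (x + y).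
Proof.
move=> mx my; have [->|nx] := eqVneq x 0; first by rewrite add0r.
have [->|ny] := eqVneq y 0; first by rewrite addr0.
have [Vq|Vq] := place_val placeV (x / y).
  rewrite -[x](divfK ny) -[X in _ + X]mul1r -mulrDl mulrC.
  by apply: place_idealMr => //; apply: place_add => //; apply: place_const1.
rewrite invf_div in Vq; rewrite -[y](divfK nx) -[X in X + _]mul1r -mulrDl mulrC.
by apply: place_idealMr => //; apply: place_add => //; apply: place_const1.
Qed.

Lemma place_idealN x : place_ideal V x -> place_ideal V (- x).
Proof.
move=> mx; rewrite -mulN1r mulrC; apply: place_idealMr => //.
exact/place_opp/place_const1.
Qed.

Lemma place_idealB x y : place_ideal V x -> place_ideal V y -> place_ideal V (x - y).
Proof. by move=> mx my; apply: place_idealD => //; apply: place_idealN. Qed.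

Lemma place_ideal_prime x y :
  V x -> V y -> place_ideal V (x * y) -> place_ideal V x \/ place_ideal V y.
Proof.
move=> Vx Vy mxy; have [Ux|] := place_unit_or_ideal Vx; last by left.
have [Uy|] := place_unit_or_ideal Vy; last by right.
by case: (place_unit_not_ideal (place_unitM Ux Uy)).
Qed.

Lemma place_unitD x y : place_units V x -> place_ideal V y -> place_units V (x + y).
Proof.
move=> Ux my; have [nx Vx VxV] := Ux.
have -> : x + y = x * (1 + x^-1 * y) by rewrite mulrDr mulr1 mulVKf.
by apply: place_unitM Ux (place_unit1D _); apply: place_idealMl.
Qed.

Lemma place_const_ideal a : place_ideal V (iota a) -> a = 0.
Proof.
move=> ma; apply/eqP; apply: contrapT => /negP na.
exact: place_unit_not_ideal (place_unit_const na) ma.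
Qed.

Definition ev (s : E) (p : {poly K}) : E := (map_poly iota p).[s].

Lemma evE s p c : ev s (p * 'X + c%:P) = ev s p * s + iota c.
Proof. by rewrite /ev rmorphD rmorphM /= map_polyX map_polyC !hornerE. Qed.

Lemma evC s c : ev s c%:P = iota c.
Proof. by rewrite /ev map_polyC hornerC. Qed.

Lemma evX s : ev s 'X = s.
Proof. by rewrite /ev map_polyX hornerX. Qed.

Lemma evD s p q : ev s (p + q) = ev s p + ev s q.
Proof. by rewrite /ev rmorphD hornerE. Qed.

Lemma evN s p : ev s (- p) = - ev s p.
Proof. by rewrite /ev rmorphN hornerE. Qed.

Lemma evM s p q : ev s (p * q) = ev s p * ev s q.
Proof. by rewrite /ev rmorphM hornerE. Qed.

Lemma ev_integral s p : V s -> V (ev s p).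
Proof.
move=> Vs; elim/poly_ind: p => [|p c IHp].
  by rewrite /ev rmorph0 horner0; apply: place_const0.
rewrite evE; apply: place_add (place_const placeV c).
exact: (place_mul placeV).
Qed.

Lemma ev_order s p : place_ideal V s -> ev s p != 0 ->
  exists n, exists2 u, place_units V u & ev s p = u * s ^+ n.
Proof.
move=> ms; elim/poly_ind: p => [|p c IHp]; first by rewrite /ev rmorph0 horner0 eqxx.
rewrite evE; have [->|nc] := eqVneq c 0.
  rewrite rmorph0 addr0 => nps.
  have [|n [u Uu ->]] := IHp; first by apply: contraNneq nps => ->; rewrite mul0r.
  by exists n.+1, u => //; rewrite exprSr mulrA.
exists 0, (ev s p * s + iota c); last by rewrite expr0 mulr1.
rewrite addrC; apply: place_unitD (place_unit_const nc) _.
by apply: (place_idealMl _ ms); apply: ev_integral; apply: place_ideal_sub.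
Qed.

Definition generates_over_const (s : E) : Prop :=
  forall S : set E, is_subfield S -> (forall a, S (iota a)) -> S s -> forall y, S y.

Lemma generates_ev s y : generates_over_const s ->
  exists p q, ev s q != 0 /\ y = ev s p / ev s q.
Proof.
move=> gs; have ev1 : ev s 1 = 1 by rewrite /ev rmorph1 hornerC.
move: y; apply: gs; first 1 last.
- by move=> a; exists a%:P, 1; rewrite ev1 oner_eq0 invr1 mulr1 evC.
- by exists 'X, 1; rewrite ev1 oner_eq0 invr1 mulr1 evX.
split.
- by exists 1, 1; rewrite ev1 oner_eq0 invr1 mulr1.
- move=> _ _ [p [q [nq ->]]] [p' [q' [nq' ->]]].
  exists (p * q' - p' * q), (q * q'); rewrite evM mulf_neq0 //; split=> //.
  by rewrite evD evN !evM -mulNr addf_div // mulNr.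
- move=> _ _ [p [q [nq ->]]] [p' [q' [nq' ->]]].
  have [p'0|np'] := eqVneq (ev s p') 0.
    exists 0, 1; rewrite ev1 oner_eq0; split=> //.
    by rewrite p'0 mul0r invr0 mulr0 /ev rmorph0 horner0 mul0r.
  exists (p * q'), (q * p'); rewrite !evM mulf_neq0 //; split=> //.
  by rewrite invf_div mulf_div.
Qed.

Lemma generates_order s y : generates_over_const s -> place_ideal V s -> s != 0 ->
  y != 0 -> exists n : int, exists2 u, place_units V u & y = u * s ^ n.
Proof.
move=> gs ms ns; have [p [q [nq ->]]] := generates_ev y gs.
rewrite mulf_eq0 negb_or => /andP[np _].
have [n [u Uu ->]] := ev_order ms np; have [m [v Uv ->]] := ev_order ms nq.
exists (n%:Z - m%:Z), (u / v); first exact/place_unitM/place_unitV.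
by rewrite expfzDr // -invr_expz mulf_div.
Qed.

(** In [K(s)] with [s] in the ideal, each nonzero element is a unit times a power of [s], because
    the term of lowest order dominates; membership in the ideal makes the exponent positive. *)
Lemma generates_uniformizer s y : generates_over_const s -> place_ideal V s ->
  s != 0 -> place_ideal V y -> exists2 z, V z & y = z * s.
Proof.
move=> gs ms ns my; have [->|ny] := eqVneq y 0.
  by exists 0; [exact: place_const0 | rewrite mul0r].
have Vs := place_ideal_sub ms.
have [[[|n]|n] [u Uu yE]] := generates_order gs ms ns ny.
- by move: my; rewrite yE expr0z mulr1 => /(place_unit_not_ideal Uu).
- exists (u * s ^+ n); last by rewrite yE -mulrA -exprSr.
  by apply: (place_mul placeV); [have [] := Uu | apply: place_exp].
- case: my => Vy []; split=> //; rewrite yE invfM invrK.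
  apply: (place_mul placeV); first by have [] := Uu.
  exact: (place_exp n.+1).
Qed.

Lemma place_ideal_expz t (n : int) : place_ideal V t -> t != 0 -> 0 < n ->
  place_ideal V (t ^ n).
Proof.
move=> mt nt; case: n => // -[|n] // _; rewrite -exprnP exprS.
by apply: place_idealMr => //; apply/place_exp/place_ideal_sub.
Qed.

(* A uniformizer [t] divides every element of the ideal, so if [t] does not
   divide [j] times evenly, [y / t ^ k] sits strictly between [1] and [t]. *)
Lemma cube_exponent y t v (j : int) :
    place_ideal V t -> t != 0 ->
    (forall z, place_ideal V z -> exists2 w, V w & z = w * t) ->
    place_units V v -> y ^+ 3 = v * t ^ j ->
  (3 %| j)%Z.
Proof.
move=> mt nt unif Uv yE; apply/dvdz_mod0P.
pose k := (j %/ 3)%Z; have jE : j = k * 3 + (j %% 3)%Z := divz_eq j 3.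
set r := (j %% 3)%Z in jE *; have r_ge0 : 0 <= r by apply: modz_ge0.
have r_lt3 : r < 3 by apply: (@ltz_pmod j 3).
have z3 : (y * t ^ (- k)) ^+ 3 = v * t ^ r.
  rewrite exprMn yE jE expfzDr // -mulrA mulrAC exprnP exprz_exp.
  by rewrite -expfzDr // mulNr subrr expr0z mul1r.
apply/eqP; apply: contrapT => /negP nr; set z := y * _ in z3.
have r_gt0 : 0 < r by rewrite lt0r nr.
have mz3 : place_ideal V (z ^+ 3).
  by rewrite z3; apply: place_idealMl (place_ideal_expz _ _ _) => //; case: Uv.
have mz : place_ideal V z.
  have [Vz|Vz] := place_val placeV z.
    have [Uz|//] := place_unit_or_ideal Vz.
    by case: (place_unit_not_ideal (place_unitX 3 Uz)).
  have [z0|nz] := eqVneq z 0; first by rewrite z0; apply: place_ideal0.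
  case: mz3 => Vz3 []; split=> //; first by rewrite expf_neq0.
  by rewrite -exprVn; apply: place_exp.
have [w Vw zE] := unif _ mz.
apply: (place_unit_not_ideal Uv).
have -> : v = w ^+ 3 * t ^ (3 - r).
  rewrite zE exprMn exprnP in z3.
  by rewrite expfzDr // mulrA z3 -mulrA -expfzDr // subrr expr0z mulr1.
apply: place_idealMl (place_ideal_expz _ _ _) => //; first exact: place_exp.
by rewrite subr_gt0.
Qed.

(** The inequality says that [h^2 / f^3] has a pole. With [X = u^2 / f] one has
    [h^2 / f^3 = X (X - 1)^2], so [X] has a pole too and [u^3] dominates [f u]. Thus
    [u^3 = h / (1 - f / u^2)] is a unit times [t^(e n)]. The order of a cube is divisible by 3, and
    since [e] is prime to 3 (tameness) so is [n]. *)
Lemma tame_cubic_exponent (u f h t pi a b c : E) (m n : int) (e : nat) :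
    place_ideal V t -> t != 0 ->
    (forall z, place_ideal V z -> exists2 w, V w & z = w * t) ->
    place_ideal V pi -> place_units V c -> pi = c * t ^+ e -> ~~ (3 %| e)%N ->
    place_units V a -> f = a * pi ^ m -> place_units V b -> h = b * pi ^ n ->
    2 * n < 3 * m -> u ^+ 3 - f * u = h ->
  (3 %| n)%Z.
Proof.
move=> mt nt unif mpi Uc piE e3 Ua fE Ub hE lt_nm uE.
have [na _ _] := Ua; have [nb _ _] := Ub; have [nc _ _] := Uc.
have npi : pi != 0 by rewrite piE mulf_neq0 ?expf_neq0.
have nf : f != 0 by rewrite fE mulf_neq0 ?expfz_neq0.
have nh : h != 0 by rewrite hE mulf_neq0 ?expfz_neq0.
have nu : u != 0.
  by apply: contra_neq nh => u0; rewrite -uE u0 expr0n mulr0 subr0.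
have mw : place_ideal V (f / u ^+ 2).
  apply: contrapT => nmw; have VX : V (u ^+ 2 / f).
    rewrite -[u ^+ 2 / f]invf_div; have [Vw|//] := place_val placeV (f / u ^+ 2).
    by have [[]|] := place_unit_or_ideal Vw.
  have Vq : V (h ^+ 2 / f ^+ 3).
    have -> : h ^+ 2 / f ^+ 3 = u ^+ 2 / f * (u ^+ 2 / f - 1) ^+ 2.
      by rewrite -uE; field.
    apply: (place_mul placeV) => //; apply: place_exp.
    by apply: (place_sub placeV) => //; apply: place_const1.
  have mN : place_ideal V (pi ^ (3 * m - 2 * n)).
    by apply: place_ideal_expz => //; rewrite subr_gt0.
  apply: (place_unit_not_ideal (place_unitM (place_unitX 2 Ub)
    (place_unitV (place_unitX 3 Ua)))).
  have -> : b ^+ 2 / a ^+ 3 = h ^+ 2 / f ^+ 3 * pi ^ (3 * m - 2 * n).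
    rewrite fE hE !exprMn expfzDr // -invr_expz.
    rewrite [3 * m]mulrC [2 * n]mulrC -!exprz_exp -!exprnP.
    by field; rewrite na !expfz_neq0.
  exact: place_idealMl.
have U1w : place_units V (1 - f / u ^+ 2).
  by apply: place_unitD place_unit1 (place_idealN mw).
have [n1w _ _] := U1w.
suff : (3 %| e%:Z * n)%Z.
  by rewrite Gauss_dvdzr // coprimezE prime_coprime.
apply: (@cube_exponent u t (b * c ^ n / (1 - f / u ^+ 2))) => //.
  by do !apply: place_unitM => //; [apply: place_unitXz | apply: place_unitV].
have -> : u ^+ 3 = h / (1 - f / u ^+ 2).
  by rewrite -uE; field; rewrite nu /= subr_eq0 eq_sym; move: n1w;
     rewrite subr_eq0 eq_sym; apply: contraNneq => <-; rewrite divff ?expf_neq0.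
by rewrite hE piE expfzMl // exprnP -exprz_exp -!mulrA; congr (_ * (_ * _)); rewrite mulrC.
Qed.

End PlaceTheory.

(** * Existence of places dominating a non-constant element (Chevalley) *)

Section PlaceExistence.

Variables (K : closedFieldType) (E : fieldType).
Variable phi : {rmorphism {fraction {poly K}} -> E}.

(** Over an algebraically closed field [p] splits into linear factors, none of which vanishes at a
    non-constant. *)
Lemma ev_transcendental s p :
  (forall a, s <> const_emb phi a) -> ev phi s p = 0 -> p = 0.
Proof.
move=> sK ps0; apply/eqP; apply: contrapT => /negP np.
have [r pE] := closed_field_poly_normal p.
move: ps0; rewrite pE /ev map_polyZ hornerZ => /eqP; rewrite mulf_eq0 fmorph_eq0.
rewrite lead_coef_eq0 (negPf np) /= rmorph_prod horner_prod.
rewrite prodf_seq_eq0 => /hasP[a _ /=].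
by rewrite rmorphB /= map_polyX map_polyC hornerXsubC subr_eq0 => /eqP/sK.
Qed.

Lemma local_param_not_const (P : option K) a :
  phi (local_param P) <> const_emb phi a.
Proof.
have X_not_const b c : 'X%:F <> ((b%:P)%:F + (c%:P)%:F : {fraction {poly K}}).
  rewrite -rmorphD -rmorphD => /eqP; rewrite tofrac_eq =>
    /eqP/(congr1 (fun p : {poly K} => size p)) /=.
  by rewrite size_polyX; have := size_polyC_leq1 (b + c); case: (size _) => [|[]].
move=> /fmorph_inj; case: P => [b|] /= E0.
  by apply: (X_not_const b a); rewrite -E0 rmorphB /= addrC subrK.
have na : a != 0.
  apply: contra_eq_neq E0 => ->; rewrite polyC0 rmorph0.
  by rewrite invr_eq0 tofrac_eq0 polyX_eq0.
apply: (X_not_const a^-1 0); rewrite polyC0 rmorph0 addr0 -[LHS]invrK E0.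
apply: (@mulfI _ ((a%:P)%:F)); first by rewrite tofrac_eq0 polyC_eq0.
by rewrite divff ?tofrac_eq0 ?polyC_eq0 // -!rmorphM /= divff ?rmorph1.
Qed.

Variable pi : E.
Hypothesis pi_not_const : forall a, pi <> const_emb phi a.

Let pi_neq0 : pi != 0.
Proof. by apply/eqP => pi0; apply: (pi_not_const (a := 0)); rewrite rmorph0. Qed.

(* Vacuously true of the empty set, as [Zorn_bigcup] requires. *)
Definition subring_dominating (B : set E) : Prop :=
  [/\ forall x y, B x -> B y -> B (x - y),
      forall x y, B x -> B y -> B (x * y),
      forall x a, B x -> B (const_emb phi a),
      forall x, B x -> B pi
    & forall z, B z -> pi * z <> 1].

Lemma subring_dominating_maximal : exists A : set E,
  [/\ subring_dominating A, A 1
    & forall B, subring_dominating B -> A `<=` B -> B `<=` A].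
Proof.
have [|A [domA maxA]] := @Zorn_bigcup E subring_dominating.
  move=> C domC totC; split.
  - move=> x y [X CX Xx] [Y CY Yy].
    have [XY|YX] := totC _ _ CX CY.
      by exists Y => //; have [+ _ _ _ _] := domC _ CY; apply=> //; apply: XY.
    by exists X => //; have [+ _ _ _ _] := domC _ CX; apply=> //; apply: YX.
  - move=> x y [X CX Xx] [Y CY Yy].
    have [XY|YX] := totC _ _ CX CY.
      by exists Y => //; have [_ + _ _ _] := domC _ CY; apply=> //; apply: XY.
    by exists X => //; have [_ + _ _ _] := domC _ CX; apply=> //; apply: YX.
  - by move=> x a [X CX Xx]; exists X => //; have [_ _ /(_ x a Xx)] := domC _ CX.
  - by move=> x [X CX Xx]; exists X => //; have [_ _ _ /(_ x Xx)] := domC _ CX.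
  - by move=> x [X CX Xx]; have [_ _ _ _] := domC _ CX; apply.
(* The maximal element could be empty; [K[pi]] excludes this, since [pi p(pi) = 1] would force
   [X p = 1] in [K[X]] by transcendence. *)
have [B_ge|B_ge] := pselect (exists x, A x); last first.
  have A0 : A = set0 by apply/seteqP; split=> // x Ax; case: B_ge; exists x.
  pose B : set E := [set ev phi pi p | p in setT].
  have domB : subring_dominating B.
    split.
    - by move=> _ _ [p _ <-] [q _ <-]; exists (p - q); rewrite // evD evN.
    - by move=> _ _ [p _ <-] [q _ <-]; exists (p * q); rewrite // evM.
    - by move=> x a _; exists a%:P; rewrite // evC.
    - by move=> x _; exists 'X; rewrite // evX.
    - move=> _ [p _ <-] pip; have : ev phi pi ('X * p - 1) = 0.
        by rewrite evD evN evM evX pip -polyC1 evC rmorph1 subrr.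
      move=> /(ev_transcendental pi_not_const) /(congr1 (horner^~ 0)).
      by rewrite !hornerE => /eqP; rewrite oppr_eq0 oner_eq0.
  case: (maxA B) => //; rewrite A0; split=> // /(_ (ev phi pi 0)); apply.
  by exists 0.
have [x Ax] := B_ge; exists A; split=> //.
  by have [_ _ + _ _] := domA => /(_ _ 1 Ax); rewrite (rmorph1 (const_emb phi)).
move=> B domB AB; apply: contrapT => nBA; apply: (maxA B) => //.
Qed.

Section Maximal.

Variable A : set E.
Hypotheses (domA : subring_dominating A) (A1 : A 1).
Hypothesis maxA : forall B, subring_dominating B -> A `<=` B -> B `<=` A.

Let AB x y : A x -> A y -> A (x - y). Proof. by case: domA => + _ _ _ _; exact. Qed.
Let AM x y : A x -> A y -> A (x * y). Proof. by case: domA => _ + _ _ _; exact. Qed.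
Let AC a : A (const_emb phi a). Proof. by have [_ _ /(_ _ a A1)] := domA. Qed.
Let Api : A pi. Proof. by case: domA => _ _ _ /(_ _ A1). Qed.
Let Apim z : A z -> pi * z <> 1. Proof. by case: domA => _ _ _ _; exact. Qed.
Let A0 : A 0. Proof. by have := AC 0; rewrite rmorph0. Qed.
Let AN x : A x -> A (- x). Proof. by move=> Ax; rewrite -sub0r; apply: AB. Qed.
Let AD x y : A x -> A y -> A (x + y).
Proof. by move=> Ax Ay; rewrite -[y]opprK; apply/AB/AN. Qed.

Let A1pi_neq0 z : A z -> 1 + pi * z != 0.
Proof.
move=> Az; rewrite addrC addr_eq0; apply/eqP => e.
by apply: (Apim (AN Az)); rewrite mulrN e opprK.
Qed.

(** Localizing [A] at [1 + pi A] does not invert [pi], as [pi a = 1 + pi b] would give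
    [pi (a - b) = 1]; maximality of [A] then absorbs the localization. *)
Let A_unit z : A z -> A (1 + pi * z)^-1.
Proof.
move=> Az; pose B : set E := [set y | exists a b, [/\ A a, A b & y = a / (1 + pi * b)]].
suff BA : B `<=` A by apply: BA; exists 1, z; rewrite mul1r.
apply: maxA; last by move=> x Ax; exists x, 0; rewrite mulr0 addr0 divr1.
have n1 := A1pi_neq0; split.
- move=> _ _ [a [b [Aa Ab ->]]] [c [d [Ac Ad ->]]].
  exists (a * (1 + pi * d) - c * (1 + pi * b)), (b + d + pi * (b * d)); split.
  + by apply: AB; apply: AM => //; apply: AD => //; apply: AM.
  + by do !apply: AD => //; apply: AM => //; apply: AM.
  + have := n1 _ Ab; have := n1 _ Ad => nd nb.
    rewrite (_ : 1 + pi * (b + d + pi * (b * d)) = (1 + pi * b) * (1 + pi * d)); last by ring.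
    by field; rewrite nb nd.
- move=> _ _ [a [b [Aa Ab ->]]] [c [d [Ac Ad ->]]].
  exists (a * c), (b + d + pi * (b * d)); split; first exact: AM.
  + by do !apply: AD => //; apply: AM => //; apply: AM.
  + have := n1 _ Ab; have := n1 _ Ad => nd nb.
    rewrite (_ : 1 + pi * (b + d + pi * (b * d)) = (1 + pi * b) * (1 + pi * d)); last by ring.
    by field; rewrite nb nd.
- by move=> x c _; exists (const_emb phi c), 0; rewrite mulr0 addr0 divr1.
- by move=> x _; exists pi, 0; rewrite mulr0 addr0 divr1.
- move=> _ [a [b [Aa Ab ->]]] e; apply: (Apim (AB Aa Ab)).
  have nb := n1 _ Ab; have : pi * a = 1 + pi * b.
    by rewrite mulrA in e; rewrite (canRL (divfK nb) e) mul1r.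
  by rewrite mulrBr => ->; rewrite addrK.
Qed.

Let inverts (x : E) (n : nat) : Prop := exists2 a : nat -> E,
  forall i, A (a i) & pi * (\sum_(i < n) a i * x ^+ i) = 1.

Let adjoin_inverts x : A x \/ exists n, inverts x n.
Proof.
pose B : set E := [set y | exists2 p : {poly E}, forall i, A p`_i & y = p.[x]].
have [domB|] := pselect (subring_dominating B).
  left; apply: (maxA domB); last first.
    by exists 'X; rewrite ?hornerX // => i; rewrite coefX; case: eqP.
  move=> y Ay; exists y%:P; rewrite ?hornerC // => i; rewrite coefC.
  by case: eqP.
move=> ndomB; right; apply: contrapT => ninv; apply: ndomB; split.
- move=> _ _ [p Ap ->] [q Aq ->]; exists (p - q); rewrite ?hornerE // => i.
  by rewrite coefB; apply: AB.
- move=> _ _ [p Ap ->] [q Aq ->]; exists (p * q); rewrite ?hornerE // => i.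
  by rewrite coefM; apply: big_ind => // j _; apply: AM.
- move=> _ a _; exists (const_emb phi a)%:P; rewrite ?hornerC // => i.
  by rewrite coefC; case: eqP.
- by move=> _ _; exists pi%:P; rewrite ?hornerC // => i; rewrite coefC; case: eqP.
- move=> _ [p Ap ->] e; apply: ninv; exists (size p), (fun i => p`_i) => //.
  by rewrite -horner_coef.
Qed.

(* Chevalley's argument: the shorter of the two relations lowers the degree of
   the longer one. *)
Let not_both_invert N n m x : (n + m <= N)%N -> x != 0 ->
  inverts x n -> inverts x^-1 m -> False.
Proof.
elim: N n m x => [|N IHN] n m x.
  rewrite leqn0 addn_eq0 => /andP[/eqP-> _] _ [a _].
  by rewrite big_ord0 mulr0 => /esym/eqP; rewrite oner_eq0.
wlog le_mn : n m x / (m <= n)%N.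
  move=> H le_N nx invn invm; have [le_mn|/ltnW le_nm] := leqP m n.
    exact: (H n m x).
  by apply: (H m n x^-1); rewrite ?invrK ?invr_eq0 // addnC.
case: n le_mn => [|n] le_mn le_N nx [a Aa ea] [b Ab eb].
  by move: ea; rewrite big_ord0 mulr0 => /esym/eqP; rewrite oner_eq0.
pose b' j := if (j < m)%N then b j else 0.
have Ab' j : A (b' j) by rewrite /b'; case: ifP.
have eb' : pi * (\sum_(j < n.+1) b' j * x^-1 ^+ j) = 1.
  rewrite -eb (big_ord_widen _ (fun j => b j * x^-1 ^+ j) le_mn).
  congr (_ * _); rewrite [RHS]big_mkcond; apply: eq_bigr => j _; rewrite /b'.
  by case: ifP; rewrite ?mul0r.
(* Multiplied by [x^n], the relation for [x^-1] reads [(1 - pi b'_0) x^n = pi (b'_n + ... + b'_1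
   x^(n-1))], and [1 - pi b'_0] is a unit of [A]. Substituting this value of [x^n] into the relation
   for [x] produces the coefficients [a']. *)
pose c := (1 + pi * (- b' 0))^-1.
have Ac : A c by apply/A_unit/AN.
pose a' i := a i + pi * a n * c * b' (n - i)%N.
apply: (IHN n m x) => //; last by exists b.
exists a'; first by move=> i; apply: AD => //; do !apply: AM => //.
have xn : x ^+ n = pi * c * \sum_(i < n) b' (n - i)%N * x ^+ i.
  have n0 : 1 + pi * (- b' 0) != 0 by apply/A1pi_neq0/AN.
  rewrite -[LHS](mulKf n0) -/c -[RHS]mulrA [RHS]mulrCA; congr (_ * _).
  have -> : 1 + pi * - b' 0 = pi * (\sum_(i < n) b' (lift ord0 i) * x^-1 ^+ lift ord0 i).
    by rewrite big_ord_recl /= expr0 mulr1 in eb'; rewrite -[X in X + _]eb'; ring.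
  rewrite -mulrA mulr_suml (reindex_inj rev_ord_inj) /=; congr (_ * _).
  apply: eq_bigr => i _.
  rewrite -[bump _ _]/(1 + (n - i.+1))%N add1n subnSK ?subSS // -mulrA; congr (_ * _).
  rewrite exprVn -[in x ^+ n](subnK (ltnW (ltn_ord i))) exprD mulKf //.
  by rewrite expf_neq0.
rewrite -[RHS]ea big_ord_recr /= xn -mulrA.
under eq_bigr do rewrite mulrDl -mulrA.
rewrite big_split /= -mulr_sumr; ring.
Qed.

Lemma maximal_dominating_is_place : is_place phi A.
Proof.
split=> //.
- move=> x; have [->|nx] := eqVneq x 0; first by left.
  have [|[n invn]] := adjoin_inverts x; first by left.
  have [|[m invm]] := adjoin_inverts x^-1; first by right.
  by case: (not_both_invert (leqnn (n + m)) nx invn invm).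
- move=> AT; apply: (@Apim pi^-1); first by rewrite AT.
  exact: divff.
Qed.

Lemma maximal_dominating_ideal : place_ideal A pi.
Proof. by split=> // -[_ _ /Apim]; apply; rewrite divff. Qed.

End Maximal.
End PlaceExistence.

Lemma place_lying_over (K : closedFieldType) (E : fieldType)
    (phi : {rmorphism {fraction {poly K}} -> E}) (P : option K) :
  exists2 V, is_place phi V & lies_over phi V P.
Proof.
have piK := @local_param_not_const K E phi P.
have [A [domA A1 maxA]] := subring_dominating_maximal piK.
exists A; first exact: (maximal_dominating_is_place piK domA A1 maxA).
exact: maximal_dominating_ideal.
Qed.

(** * Extension of isomorphisms to an algebraic closure *)

Section PartialIsomorphisms.

Variables (F Omega : fieldType) (phi : {rmorphism F -> Omega}).

(* A partial automorphism is encoded by its graph; the definition is invariant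
   under exchange of the two coordinates. *)
Record partial_iso (G : set (Omega * Omega)) : Prop := PartialIso {
  piso_base : forall c, G (phi c, phi c);
  piso_sub : forall x y x' y', G (x, y) -> G (x', y') -> G (x - x', y - y');
  piso_div : forall x y x' y', G (x, y) -> G (x', y') -> G (x / x', y / y');
  piso_fun : forall y, G (0, y) -> y = 0;
  piso_inj : forall x, G (x, 0) -> x = 0 }.

Lemma partial_iso_transpose G :
  partial_iso G -> partial_iso [set z | G (z.2, z.1)].
Proof.
case=> G1 G2 G3 G4 G5; split=> //= [x y x' y'|x y x' y']; [exact: G2|exact: G3].
Qed.

(** Evaluation at [z] and at [z'] both have kernel generated by [p], so the pairs form the graph of
    an isomorphism; a Bezout relation with [p] turns quotients of values into values. It serves
    twice: with [D] the base field to start, and with [D] the domain of a partial isomorphism to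
    extend it. *)
Lemma partial_iso_adjoin (D : fieldType) (i g : {rmorphism D -> Omega})
    (p : {poly D}) (z z' : Omega) :
    (forall c, exists2 d, i d = phi c & g d = phi c) ->
    irreducible_poly p -> root (map_poly i p) z -> root (map_poly g p) z' ->
  partial_iso [set w | exists q, w = ((map_poly i q).[z], (map_poly g q).[z'])].
Proof.
move=> base irr_p pz pz'.
have div_or q : (exists2 r, q = r * p & True) \/
    (exists r s, [/\ r * p + s * q = 1 & True]).
  have [dpq|ndpq] := boolP (p %| q)%R.
    by left; exists (q %/ p)%R; rewrite ?divpK.
  right; have : coprimep p q by rewrite irreducible_poly_coprime.
  by case/Bezout_eq1_coprimepP => -[r s] /= e; exists r, s.
have ev_inv (h : {rmorphism D -> Omega}) (w : Omega) r s q :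
    root (map_poly h p) w -> r * p + s * q = 1 ->
    (map_poly h s).[w] * (map_poly h q).[w] = 1.
  move=> /rootP pw /(congr1 (fun q => (map_poly h q).[w])).
  by rewrite rmorphD !rmorphM rmorph1 /= !hornerE pw mulr0 add0r.
have inv_eq (h : {rmorphism D -> Omega}) (w : Omega) r s q :
    root (map_poly h p) w -> r * p + s * q = 1 ->
    (map_poly h s).[w] = (map_poly h q).[w]^-1.
  move=> pw e; have e1 := ev_inv _ _ _ _ _ pw e.
  have nq : (map_poly h q).[w] != 0.
    by apply: contra_eq_neq e1 => ->; rewrite mulr0 eq_sym oner_eq0.
  by apply: (mulIf nq); rewrite mulVf.
have ev_dvd (h : {rmorphism D -> Omega}) (w : Omega) r :
    root (map_poly h p) w -> (map_poly h (r * p)).[w] = 0.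
  by move=> /rootP pw; rewrite rmorphM /= hornerM pw mulr0.
split.
- move=> c; have [d di dg] := base c.
  by exists d%:P; rewrite !map_polyC !hornerC /= di dg.
- move=> _ _ _ _ [q [-> ->]] [r [-> ->]]; exists (q - r).
  by rewrite !rmorphB /= !hornerE.
- move=> _ _ _ _ [q [-> ->]] [r [-> ->]].
  (* If [p] divides the denominator, both its values vanish, and [0^-1 = 0] makes the quotient pair
     [(0, 0)]. *)
  have [[s -> _]|[s [t [e _]]]] := div_or r.
    by exists 0; rewrite !ev_dvd // !invr0 !mulr0 !rmorph0 !horner0.
  by exists (q * t); rewrite !rmorphM /= !hornerM !(inv_eq _ _ _ _ _ _ e).
- move=> y [q [q0 ->]]; have [[s -> _]|[s [t [e _]]]] := div_or q.
    exact: ev_dvd.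
  by have := ev_inv _ _ _ _ _ pz e; rewrite -q0 mulr0 => /esym/eqP; rewrite oner_eq0.
- move=> y [q [-> q0]]; have [[s -> _]|[s [t [e _]]]] := div_or q.
    exact: ev_dvd.
  by have := ev_inv _ _ _ _ _ pz' e; rewrite -q0 mulr0 => /esym/eqP; rewrite oner_eq0.
Qed.

Section Domain.

Variables (G : set (Omega * Omega)) (pisoG : partial_iso G).

Definition piso_dom_pred of partial_iso G : {pred Omega} :=
  fun x => `[< exists y, G (x, y) >].

Fact piso_dom_divring : divring_closed (piso_dom_pred pisoG).
Proof.
split=> [|x y /asboolP[x' Gx] /asboolP[y' Gy]|x y /asboolP[x' Gx] /asboolP[y' Gy]];
  apply/asboolP.
- by exists 1; have := piso_base pisoG 1; rewrite rmorph1.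
- by exists (x' - y'); apply: piso_sub.
- by exists (x' / y'); apply: piso_div.
Qed.

HB.instance Definition _ :=
  GRing.isDivringClosed.Build Omega (piso_dom_pred pisoG) piso_dom_divring.

Record piso_dom := PisoDom { piso_val : Omega; piso_valP : piso_val \in piso_dom_pred pisoG }.

HB.instance Definition _ := [isSub for piso_val].
HB.instance Definition _ := [Choice of piso_dom by <:].
HB.instance Definition _ := [SubChoice_isSubComUnitRing of piso_dom by <:].
HB.instance Definition _ := [SubComUnitRing_isSubIntegralDomain of piso_dom by <:].
HB.instance Definition _ := [SubIntegralDomain_isSubField of piso_dom by <:].

Fact piso_val_zmod : zmod_morphism piso_val. Proof. by []. Qed.
Fact piso_val_monoid : monoid_morphism piso_val. Proof. by []. Qed.
HB.instance Definition _ :=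
  GRing.isZmodMorphism.Build piso_dom Omega piso_val piso_val_zmod.
HB.instance Definition _ :=
  GRing.isMonoidMorphism.Build piso_dom Omega piso_val piso_val_monoid.

Definition piso_map (x : piso_dom) : Omega :=
  projT1 (cid (asboolW (piso_valP x))).

Lemma piso_mapP x : G (piso_val x, piso_map x).
Proof. by rewrite /piso_map; case: cid. Qed.

Lemma piso_map_unique x y : G (piso_val x, y) -> piso_map x = y.
Proof.
move=> Gxy; apply/eqP; rewrite -subr_eq0; apply/eqP/(piso_fun pisoG).
by rewrite -(subrr (piso_val x)); apply: piso_sub => //; apply: piso_mapP.
Qed.

Fact piso_map_zmod : zmod_morphism piso_map.
Proof. by move=> x y; apply: piso_map_unique; apply: piso_sub => //; apply: piso_mapP. Qed.

Fact piso_map_monoid : monoid_morphism piso_map.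
Proof.
have G1 : G (1, 1) by have := piso_base pisoG 1; rewrite rmorph1.
split=> [|x y]; first exact: piso_map_unique.
apply: piso_map_unique.
have GV : G ((piso_val y)^-1, (piso_map y)^-1).
  by have := piso_div pisoG G1 (piso_mapP y); rewrite !div1r.
rewrite -[piso_map y]invrK rmorphM /= -[piso_val y]invrK.
exact: piso_div (piso_mapP x) GV.
Qed.

HB.instance Definition _ :=
  GRing.isZmodMorphism.Build piso_dom Omega piso_map piso_map_zmod.
HB.instance Definition _ :=
  GRing.isMonoidMorphism.Build piso_dom Omega piso_map piso_map_monoid.

Definition piso_in (c : F) : piso_dom :=
  @PisoDom (phi c) (asboolT (ex_intro _ (phi c) (piso_base pisoG c))).

Lemma piso_in_val c : piso_val (piso_in c) = phi c. Proof. by []. Qed.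

Lemma piso_in_map c : piso_map (piso_in c) = phi c.
Proof. by apply: piso_map_unique; exact: (piso_base pisoG c). Qed.

Fact piso_in_zmod : zmod_morphism piso_in.
Proof. by move=> c d; apply: val_inj; rewrite /= rmorphB. Qed.
Fact piso_in_monoid : monoid_morphism piso_in.
Proof. by split=> [|c d]; apply: val_inj; rewrite /= ?rmorph1 ?rmorphM. Qed.
HB.instance Definition _ := GRing.isZmodMorphism.Build F piso_dom piso_in piso_in_zmod.
HB.instance Definition _ := GRing.isMonoidMorphism.Build F piso_dom piso_in piso_in_monoid.

End Domain.

End PartialIsomorphisms.

Lemma irreducible_annihilator (D E : fieldType) (i : {rmorphism D -> E}) (z : E) :
  algebraicOver i z -> exists2 p, irreducible_poly p & root (map_poly i p) z.
Proof.
move=> [p0 np0 p0z].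
pose P n := `[< exists p : {poly D}, [/\ p != 0, root (map_poly i p) z & size p = n] >].
have exP : exists n, P n by exists (size p0); apply/asboolP; exists p0.
case: (ex_minnP exP) => n /asboolP[p [np pz sp]] minp; exists p => //.
have min_p q : q != 0 -> root (map_poly i q) z -> (size p <= size q)%N.
  by move=> nq qz; rewrite sp; apply: minp; apply/asboolP; exists q.
split.
  rewrite ltnNge; apply/negP => /size1_polyC pC.
  move: pz np; rewrite pC map_polyC rootC fmorph_eq0 polyC_eq0.
  by move=> /eqP->; rewrite eqxx.
move=> q sq dqp; have [nq nr] : q != 0 /\ (p %/ q)%R != 0.
  split; first by apply: contraTneq dqp => ->; rewrite dvd0p.
  by apply: contra_neq np => r0; rewrite -(divpK dqp) r0 mul0r.
move: pz; rewrite -{1}(divpK dqp) rmorphM rootM => /orP[] qz; last first.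
  rewrite -dvdp_size_eqp // eqn_leq dvdp_leq //=; exact: min_p.
have := min_p _ nr qz; have := size_mul nr nq; rewrite divpK // => ->.
rewrite -subn1 leq_subLR addnC leq_add2r.
have : (0 < size q)%N by rewrite size_poly_gt0.
by case: (size q) sq => [|[]].
Qed.

Section AutomorphismExtension.

Variables (F : fieldType) (Omega : closedFieldType) (phi : {rmorphism F -> Omega}).
Hypothesis Omega_algebraic : forall z : Omega, algebraicOver phi z.

(** [z] is a root of an irreducible polynomial over the domain of [G]. Its image under the partial
    map has a root [z'] in the algebraically closed [Omega], and adjoining [(z, z')] gives a larger
    graph, hence [G] itself. *)
Lemma maximal_partial_iso_total (G : set (Omega * Omega)) (z : Omega) :
    partial_iso phi G ->
    (forall B, partial_iso phi B -> G `<=` B -> B `<=` G) ->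
  exists z', G (z, z').
Proof.
move=> pisoG maxG; pose D := piso_dom pisoG.
have algz : algebraicOver (@piso_val _ _ _ _ pisoG) z.
  have [p np pz] := Omega_algebraic z; exists (map_poly (piso_in pisoG) p).
    by rewrite map_poly_eq0.
  by rewrite -map_poly_comp.
have [p irr_p pz] := irreducible_annihilator algz.
have [z' pz'] : exists z', root (map_poly (@piso_map _ _ _ _ pisoG) p) z'.
  by apply/closed_rootP; rewrite size_map_poly; have [+ _] := irr_p; case: (size p) => [|[]].
exists z'; apply: (maxG _ (partial_iso_adjoin _ irr_p pz pz')).
- by move=> c; exists (piso_in pisoG c); [exact: piso_in_val | exact: piso_in_map].
- move=> [x y] Gxy; have Dx : x \in piso_dom_pred pisoG by apply/asboolP; exists y.
  exists (PisoDom Dx)%:P; rewrite !map_polyC !hornerC; congr pair.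
  by apply/esym/piso_map_unique.
- by exists 'X; rewrite !map_polyX !hornerX.
Qed.

Lemma automorphism_extension (p : {poly F}) (a b : Omega) :
    irreducible_poly p -> root (map_poly phi p) a -> root (map_poly phi p) b ->
  exists tau : Omega -> Omega,
    [/\ field_hom_over phi phi tau, bijective tau & tau a = b].
Proof.
move=> irr_p pa pb; pose base (G : set (Omega * Omega)) := G !=set0 ->
  partial_iso phi G /\ G (a, b).
have [|G [domG maxG]] := @Zorn_bigcup _ base.
  move=> C domC totC [w [X CX Xw]].
  have good Y y : C Y -> Y y -> partial_iso phi Y /\ Y (a, b).
    by move=> CY Yy; apply: domC => //; exists y.
  have [pX Xab] := good _ _ CX Xw; split; last by exists X.
  have two u v : (\bigcup_(Y in C) Y) u -> (\bigcup_(Y in C) Y) v ->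
      exists Y, [/\ C Y, partial_iso phi Y, Y u & Y v].
    move=> [Y CY Yu] [Z CZ Zv]; have [YZ|ZY] := totC _ _ CY CZ.
      by exists Z; split=> //; [have [] := good _ _ CZ Zv | apply: YZ].
    by exists Y; split=> //; [have [] := good _ _ CY Yu | apply: ZY].
  split.
  - by move=> c; exists X => //; exact: (piso_base pX c).
  - move=> x y x' y' Gx Gx'; have [Y [CY pY Yu Yv]] := two _ _ Gx Gx'.
    by exists Y => //; exact: (piso_sub pY Yu Yv).
  - move=> x y x' y' Gx Gx'; have [Y [CY pY Yu Yv]] := two _ _ Gx Gx'.
    by exists Y => //; exact: (piso_div pY Yu Yv).
  - by move=> y [Y CY Yy]; have [pY _] := good _ _ CY Yy; apply: (piso_fun pY).
  - by move=> y [Y CY Yy]; have [pY _] := good _ _ CY Yy; apply: (piso_inj pY).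
(* The empty graph is not maximal: the isomorphism from [F(a)] to [F(b)] lies above it. *)
have [G_ge|G_ge] := pselect (G !=set0); last first.
  have G0 : G = set0 by apply/seteqP; split=> // x Gx; case: G_ge; exists x.
  have baseF c : exists2 d, phi d = phi c & phi d = phi c by exists c.
  have piso0 := partial_iso_adjoin baseF irr_p pa pb.
  case: (maxG _ _ (fun _ => conj piso0 _)); last first.
    by exists 'X; rewrite !map_polyX !hornerX.
  rewrite G0; split=> // /(_ (a, b)); apply.
  by exists 'X; rewrite !map_polyX !hornerX.
have [pisoG Gab] := domG G_ge.
have maxG' B : partial_iso phi B -> G `<=` B -> B `<=` G.
  move=> pB GB; apply: contrapT => nBG; apply: (maxG B); first by split.
  by move=> _; split=> //; apply: GB.
have tot z := maximal_partial_iso_total z pisoG maxG'.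
(* Surjectivity is totality of the transposed graph, which is maximal as well. *)
have surj z : exists z', G (z', z).
  apply: (maximal_partial_iso_total z (partial_iso_transpose pisoG)).
  move=> B pB GB [x y] /= Bxy; apply: (maxG' _ (partial_iso_transpose pB)) => //=.
  by move=> [u v] /= Guv; apply: (GB (v, u)).
pose tau z := projT1 (cid (tot z)); pose rho z := projT1 (cid (surj z)).
have tauP z : G (z, tau z) by rewrite /tau; case: cid.
have rhoP z : G (rho z, z) by rewrite /rho; case: cid.
have tau_eq z y : G (z, y) -> tau z = y.
  move=> Gzy; apply/eqP; rewrite -subr_eq0; apply/eqP/(piso_fun pisoG).
  by rewrite -(subrr z); exact: (piso_sub pisoG).
have rho_eq z y : G (y, z) -> rho z = y.
  move=> Gzy; apply/eqP; rewrite -subr_eq0; apply/eqP/(piso_inj pisoG).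
  by rewrite -(subrr z); exact: (piso_sub pisoG).
have G1 : G (1, 1) by have := piso_base pisoG 1; rewrite rmorph1.
have GV x y : G (x, y) -> G (x^-1, y^-1).
  by move=> /(piso_div pisoG G1); rewrite !div1r.
exists tau; split; last exact: tau_eq.
  split=> [x y||c]; last by apply: tau_eq; exact: (piso_base pisoG c).
    by apply: tau_eq; exact: (piso_sub pisoG).
  split; first exact: tau_eq.
  move=> x y; apply: tau_eq; rewrite -[y in X in (X, _)]invrK -[tau y]invrK.
  by apply: (piso_div pisoG) => //; apply: GV.
by exists rho => z; [apply: rho_eq | apply: tau_eq].
Qed.

End AutomorphismExtension.

(** * The rational parameter of the generic cubic cover *)

(* [ring] does not use the equation [3 = 0]; [z] is the cofactor of 3. *)
Lemma char3_eq (R : comPzRingType) (x y z : R) : 3 = 0 :> R -> x = y + 3 * z -> x = y.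
Proof. by move=> -> ->; rewrite mul0r addr0. Qed.

Section RationalParameter.

Variables (K : closedFieldType) (lam c b : K).
Hypotheses (char3 : 3 = 0 :> K) (lam0 : lam != 0) (lam1 : lam != 1).
Hypotheses (c_lam : c * (1 + lam) = -1) (b_lam : b = lam * c ^+ 2).

Let c_neq0 : c != 0.
Proof. by apply: contra_eq_neq c_lam => ->; rewrite mul0r eq_sym oppr_eq0 oner_eq0. Qed.

(** As a function of the coordinate, [x = t^2 (t - 1) / (c (t - b))], with a simple pole at [t = b].
    That [b] differs from 0 and 1 means that numerator and denominator are coprime. *)
Lemma simple_pole_neq0 : b != 0.
Proof. by rewrite b_lam mulf_neq0 ?expf_neq0. Qed.

Lemma simple_pole_neq1 : b != 1.
Proof.
apply: contra_neq lam1 => b1; apply/eqP; rewrite -subr_eq0.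
have : c ^+ 2 * (lam - 1) ^+ 2 == 0.
  rewrite (_ : _ * _ = (c * (1 + lam)) ^+ 2 - b - 3 * b); last by rewrite b_lam; ring.
  by rewrite char3 c_lam b1; apply/eqP; ring.
by rewrite mulf_eq0 !expf_eq0 (negPf c_neq0).
Qed.

(** In characteristic 3 the [t]-derivative of [t^3 - t^2 - c x t + c b x] is [t - c x], so a double
    root over [x = a] can only be [t = c a]. The value there is [c^3 f(a)], which locates the branch
    points at the zeros of [f]. *)
Let branch_value a : (c * a) ^+ 3 - (c * a) ^+ 2 - c * a * (c * a) + c * a * b =
  c ^+ 3 * (a * (a - 1) * (a - lam)).
Proof.
apply: (char3_eq (z := - (c * a) ^+ 2) char3); rewrite b_lam.
have -> : c ^+ 3 * (a * (a - 1) * (a - lam)) =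
  c ^+ 3 * a ^+ 3 - (c * (1 + lam)) * c ^+ 2 * a ^+ 2 + c ^+ 3 * lam * a by ring.
by rewrite c_lam; ring.
Qed.

Variables (E : fieldType) (phi : {rmorphism {fraction {poly K}} -> E}).
Variable t : E.

Let iota := const_emb phi.
Let x : E := phi 'X%:F.

Hypothesis t_eq : t ^+ 3 - t ^+ 2 = iota c * (t - iota b) * x.
Hypothesis t_gen : generates_over_const phi t.

Let x_not_const a : x <> iota a.
Proof.
move=> xa; apply: (@local_param_not_const K E phi (Some 0) a).
by rewrite -/iota -xa /= subr0.
Qed.

Let x_neq0 : x != 0.
Proof. by apply/eqP => x0; apply: (x_not_const (a := 0)); rewrite x0 rmorph0. Qed.

Let t_not_const a : t <> iota a.
Proof.
move=> ta; move: t_eq.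
rewrite ta -!(rmorphXn iota) -!(rmorphB iota) -(rmorphM iota) => e.
have [ab|nab] := eqVneq a b.
  move: e; rewrite ab subrr mulr0 rmorph0 mul0r => /eqP; rewrite (fmorph_eq0 iota).
  rewrite (_ : b ^+ 3 - b ^+ 2 = b ^+ 2 * (b - 1)); last by ring.
  by rewrite mulf_eq0 expf_eq0 (negPf simple_pole_neq0) subr_eq0 (negPf simple_pole_neq1).
have nd : c * (a - b) != 0 by rewrite mulf_neq0 // subr_eq0.
apply: (@x_not_const ((a ^+ 3 - a ^+ 2) / (c * (a - b)))).
by rewrite (fmorph_div iota) e mulrC mulKf // (fmorph_eq0 iota).
Qed.

Let t_shift_neq0 a : t - iota a != 0.
Proof. by rewrite subr_eq0; apply/eqP/t_not_const. Qed.

Let t_neq0 : t != 0.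
Proof. by have := t_shift_neq0 0; rewrite rmorph0 subr0. Qed.

Let gen_shift a : generates_over_const phi (t - iota a).
Proof.
move=> S subS SK Ss; apply: (t_gen subS SK).
have [_ SB _] := subS; have := SB _ _ Ss (SK (- a)).
by rewrite (rmorphN iota) opprK subrK.
Qed.

Let gen_inv : generates_over_const phi t^-1.
Proof.
move=> S subS SK Ss; apply: (t_gen subS SK).
by have [S1 _ SV] := subS; have := SV _ _ S1 Ss; rewrite div1r invrK.
Qed.

Variables (V : set E) (placeV : is_place phi V) (P : option K).
Hypothesis overP : lies_over phi V P.

Let mP : place_ideal V (phi (local_param P)) := overP.

(** If every [t - iota a] were a unit, so would be every nonzero polynomial in [t], as polynomials
    split over [K]; then [V] would be all of [K(t)]. *)
Let residue : V t -> exists a, place_ideal V (t - iota a).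
Proof.
move=> Vt; apply: contrapT => nres.
have Ut a : place_units V (t - iota a).
  have Va : V (t - iota a).
    by apply: (place_sub placeV) => //; apply: (place_const placeV).
  have [//|ma] := place_unit_or_ideal Va.
  by case: nres; exists a.
have Uev p : ev phi t p != 0 -> place_units V (ev phi t p).
  have [r ->] := closed_field_poly_normal p.
  rewrite /ev map_polyZ hornerZ mulf_eq0 negb_or fmorph_eq0 => /andP[nl _].
  apply: (place_unitM placeV); first exact: place_unit_const.
  rewrite rmorph_prod horner_prod.
  apply: big_ind => //; first exact: (place_unit1 placeV).
    by move=> *; apply: (place_unitM placeV).
  by move=> a _; rewrite rmorphB /= map_polyX map_polyC hornerXsubC; apply: Ut.
apply: (place_proper placeV); apply/seteqP; split=> // y _.
have [p [q [nq ->]]] := generates_ev y t_gen.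
have [->|np] := eqVneq (ev phi t p) 0; first by rewrite mul0r; apply: (place_const0 placeV).
apply: (place_mul placeV); first by have [] := Uev _ np.
by have [] := Uev _ nq.
Qed.

Let unit_shift a d : place_ideal V (t - iota a) -> a != d -> place_units V (t - iota d).
Proof.
move=> ma nad; have -> : t - iota d = iota (a - d) + (t - iota a).
  by rewrite rmorphB; ring.
by apply: (place_unitD placeV) => //; apply: (place_unit_const placeV); rewrite subr_eq0.
Qed.

Let shift_ram a u e : place_ideal V (t - iota a) -> place_units V u ->
  phi (local_param P) = u * (t - iota a) ^+ e -> ram_index phi V P e.
Proof.
move=> ma Uu uE; exists (t - iota a); split=> //; last by exists u.
by move=> y my; apply: (generates_uniformizer placeV) my.
Qed.

(** The function [x] of [t] has a double pole at infinity and a simple one at [t = b]. Over a finite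
    value [d], a point [t = a] contributes the factor [t - a] to [x - d], with cofactor
    [(t - a) (t - a - 1) + (a - c d)] up to a unit. The zero is double exactly when [a = c d], and
    not triple, [t - a - 1] being a unit. *)
Lemma rational_parameter_ramification : exists2 e, ram_index phi V P e &
  e = 1%N \/ e = 2%N /\ (P = None \/ exists2 a, P = Some a & a * (a - 1) * (a - lam) = 0).
Proof.
have Uc : place_units V (iota c) by apply: (place_unit_const placeV).
have iota_c0 : iota c != 0 by rewrite (fmorph_eq0 iota).
have xV : x^-1 = iota c * (t - iota b) / (t ^+ 3 - t ^+ 2).
  by rewrite t_eq; field; rewrite iota_c0 x_neq0 t_shift_neq0.
have t1 : t - 1 != 0 by have := t_shift_neq0 1; rewrite rmorph1.
have t32 : t ^+ 3 - t ^+ 2 != 0.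
  by rewrite (_ : _ - _ = t ^+ 2 * (t - 1)) ?mulf_neq0 ?expf_neq0 //; ring.
have [Vt|nVt] := pselect (V t); last first.
  have mt := place_idealV placeV nVt.
  have U1 : place_units V (1 - t^-1).
    exact/(place_unit1D placeV)/(place_idealN placeV).
  have Ub : place_units V (1 - iota b * t^-1).
    apply/(place_unit1D placeV)/(place_idealN placeV).
    by apply: (place_idealMl placeV) => //; apply: (place_const placeV).
  have UU := place_unitM placeV (place_unitM placeV Uc Ub) (place_unitV U1).
  have {}xV : x^-1 = iota c * (1 - iota b * t^-1) / (1 - t^-1) * t^-1 ^+ 2.
    by rewrite xV; field; rewrite t_neq0 t1 t32.
  have mxV : place_ideal V x^-1.
    rewrite xV expr2 mulrA; apply: (place_idealMl placeV) => //.
    by apply: (place_mul placeV); [have [] := UU | case: mt].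
  have nVx : ~ V x.
    by move=> Vx; case: mxV => VxV []; split; rewrite ?invr_eq0 ?invrK.
  exists 2%N.
    exists t^-1; split=> //.
      by move=> y; apply: (generates_uniformizer placeV) => //; rewrite invr_eq0.
    exists (iota c * (1 - iota b * t^-1) / (1 - t^-1)) => //.
    move: mP; case: (P) => [a|] mPa; last by rewrite -xV /= fmorphV.
    case: nVx; rewrite -[x](subrK (iota a)); apply: (place_add placeV).
      by move/place_ideal_sub: mPa; rewrite /= !rmorphB.
    exact: (place_const placeV).
  right; split=> //; left; move: mP; case: (P) => [a|] mPa //.
  case: nVx; rewrite -[x](subrK (iota a)); apply: (place_add placeV).
    by move/place_ideal_sub: mPa; rewrite /= !rmorphB.
  exact: (place_const placeV).
have [a ma] := residue Vt.
have Vconst d : V (iota d) := place_const placeV d.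
case: (P) (mP) (@shift_ram a) => [d|] /= mPd ram; last first.
  rewrite fmorphV -/x in mPd ram.
  have ab : a = b.
    apply/eqP; rewrite -subr_eq0; apply/eqP/(place_const_ideal placeV).
    rewrite (_ : const_emb phi (a - b) = x^-1 * ((t ^+ 3 - t ^+ 2) / iota c) - (t - iota a)).
      apply: (place_idealB placeV) => //; apply: (place_idealMr placeV) => //.
      apply: (place_mul placeV); last by rewrite -fmorphV.
      by apply: (place_sub placeV); apply: (place_exp placeV).
    by rewrite t_eq -/iota rmorphB; field; rewrite iota_c0 x_neq0.
  exists 1%N; last by left.
  have Ut0 := unit_shift (d := 0) ma; have Ut1 := unit_shift (d := 1) ma.
  rewrite rmorph0 subr0 in Ut0; rewrite rmorph1 in Ut1.
  apply: (ram (iota c / (t ^+ 2 * (t - 1)))) => //.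
    apply: (place_unitM placeV Uc); apply: place_unitV.
    apply: (place_unitM placeV); last by apply: Ut1; rewrite ab simple_pole_neq1.
    by apply: (place_unitX placeV); apply: Ut0; rewrite ab simple_pole_neq0.
  by rewrite xV ab expr1; field; rewrite t_neq0 t1 t32.
have {}ram u e := ram u e ma; rewrite !rmorphB -/x -/(iota d) in mPd ram.
(* The cubic equation reduced modulo the place, where [t] becomes [a] and [x] becomes [d]. *)
have Na : a ^+ 3 - a ^+ 2 - c * d * a + c * d * b = 0.
  apply: (place_const_ideal placeV); rewrite -/iota.
  rewrite (_ : iota _ = (x - iota d) * (iota c * (t - iota b)) -
    (t - iota a) * (t ^+ 2 + (iota a - 1) * t + (iota a ^+ 2 - iota a - iota c * iota d))).
    apply: (place_idealB placeV); apply: (place_idealMr placeV) => //.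
      by apply: (place_mul placeV) => //; apply: (place_sub placeV).
    have V1 := place_const1 placeV.
    apply: (place_add placeV); last first.
      by do !apply: (place_sub placeV) => //; rewrite -?rmorphXn -?rmorphM.
    apply: (place_add placeV); first exact: (place_exp placeV).
    by apply: (place_mul placeV) => //; apply: (place_sub placeV).
  rewrite mulrBl [x * _]mulrC -t_eq.
  rewrite !(rmorphD iota, rmorphN iota, rmorphM iota, rmorphXn iota); ring.
have nab : a != b.
  apply: contra_eq_neq Na => ->.
  rewrite (_ : _ + _ = b ^+ 2 * (b - 1)); last by ring.
  by rewrite mulf_neq0 ?expf_neq0 ?subr_eq0 ?simple_pole_neq0 ?simple_pole_neq1.
have Utb := unit_shift ma nab.
have xdE : x - iota d = (t - iota a) / (iota c * (t - iota b)) *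
    (t ^+ 2 + (iota a - 1) * t + (iota a ^+ 2 - iota a - iota c * iota d)).
  have := congr1 iota Na.
  rewrite !(rmorphD iota, rmorphN iota, rmorphM iota, rmorphXn iota, rmorph0 iota) => Na'.
  have ntb : t - iota b != 0 by [].
  apply: (mulfI (mulf_neq0 iota_c0 ntb)).
  rewrite mulrBr -t_eq !mulrA; apply/eqP; rewrite -subr_eq0 -Na'; apply/eqP.
  by field; rewrite iota_c0 ntb.
have UD := place_unitV (place_unitM placeV Uc Utb).
have M1E : t ^+ 2 + (iota a - 1) * t + (iota a ^+ 2 - iota a - iota c * iota d) =
    (t - iota a) * ((t - iota a) - 1) + iota (a - c * d).
  have := congr1 iota char3; rewrite rmorph0 -[3](natrD _ 1 2) => E3.
  have E3' : 3 = 0 :> E by rewrite -E3 rmorph_nat.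
  apply: (char3_eq (z := iota a * t - iota a) E3'); rewrite rmorphB rmorphM; ring.
have Ua1 : place_units V (t - iota a - 1).
  rewrite addrC; apply: (place_unitD placeV) => //.
  by rewrite -(rmorph1 iota) -rmorphN; apply: (place_unit_const placeV); rewrite oppr_eq0 oner_eq0.
have [acd|nacd] := eqVneq (a - c * d) 0.
  exists 2%N.
    apply: (ram ((iota c * (t - iota b))^-1 * (t - iota a - 1))).
      exact: (place_unitM placeV).
    by rewrite xdE M1E acd rmorph0 addr0; ring.
  right; split=> //; right; exists d => //.
  have ca3 : c ^+ 3 != 0 by rewrite expf_neq0.
  apply: (mulfI ca3); rewrite -branch_value mulr0 -Na.
  by have -> : a = c * d by apply/eqP; rewrite -subr_eq0 acd.
exists 1%N; last by left.
apply: (ram ((iota c * (t - iota b))^-1 * ((t - iota a) * (t - iota a - 1) + iota (a - c * d)))).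
  apply: (place_unitM placeV) => //; rewrite addrC; apply: (place_unitD placeV).
    exact: (place_unit_const placeV).
  by apply: (place_idealMr placeV) => //; case: Ua1.
by rewrite xdE M1E; ring.
Qed.

End RationalParameter.

(** * Normal form of cubic covers *)

Lemma frac_repr (R : idomainType) (h : {fraction R}) :
  exists N D : R, D != 0 /\ h = N%:F / D%:F.
Proof.
elim/quotW: h => x; have dx : \d_x != 0 := denom_ratioP x.
exists \n_x, \d_x; split=> //.
have ndx : (\d_x)%:F != 0 by rewrite tofrac_eq0.
apply: (canRL (mulfK ndx)).
rewrite -[LHS]/(FracField.mul _ _) !piE.
apply/eqmodP; rewrite /= FracField.equivfE /FracField.mulf.
by rewrite !numden_Ratio ?mulr1 ?mul1r ?oner_eq0 // mulrC.
Qed.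

Lemma closed_cube_root (K : closedFieldType) (z : K) : exists r, r ^+ 3 = z.
Proof.
have /closed_rootP[r] : size ('X^3 - z%:P) != 1.
  by rewrite size_XnsubC.
by rewrite /root !hornerE subr_eq0 => /eqP; exists r.
Qed.

Lemma frac_cancelr (F : fieldType) (x y z : F) : z != 0 -> x * z / (y * z) = x / y.
Proof. by move=> nz; rewrite -mulf_div divff // mulr1. Qed.

Section NormalForm.

Variables (K : closedFieldType) (lam : K).
Hypotheses (char3 : 3 = 0 :> K) (lam0 : lam != 0) (lam1 : lam != 1).

Definition branch_poly : {poly K} := 'X * ('X - 1%:P) * ('X - lam%:P).

Let f := branch_poly.

Lemma branch_polyE : f = 'X^3 - (1 + lam) *: 'X^2 + lam *: 'X.
Proof. by rewrite /f /branch_poly -!mul_polyC !rmorphD /= polyC1; ring. Qed.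

Lemma horner_branch_poly a : f.[a] = a * (a - 1) * (a - lam).
Proof. by rewrite /f /branch_poly !hornerE. Qed.

Lemma size_branch_poly : size f = 4.
Proof.
rewrite /f /branch_poly !size_mul ?mulf_neq0 ?polyX_eq0 ?polyXsubC_eq0 //.
by rewrite size_polyX !size_XsubC.
Qed.

Lemma branch_poly_neq0 : f != 0.
Proof. by rewrite -size_poly_eq0 size_branch_poly. Qed.

Variable A : set {fraction {poly K}}.

(* [A] stands for the set of the [h] such that a given cubic cover is defined
   by [u^3 - f u = h]; [A_shift] is the change of variable [u := u + r]. *)
Hypothesis A_shift : forall h r, A h -> A (h + r ^+ 3 - f%:F * r).
Hypothesis A_pole : forall a n p q h, A h -> p.[a] != 0 -> q.[a] != 0 ->
  h * (('X - a%:P) ^+ n * q)%:F = p%:F -> (0 < n)%N -> (3 %| n)%N.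
Hypothesis A_zero : forall a p, f.[a] = 0 -> A (('X - a%:P) * p)%:F -> p.[a] = 0.
Hypothesis A_infinity : forall p : {poly K}, A p%:F -> (5 < size p)%N -> (3 %| (size p).-1)%N.

Let A_shift_poly p r : A p%:F -> A (p + r ^+ 3 - f * r)%:F.
Proof. by move=> /(A_shift r%:F); rewrite -tofracXn -tofracM -tofracD -tofracB. Qed.

(** At a pole [a] the order is [3 s] by [A_pole]. Shifting by [r = - kap / (X - a)^s], with [kap] a
    cube root of the leading coefficient, cancels the leading term through [r^3], while [f r] has a
    pole of order at most [s]. The new numerator vanishes at [a], so a factor of the denominator
    cancels. *)
Let clear_poles n (N D : {poly K}) : (size D <= n)%N -> D != 0 -> A (N%:F / D%:F) ->
  exists p : {poly K}, A p%:F.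
Proof.
clearbody f; elim: n N D => [|n IHn] N D; first by rewrite leqn0 size_poly_eq0 => ->.
move=> sD nD AND; have nDF : D%:F != 0 :> {fraction {poly K}} by rewrite tofrac_eq0.
have [/size1_polyC DC|D_gt1] := leqP (size D) 1.
  have nc : D`_0 != 0 by apply: contraNneq nD => c0; rewrite DC c0.
  exists ((D`_0)^-1 *: N); rewrite (_ : _%:F = N%:F / D%:F) //.
  apply: (canRL (mulfK nDF)); rewrite -rmorphM; congr (_%:F).
  by rewrite [X in _ * X]DC -mulrC mul_polyC scalerA divff // scale1r.
have /closed_rootP[a Da] : size D != 1 by rewrite gtn_eqF.
have reduce N' D' : D = ('X - a%:P) * D' -> A (N'%:F / D'%:F) -> exists p : {poly K}, A p%:F.
  move=> DE; have nD' : D' != 0 by apply: contraNneq nD => D0; rewrite DE D0 mulr0.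
  apply: IHn => //; rewrite -ltnS; apply: leq_trans sD.
  by rewrite DE size_mul ?polyXsubC_eq0 // size_XsubC.
have [Na|nNa] := boolP (root N a).
  have [N' NE] := factor_theorem _ _ Na; have [D' DE] := factor_theorem _ _ Da.
  apply: (reduce N' D'); first by rewrite mulrC.
  suff <- : N%:F / D%:F = N'%:F / D'%:F by [].
  rewrite NE DE !tofracM; apply: frac_cancelr.
  by rewrite tofrac_eq0 polyXsubC_eq0.
have [m [q + DE]] := multiplicity_XsubC D a; rewrite nD /= => nqa.
have m_gt0 : (0 < m)%N.
  by case: m DE => // DE; case/negP: nqa; move: Da; rewrite DE mulr1.
have qE : D = ('X - a%:P) ^+ m * q by rewrite mulrC.
have /dvdnP[s mE] : (3 %| m)%N.
  by apply: (A_pole AND nNa nqa) m_gt0; rewrite -qE divfK.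
have s_gt0 : (0 < s)%N by move: m_gt0; rewrite mE; case: (s).
have [kap kapE] := closed_cube_root (N.[a] / q.[a]).
pose X1 : {fraction {poly K}} := ('X - a%:P)%:F.
have nX1 : X1 != 0 by rewrite tofrac_eq0 polyXsubC_eq0.
have nq : q%:F != 0 :> {fraction {poly K}}.
  by rewrite tofrac_eq0; apply: contraNneq nqa => ->; rewrite root0.
pose N1 := N - kap ^+ 3 *: q + kap *: (f * ('X - a%:P) ^+ (2 * s) * q).
have N1a : root N1 a.
  rewrite /root /N1 !hornerE subrr expr0n muln_eq0 (gtn_eqF s_gt0) /=.
  by rewrite kapE divfK // subrr !(mulr0, mul0r) addr0.
have [N' NE] := factor_theorem _ _ N1a; have [D' DE'] := factor_theorem _ _ Da.
apply: (reduce N' D'); first by rewrite mulrC.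
have := A_shift (- (kap%:P)%:F / X1 ^+ s) AND.
suff -> : N%:F / D%:F + (- (kap%:P)%:F / X1 ^+ s) ^+ 3 - f%:F * (- (kap%:P)%:F / X1 ^+ s) =
  N'%:F / D'%:F by [].
transitivity (N1%:F / D%:F); last first.
  rewrite NE DE' !tofracM; exact: (frac_cancelr _ _ nX1).
have -> : D%:F = X1 ^+ s ^+ 3 * q%:F :> {fraction {poly K}}.
  by rewrite qE tofracM tofracXn -/X1 mE exprM.
have -> : N1%:F = N%:F - (kap%:P)%:F ^+ 3 * q%:F +
    (kap%:P)%:F * (f%:F * (X1 ^+ s) ^+ 2 * q%:F) :> {fraction {poly K}}.
  by rewrite /N1 /X1 -!mul_polyC -exprM mulnC polyC_exp !(tofracXn, tofracM, tofracD, tofracN).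
have key (L : fieldType) (n' d k g y : L) : d != 0 -> y != 0 ->
    n' / (y ^+ 3 * d) + (- k / y) ^+ 3 - g * (- k / y) =
    (n' - k ^+ 3 * d + k * (g * y ^+ 2 * d)) / (y ^+ 3 * d).
  by move=> nd ny; field; rewrite nd ny.
exact: key nq (expf_neq0 s nX1).
Qed.

(** The same cancellation at infinity: a polynomial of degree [3 s] with [s >= 2] loses its leading
    term to [r = - kap X^s], because [f r] has degree [s + 3 < 3 s]. The bound is degree 4, since
    [h^2] dominates [f^3] at infinity only from degree 5 on. *)
Let lower_degree n (p : {poly K}) : (size p <= n)%N -> A p%:F ->
  exists p' : {poly K}, A p'%:F /\ (size p' <= 5)%N.
Proof.
elim: n p => [|n IHn] p sp Ap; first by exists p; rewrite (leq_trans sp).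
have [p5|p5] := leqP (size p) 5; first by exists p.
have /dvdnP[s sE] := A_infinity Ap p5.
have spE : size p = (3 * s).+1 by rewrite mulnC -sE prednK // (leq_trans _ p5).
have s_ge2 : (1 < s)%N by move: p5; rewrite spE; case: (s) => [|[|]].
have [kap kapE] := closed_cube_root (lead_coef p).
apply: (IHn (p + (- kap *: 'X^s) ^+ 3 - f * (- kap *: 'X^s))); last exact: A_shift_poly.
rewrite -ltnS; apply: leq_trans sp; rewrite spE ltnS.
rewrite exprZn -exprM mulnC; apply/leq_sizeP => i le_si.
rewrite !coefB coefD !coefZ coefXn.
have -> : (f * (- kap *: 'X^s))`_i = 0.
  apply/leq_sizeP: i le_si; rewrite -scalerAr (leq_trans (size_scale_leq _ _)) //.
  rewrite size_mul ?branch_poly_neq0 ?monic_neq0 ?monicXn // size_branch_poly size_polyXn.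
  by rewrite addnS /= mulSn addnC leq_add2l (leq_mul2l 2 2).
rewrite subr0; have [iE|ni] := eqVneq i (3 * s)%N.
  have -> : p`_i = lead_coef p by rewrite lead_coefE spE iE.
  by rewrite mulr1 -kapE; ring.
rewrite mulr0 addr0 nth_default // spE ltn_neqAle eq_sym ni; exact: le_si.
Qed.

(** Once the degree is at most 4, a quadratic shift makes [h] vanish at the three zeros of [f],
    doubly by [A_zero]. So [f^2] divides a polynomial of degree at most 6, and only a scalar remains
    to be determined. *)
Lemma cubic_cover_normal_form : A !=set0 ->
  exists kap, A (kap ^+ 3 *: f ^+ 2)%:F /\ (kap = 0 \/ kap ^+ 2 * (1 + lam) = -1).
Proof.
case=> h Ah.
have [p0 Ap0] : exists p : {poly K}, A p%:F.
  have [N [D [nD hE]]] := frac_repr h; apply: (@clear_poles _ N D (leqnn _) nD).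
  by rewrite -hE.
have [p [Ap sp]] := lower_degree (leqnn _) Ap0.
have [r0 r0E] := closed_cube_root (- p.[0]).
have [r1 r1E] := closed_cube_root (- p.[1]).
have [rl rlE] := closed_cube_root (- p.[lam]).
(* Newton interpolation: [r] takes the values [r0], [r1], [rl] at 0, 1, [lam], so that [r^3] cancels
   [p] there. *)
pose r := r0%:P + (r1 - r0) *: 'X +
  ((rl - r0 - (r1 - r0) * lam) / (lam * (lam - 1))) *: ('X * ('X - 1%:P)).
have sr : (size r <= 3)%N.
  rewrite (leq_trans (size_polyD _ _)) // geq_max (leq_trans (size_polyD _ _)) /=.
    rewrite (leq_trans (size_scale_leq _ _)) // size_mul ?polyX_eq0 ?polyXsubC_eq0 //.
    by rewrite size_polyX size_XsubC.
  rewrite geq_max (leq_trans (size_polyC_leq1 _)) //=.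
  by rewrite (leq_trans (size_scale_leq _ _)) // size_polyX.
pose g := p + r ^+ 3 - f * r.
have Ag : A g%:F by apply: A_shift_poly.
have sg : (size g <= 7)%N.
  rewrite (leq_trans (size_polyD _ _)) // geq_max size_polyN; apply/andP; split.
    rewrite (leq_trans (size_polyD _ _)) // geq_max (leq_trans sp) //=.
    rewrite (leq_trans (size_poly_exp_leq _ _)) // ltnS.
    by case: (size r) sr => [|[|[|[]]]].
  rewrite (leq_trans (size_polyMleq _ _)) // size_branch_poly.
  by case: (size r) sr => [|[|[|[]]]].
have double_root a : f.[a] = 0 -> g.[a] = 0 -> (('X - a%:P) ^+ 2 %| g)%R.
  move=> fa /eqP/factor_theorem[g1 gE]; rewrite gE mulrC dvdp_mul2l ?polyXsubC_eq0 //.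
  rewrite dvdp_XsubCl; apply/eqP; apply: (A_zero fa); by rewrite mulrC -gE.
have fg : (f ^+ 2 %| g)%R.
  have cop (a b : K) : a != b -> coprimep (('X - a%:P) ^+ 2) (('X - b%:P) ^+ 2).
    move=> nab; rewrite coprimep_expl // coprimep_expr //.
    by rewrite coprimep_XsubC root_XsubC eq_sym.
  have l1 : 1 != lam by rewrite eq_sym.
  have l0 : 0 != lam by rewrite eq_sym.
  have o0 : 0 != 1 :> K by rewrite eq_sym oner_eq0.
  have -> : f = ('X - 0%:P) * ('X - 1%:P) * ('X - lam%:P) by rewrite polyC0 subr0.
  have h12 := cop 0 1 o0.
  have h3 : coprimep (('X - 0%:P) ^+ 2 * ('X - 1%:P) ^+ 2) (('X - lam%:P) ^+ 2).
    by rewrite coprimepMl !cop.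
  rewrite 2!exprMn (Gauss_dvdp _ h3) (Gauss_dvdp _ h12).
  have fa a : a * (a - 1) * (a - lam) = 0 -> f.[a] = 0 by rewrite horner_branch_poly.
  have f0 : f.[0] = 0 by apply: fa; rewrite !mul0r.
  have f1 : f.[1] = 0 by apply: fa; rewrite subrr mulr0 mul0r.
  have fl : f.[lam] = 0 by apply: fa; rewrite subrr mulr0.
  have gval a : f.[a] = 0 -> r.[a] ^+ 3 = - p.[a] -> g.[a] = 0.
    move=> fa0 ra; rewrite /g hornerD hornerN hornerM fa0 mul0r subr0 hornerD horner_exp.
    by rewrite ra subrr.
  have l1' : lam - 1 != 0 by rewrite subr_eq0.
  have rval a : r.[a] = r0 + (r1 - r0) * a +
      (rl - r0 - (r1 - r0) * lam) / (lam * (lam - 1)) * (a * (a - 1)).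
    by rewrite /r !hornerE.
  have g0 : g.[0] = 0.
    by apply: (gval _ f0); rewrite rval -r0E; congr (_ ^+ 3); ring.
  have g1 : g.[1] = 0.
    by apply: (gval _ f1); rewrite rval -r1E; congr (_ ^+ 3); ring.
  have gl : g.[lam] = 0.
    by apply: (gval _ fl); rewrite rval -rlE; congr (_ ^+ 3); field; rewrite l1' lam0.
  by rewrite !double_root.
have nf2 : f ^+ 2 != 0 by rewrite expf_neq0 ?branch_poly_neq0.
have [d gE] : exists d : K, g = d *: f ^+ 2.
  have /dvdpP[q gE] := fg; suff /size1_polyC qC : (size q <= 1)%N.
    by exists q`_0; rewrite gE {1}qC mul_polyC.
  have [->|nq] := eqVneq q 0; first by rewrite size_poly0.
  move: sg; rewrite gE size_mul // expr2 size_mul ?branch_poly_neq0 //.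
  by rewrite size_branch_poly addnC.
have [kap kapE] := closed_cube_root d; exists kap; rewrite kapE -gE; split=> //.
(* A last shift removes [X^6] from [kap^3 f^2] and leaves [e] as coefficient of [X^5]. Degree 5 is
   prime to 3, hence forbidden, and [e = 0] is the alternative in the conclusion. *)
have /A_infinity := A_shift_poly (- kap *: 'X^2) Ag.
set p1 := _ - _; pose e := kap ^+ 3 * (1 + lam) + kap.
have p1E : p1 = e *: 'X^5 + (
    (kap ^+ 3 * ((1 + lam) ^+ 2 + 2 * lam) - kap * (1 + lam)) *: 'X^4 +
    (kap * lam - kap ^+ 3 * 2 * lam * (1 + lam)) *: 'X^3 +
    (kap ^+ 3 * lam ^+ 2) *: 'X^2).
  have char3P : 3 = 0 :> {poly K} by rewrite -polyC_natr char3 polyC0.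
  apply: (char3_eq (z := - ((kap ^+ 3 * (1 + lam)) *: 'X^5)) char3P).
  rewrite /p1 gE -kapE branch_polyE /e -!mul_polyC.
  by rewrite !(rmorphD, rmorphN, rmorphM, rmorphXn) /= polyC1; ring.
have [e0 _|ne] := eqVneq e 0.
  have : kap * (kap ^+ 2 * (1 + lam) + 1) == 0.
    by rewrite -e0 /e; apply/eqP; ring.
  rewrite mulf_eq0 => /orP[/eqP->|]; [by left | by rewrite addr_eq0 => /eqP->; right].
have sp1 : size p1 = 6.
  rewrite p1E size_polyDl size_scale ?size_polyXn //.
  rewrite ltnS !(leq_trans (size_polyD _ _)) // geq_max; apply/andP; split; last first.
    by rewrite (leq_trans (size_scale_leq _ _)) ?size_polyXn.
  rewrite (leq_trans (size_polyD _ _)) // geq_max.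
  by rewrite !(leq_trans (size_scale_leq _ _)) ?size_polyXn.
by rewrite sp1 => /(_ isT).
Qed.

End NormalForm.

Lemma clear_cubic_denominator (R : idomainType) (a b n d : R) (v : {fraction R}) :
  v * d%:F = n%:F -> v ^+ 3 - (a%:F * v + b%:F) = 0 ->
  n ^+ 3 = d ^+ 2 * (a * n + b * d).
Proof.
move=> vd /eqP; rewrite subr_eq0 => /eqP v3; apply/eqP; rewrite -tofrac_eq.
rewrite !(tofracXn, tofracM, tofracD) -vd exprMn v3; apply/eqP; ring.
Qed.

(** * The explicit cubic cover: irreducibility, rational coordinate, tameness *)

Section GenericCubicCover.

Variables (K : closedFieldType) (lam kap : K).
Hypotheses (char3 : 3 = 0 :> K) (lam0 : lam != 0) (lam1 : lam != 1).
Hypothesis kapE : kap ^+ 2 * (1 + lam) = -1.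

Local Notation F := {fraction {poly K}}.
Local Notation f := (branch_poly lam).

Lemma kap_neq0 : kap != 0.
Proof.
by apply: contra_eq_neq kapE => ->; rewrite expr0n mul0r eq_sym oppr_eq0 oner_eq0.
Qed.

Definition cubic_poly : {poly F} :=
  'X^3 - (f%:F *: 'X + ((kap ^+ 3 *: f ^+ 2)%:F)%:P).

Lemma size_cubic_tail (F' : fieldType) (a b : F') : (size (a *: 'X + b%:P)%R <= 2)%N.
Proof.
rewrite (leq_trans (size_polyD _ _)) // geq_max (leq_trans (size_scale_leq _ _)) ?size_polyX //.
by rewrite (leq_trans (size_polyC_leq1 _)).
Qed.

Lemma size_cubic_poly : size cubic_poly = 4.
Proof.
rewrite size_polyDl size_polyXn // size_polyN.
by rewrite (leq_ltn_trans (size_cubic_tail _ _)).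
Qed.

Lemma horner_cubic_poly (E : fieldType) (phi : {rmorphism F -> E}) z :
  (map_poly phi cubic_poly).[z] = z ^+ 3 - (phi f%:F * z + phi (kap ^+ 3 *: f ^+ 2)%:F).
Proof.
rewrite /cubic_poly rmorphB rmorphD /= map_polyXn map_polyZ map_polyX map_polyC.
by rewrite !hornerE.
Qed.

(** A root would vanish at 0, 1 and [lam], so have degree [n >= 3]; then [v^3] has degree [3 n],
    more than both [n + 3] and [6]. *)
Lemma cubic_no_polynomial_root (v : {poly K}) : v ^+ 3 - f * v <> kap ^+ 3 *: f ^+ 2.
Proof.
move=> vE; have nf := branch_poly_neq0 lam.
have nf2 : f ^+ 2 != 0 by rewrite expf_neq0.
have nk3 : kap ^+ 3 != 0 by rewrite expf_neq0 ?kap_neq0.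
have nv : v != 0.
  apply: contra_eq_neq vE => ->; rewrite expr0n mulr0 subr0 eq_sym.
  by rewrite scale_poly_eq0 negb_or nk3.
have va a : f.[a] = 0 -> root v a.
  move=> fa; have := congr1 (horner^~ a) vE.
  rewrite /= hornerD hornerN hornerZ !horner_exp hornerM fa mul0r subr0.
  by rewrite expr0n mulr0 => /eqP; rewrite expf_eq0.
have sv : (3 < size v)%N.
  apply: (@max_poly_roots _ v [:: 0; 1; lam] nv).
    by rewrite /= !va // horner_branch_poly ?subrr ?mulr0 ?mul0r.
  by rewrite /= !inE negb_or eq_sym oner_eq0 [0 == lam]eq_sym lam0 eq_sym lam1.
have sf := size_branch_poly lam.
have sf2 : size (f ^+ 2) = 7 by rewrite expr2 size_mul // sf.
have sv3 : size (v ^+ 3) = (3 * (size v).-1).+1.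
  have := size_exp v 3; rewrite mulnC => <-; rewrite prednK //.
  by rewrite size_poly_gt0 expf_neq0.
have : (size (v ^+ 3) <= maxn (size (f * v)%R) 7)%N.
  rewrite -[v ^+ 3](subrK (f * v)) vE (leq_trans (size_polyD _ _)) // geq_max.
  rewrite leq_max size_scale // sf2 leqnn orbT /=.
  by rewrite leq_max leqnn.
rewrite sv3 size_mul // sf leq_max; move: (size v) sv => n n3 le; lia.
Qed.

Lemma cubic_poly_irreducible : irreducible_poly cubic_poly.
Proof.
apply: cubic_irreducible => [|v]; first by rewrite size_cubic_poly.
apply/negP => /rootP; have := horner_cubic_poly idfun v.
rewrite map_poly_id // => -> /= vE.
have [N0 [D0 [nD0 vND]]] := frac_repr v.
have ng : gcdp N0 D0 != 0 by rewrite gcdp_eq0 (negPf nD0) andbF.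
set g := gcdp N0 D0 in ng; pose N := (N0 %/ g)%R; pose D := (D0 %/ g)%R.
have DE : D0 = D * g by rewrite divpK // dvdp_gcdr.
have NE : N0 = N * g by rewrite divpK // dvdp_gcdl.
have cND : coprimep N D by apply: coprimep_div_gcd; rewrite nD0 orbT.
have nD : D != 0 by apply: contraNneq nD0 => D00; rewrite DE D00 mul0r.
have nDF : D%:F != 0 :> F by rewrite tofrac_eq0.
have {vND}vND : v * D%:F = N%:F.
  rewrite vND DE NE !tofracM frac_cancelr ?tofrac_eq0 // mulfVK //.
have eqF : N ^+ 3 = D ^+ 2 * (f * N + kap ^+ 3 *: f ^+ 2 * D).
  exact: clear_cubic_denominator vND vE.
(* [D] divides [N^3] and is coprime to it, so a rational root is a polynomial. *)
have /size1_polyC DC : (size D <= 1)%N.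
  have : coprimep (N ^+ 3) D by rewrite coprimep_expl.
  rewrite eqF expr2 -mulrA coprimepMl coprimepp => /andP[/eqP-> _] //.
move: (nD); rewrite DC polyC_eq0 => nd.
apply: (@cubic_no_polynomial_root ((D`_0)^-1 *: N)).
set M := _ *: N; have NM : N = M * D.
  by rewrite DC mulrC mul_polyC scalerA divff // scale1r.
have vM : v * 1%:F = M%:F.
  rewrite tofrac1 mulr1; apply: (mulIf nDF); rewrite vND -tofracM.
  exact: (congr1 _ NM).
have := clear_cubic_denominator vM vE.
by rewrite expr1n mul1r mulr1 => ->; rewrite addrAC subrr add0r.
Qed.

End GenericCubicCover.

Lemma base_in_subfield (K : fieldType) (E : fieldType)
    (phi : {rmorphism {fraction {poly K}} -> E}) (S : set E) :
  is_subfield S -> (forall a, S (const_emb phi a)) -> S (phi 'X%:F) ->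
  forall h, S (phi h).
Proof.
move=> [S1 SB SV] SK SX h.
have S0 : S 0 by rewrite -(subrr 1); apply: SB.
have SN y : S y -> S (- y) by move=> Sy; rewrite -sub0r; apply: SB.
have SM y z : S y -> S z -> S (y * z).
  by move=> Sy Sz; rewrite -[z]invrK -[z^-1]div1r; apply: (SV) => //; apply: SV.
have Spoly p : S (phi p%:F).
  elim/poly_ind: p => [|p c IHp]; first by rewrite tofrac0 rmorph0.
  rewrite tofracD tofracM rmorphD rmorphM -[phi (p%:F) * _]opprK addrC.
  by apply: SB; [exact: SK | apply/SN/SM].
have [N [D [_ ->]]] := frac_repr h; rewrite fmorph_div; exact: SV.
Qed.

Lemma primitive_subfield (F0 : fieldType) (L : fieldExtType F0) (v : L) (S : set L) :
    <<1; v>>%VS = fullv -> is_subfield S ->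
  (forall h, S (in_alg L h)) -> S v -> forall y, S y.
Proof.
move=> v_gen [S1 SB SV] SF Sv y.
have S0 : S 0 by rewrite -(subrr 1); apply: SB.
have SN u : S u -> S (- u) by move=> Su; rewrite -sub0r; apply: SB.
have SM u z : S u -> S z -> S (u * z).
  by move=> Su Sz; rewrite -[z]invrK -[z^-1]div1r; apply: (SV) => //; apply: (SV).
have : y \in <<1; v>>%VS by rewrite v_gen memvf.
case/Fadjoin_polyP => p /polyOverP p1 ->; rewrite horner_coef.
apply: big_ind => // [u z Su Sz|i _].
  by rewrite -[z]opprK; apply: SB => //; apply: SN.
apply: (SM); first by have /vlineP[c ->] := p1 i; rewrite -[c *: 1]/(in_alg L c).
by elim: (nat_of_ord i) => // n IHn; rewrite exprS; apply: (SM).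
Qed.

Section CubicParameter.

Variables (K : closedFieldType) (lam kap : K).
Hypotheses (char3 : 3 = 0 :> K) (lam0 : lam != 0) (lam1 : lam != 1).
Hypothesis kapE : kap ^+ 2 * (1 + lam) = -1.

Local Notation F := {fraction {poly K}}.
Local Notation f := (branch_poly lam).

Variables (E : fieldType) (phi : {rmorphism F -> E}).
Let iota := const_emb phi.
Let x := phi 'X%:F.

Lemma phi_branch_poly : phi f%:F = x * (x - 1) * (x - iota lam).
Proof. by rewrite /branch_poly !tofracM !rmorphM !tofracB !rmorphB tofrac1 rmorph1. Qed.

Lemma phi_cubic_const : phi (kap ^+ 3 *: f ^+ 2)%:F = iota kap ^+ 3 * phi f%:F ^+ 2.
Proof.
rewrite -mul_polyC polyC_exp tofracM tofracXn tofracXn.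
by rewrite (rmorphM phi) (rmorphXn phi) (rmorphXn phi).
Qed.

Lemma branch_poly_emb_neq0 : phi f%:F != 0.
Proof. by rewrite fmorph_eq0 tofrac_eq0 branch_poly_neq0. Qed.

Variable v : E.
Hypothesis vE : v ^+ 3 - phi f%:F * v = phi (kap ^+ 3 *: f ^+ 2)%:F.

Lemma cubic_root_neq0 : v != 0.
Proof.
apply: contra_eq_neq vE => ->; rewrite expr0n mulr0 subr0 eq_sym phi_cubic_const.
rewrite mulf_neq0 ?expf_neq0 ?branch_poly_emb_neq0 // fmorph_eq0.
exact: (kap_neq0 kapE).
Qed.

(** Passing to a multiple of [1 / v] reverses the cubic: [f] now occurs only in the constant term,
    and modulo a finite branch point the equation becomes [T^2 (T - 1)]. *)
Lemma reduced_root_eq (w := - (iota (kap ^+ 3) * phi f%:F / v)) :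
  w ^+ 3 - w ^+ 2 + iota (kap ^+ 6) * phi f%:F = 0.
Proof.
have nv := cubic_root_neq0; have v3 := vE; rewrite phi_cubic_const in v3.
rewrite /w !(rmorphXn iota).
move: (phi f%:F) (iota kap) v3 nv => g k v3 nv.
have -> : (- (k ^+ 3 * g / v)) ^+ 3 - (- (k ^+ 3 * g / v)) ^+ 2 + k ^+ 6 * g =
    k ^+ 6 * g / v ^+ 3 * ((v ^+ 3 - g * v) - k ^+ 3 * g ^+ 2) by field.
by rewrite v3 subrr mulr0.
Qed.

(** This is [t = c x + w] with [c = kap^2] and [w] the reduced root. As cubing is additive,
    [(t - c x)^3] cancels the [x^3] term of [c^3 f], and [c (1 + lam) = -1] cancels the [x^2]
    terms. *)
Definition cubic_parameter : E := iota (kap ^+ 2) * x - iota (kap ^+ 3) * phi f%:F / v.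

Lemma cubic_parameter_eq : cubic_parameter ^+ 3 - cubic_parameter ^+ 2 =
  iota (kap ^+ 2) * (cubic_parameter - iota (lam * (kap ^+ 2) ^+ 2)) * x.
Proof.
have c3 : 3 = 0 :> E by have := congr1 iota char3; rewrite rmorph_nat rmorph0.
have kE : iota kap ^+ 2 * (1 + iota lam) = -1.
  by rewrite -(rmorph1 iota) -(rmorphD iota) -(rmorphXn iota) -(rmorphM iota) kapE rmorphN rmorph1.
have gE := phi_branch_poly; have := reduced_root_eq.
rewrite /cubic_parameter; set w := - (_ / v) => w3.
move: w3; rewrite !(rmorphXn iota, rmorphM iota).
move: w (phi f%:F) (iota kap) (iota lam) x kE gE => w g k l y kE gE w3.
apply: (char3_eq (z := w ^+ 2 * k ^+ 2 * y + w * k ^+ 4 * y ^+ 2 -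
  k ^+ 2 * y * w - k ^+ 4 * y ^+ 2) c3).
have g6 : k ^+ 6 * g = k ^+ 6 * y ^+ 3 - (k ^+ 2 * (1 + l)) * k ^+ 4 * y ^+ 2 + k ^+ 6 * l * y.
  by rewrite gE; ring.
rewrite kE in g6; apply/eqP; rewrite -subr_eq0 -{1}w3 g6; apply/eqP; ring.
Qed.

End CubicParameter.

Section GenericCubicCoverTame.

Variables (K : closedFieldType) (lam kap : K).
Hypotheses (pchar3 : 3%N \in [pchar K]) (lam0 : lam != 0) (lam1 : lam != 1).
Hypothesis kapE : kap ^+ 2 * (1 + lam) = -1.

Local Notation F := {fraction {poly K}}.
Local Notation f := (branch_poly lam).

Let char3 : 3 = 0 :> K. Proof. by have /andP[_ /eqP] := pchar3. Qed.

(** The equation, linear in [x], gives [x] from [t]; then [w = t - c x], and [v] is a multiple of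
    [1 / w] by an element of [K(x)]. *)
Lemma cubic_parameter_generates (E : fieldType) (phi : {rmorphism F -> E}) (v : E) :
    v ^+ 3 - phi f%:F * v = phi (kap ^+ 3 *: f ^+ 2)%:F ->
    (forall S : set E, is_subfield S -> (forall h, S (phi h)) -> S v -> forall y, S y) ->
  generates_over_const phi (cubic_parameter lam kap phi v).
Proof.
move=> vE gen_v S subS SK St; have [S1 SB SV] := subS.
have tE := cubic_parameter_eq char3 kapE vE.
have nv := cubic_root_neq0 kapE vE.
set t := cubic_parameter _ _ _ _ in St tE.
have S0 : S 0 by rewrite -(subrr 1); apply: SB.
have SM y z : S y -> S z -> S (y * z).
  by move=> Sy Sz; rewrite -[z]invrK -[z^-1]div1r; apply: (SV) => //; apply: (SV).
have SX y n : S y -> S (y ^+ n).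
  by move=> Sy; elim: n => // n IHn; rewrite exprS; apply: SM.
set iota := const_emb phi in SK tE.
have ntb : t - iota (lam * (kap ^+ 2) ^+ 2) != 0.
  apply/eqP => tb; move: tE; rewrite tb mulr0 mul0r => /eqP.
  have -> : t = iota (lam * (kap ^+ 2) ^+ 2) by apply/eqP; rewrite -subr_eq0 tb.
  rewrite -!(rmorphXn iota) -(rmorphB iota) (fmorph_eq0 iota).
  set b := lam * _; have bE : b = lam * (kap ^+ 2) ^+ 2 by [].
  have nb0 := simple_pole_neq0 lam0 kapE bE; have nb1 := simple_pole_neq1 char3 lam1 kapE bE.
  rewrite (_ : _ - _ = b ^+ 2 * (b - 1)); last by ring.
  by rewrite mulf_eq0 expf_eq0 (negPf nb0) subr_eq0 (negPf nb1).
have nk : iota (kap ^+ 2) != 0 by rewrite (fmorph_eq0 iota) expf_neq0 ?(kap_neq0 kapE).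
have Sx : S (phi 'X%:F).
  rewrite -[phi _](mulKf (mulf_neq0 nk ntb)) -tE mulrC.
  by apply: SV; [apply: SB; apply: SX | apply: SM => //; apply: SB].
have Sphi := base_in_subfield subS SK Sx.
apply: gen_v => //; pose w := t - iota (kap ^+ 2) * phi 'X%:F.
have Sw : S w by apply: SB => //; apply: SM.
have nf := branch_poly_emb_neq0 lam phi.
have nk3 : iota (kap ^+ 3) != 0 by rewrite (fmorph_eq0 iota) expf_neq0 ?(kap_neq0 kapE).
have vw : v = - (iota (kap ^+ 3) * phi f%:F) / w.
  rewrite /w /t /cubic_parameter -/iota.
  have -> : iota (kap ^+ 2) * phi 'X%:F - iota (kap ^+ 3) * phi f%:F / v -
      iota (kap ^+ 2) * phi 'X%:F = - (iota (kap ^+ 3) * phi f%:F) / v by ring.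
  have key (a u : E) : a != 0 -> u != 0 -> u = - a / (- a / u).
    by move=> na nu; field; rewrite nu oppr_eq0 na.
  exact: key (mulf_neq0 nk3 nf) nv.
by rewrite vw; apply: (SV) => //; rewrite -sub0r; apply: SB => //; apply: SM.
Qed.

Lemma cubic_cover_ramification (E : fieldType) (phi : {rmorphism F -> E}) (v : E) V P :
    v ^+ 3 - phi f%:F * v = phi (kap ^+ 3 *: f ^+ 2)%:F ->
    (forall S : set E, is_subfield S -> (forall h, S (phi h)) -> S v -> forall y, S y) ->
    is_place phi V -> lies_over phi V P ->
  exists2 e, ram_index phi V P e & e = 1%N \/
    e = 2%N /\ (P = None \/ exists2 a, P = Some a & a * (a - 1) * (a - lam) = 0).
Proof.
move=> vE gen_v placeV overP.
exact: (rational_parameter_ramification char3 lam0 lam1 kapE erefl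
  (cubic_parameter_eq char3 kapE vE) (cubic_parameter_generates vE gen_v) placeV overP).
Qed.

Section FieldExtension.

Variables (L : fieldExtType F) (v : L).
Hypotheses (v_root : root (map_poly (in_alg L) (cubic_poly lam kap)) v).
Hypothesis v_gen : <<1; v>>%VS = fullv.

Lemma cubic_extension_root :
  v ^+ 3 - in_alg L f%:F * v = in_alg L (kap ^+ 3 *: f ^+ 2)%:F.
Proof.
move/rootP: v_root; rewrite horner_cubic_poly => /eqP.
by rewrite opprD addrA subr_eq0 => /eqP.
Qed.

(** In characteristic 3 the derivative of the cubic is the nonzero constant [- f]. *)
Lemma cubic_extension_separable : separable 1%VS {:L}.
Proof.
have char3L : 3 = 0 :> L.
  have := congr1 (const_emb (in_alg L)) char3.
  by rewrite rmorph_nat rmorph0.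
have sep_v : separable_element 1 v.
  apply/separable_elementP; exists (map_poly (in_alg L) (cubic_poly lam kap)).
  split=> //; first by apply/polyOverP => i; rewrite coef_map /= rpredZ ?mem1v.
  have char3F : 3 = 0 :> {poly F}.
    by rewrite -(rmorph_nat (polyC \o @FracField.tofrac _ \o polyC)) /= char3 !rmorph0.
  rewrite unlock deriv_map.
  have -> : (cubic_poly lam kap)^`() = (- f%:F) *: 1.
    rewrite /cubic_poly derivB derivD derivZ derivX derivC derivXn addr0.
    by rewrite -mulr_natl char3F mul0r sub0r scaleNr.
  rewrite map_polyZ rmorph1 coprimepZr ?coprimep1 //.
  by rewrite fmorph_eq0 oppr_eq0 tofrac_eq0 branch_poly_neq0.
by apply/separableP => y _; apply: (adjoin_separableP sep_v); rewrite v_gen memvf.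
Qed.

Lemma cubic_extension_tame (r : nat) (Q : 'I_r -> option K) :
    (forall P, P = None \/ (exists2 a, P = Some a & a * (a - 1) * (a - lam) = 0) ->
      range Q P) ->
  tame_cover Q L.
Proof.
move=> branchQ; split; first exact: cubic_extension_separable.
move=> V P placeV overP.
have [e ramP e12] :=
  cubic_cover_ramification cubic_extension_root (fun S => @primitive_subfield _ L v S v_gen)
    placeV overP.
exists e => //; case: asboolP => [_|nQP].
  move=> p pK; have -> : p = 3%N by have := pcharf_eq pchar3 p; rewrite pK => /esym/eqP.
  by case: e12 => [->|[->]].
by case: e12 => [//|[_ /branchQ]].
Qed.

End FieldExtension.

Lemma generic_cubic_extension : exists (L : fieldExtType F) (v : L),
  [/\ \dim {:L} = 3, root (map_poly (in_alg L) (cubic_poly lam kap)) v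
    & <<1; v>>%VS = fullv].
Proof.
have irr : irreducible_poly (cubic_poly lam kap) by apply: cubic_poly_irreducible.
have [L dimL [v rv gv]] := irredp_FAdjoin irr.
by exists L, v; rewrite dimL size_cubic_poly.
Qed.

End GenericCubicCoverTame.

(** * From tameness at all places to the normal form of a cubic cover *)

Section PolynomialsAtPlaces.

Variables (K E : fieldType) (phi : {rmorphism {fraction {poly K}} -> E}).
Variables (V : set E) (placeV : is_place phi V).

Lemma place_poly_integral a (p : {poly K}) :
  lies_over phi V (Some a) -> V (phi p%:F).
Proof.
move=> overP; have Vx : V (phi 'X%:F).
  have := place_add placeV (place_ideal_sub overP) (place_const placeV a).
  by rewrite -rmorphD -tofracD subrK.
elim/poly_ind: p => [|p c IHp]; first by rewrite tofrac0 rmorph0; apply: (place_const0 placeV).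
rewrite tofracD tofracM rmorphD rmorphM; apply: (place_add placeV).
  exact: (place_mul placeV).
exact: (place_const placeV).
Qed.

Lemma place_ideal_poly a (p : {poly K}) :
  lies_over phi V (Some a) -> p.[a] = 0 -> place_ideal V (phi p%:F).
Proof.
move=> overP /rootP/factor_theorem[q ->]; rewrite tofracM rmorphM.
by apply: (place_idealMl placeV) => //; apply: place_poly_integral overP.
Qed.

Lemma place_unit_poly a (p : {poly K}) :
  lies_over phi V (Some a) -> p.[a] != 0 -> place_units V (phi p%:F).
Proof.
move=> overP pa; rewrite -[p](addrNK p.[a]%:P) tofracD rmorphD addrC.
apply: (place_unitD placeV); first exact: (place_unit_const placeV).
by apply: place_ideal_poly overP _; rewrite !hornerE subrr.
Qed.

Lemma place_poly_infinity (p : {poly K}) : lies_over phi V None -> p != 0 ->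
  exists2 b, place_units V b &
    phi p%:F = b * phi (local_param None) ^ (- ((size p).-1)%:Z).
Proof.
move=> overP np; set pi := phi (local_param None).
have piE : pi = (phi 'X%:F)^-1 by exact: fmorphV.
have nX : phi 'X%:F != 0 by rewrite fmorph_eq0 tofrac_eq0 polyX_eq0.
have npi : pi != 0 by rewrite piE invr_eq0.
have Xpi : phi 'X%:F * pi = 1 by rewrite piE divff.
have small d (q : {poly K}) : (size q <= d)%N -> place_ideal V (phi q%:F * pi ^+ d).
  elim: d q => [|d IHd] q.
    rewrite leqn0 size_poly_eq0 => /eqP->; rewrite tofrac0 rmorph0 mul0r.
    exact: (place_ideal0 placeV).
  move=> sq; have [r [c [qE sr]]] : exists r c, q = r * 'X + c%:P /\ (size r <= d)%N.
    elim/poly_ind: q sq => [|r c _] sq.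
      by exists 0, 0; rewrite polyC0 mul0r addr0 size_poly0.
    exists r, c; split=> //; have [->|nr] := eqVneq r 0; first by rewrite size_poly0.
    by move: sq; rewrite size_MXaddC (negPf nr).
  rewrite qE tofracD tofracM rmorphD rmorphM mulrDl exprS.
  apply: (place_idealD placeV).
    by rewrite [pi * _]mulrC mulrACA Xpi mulr1; apply: IHd.
  apply: (place_idealMl placeV); first exact: (place_const placeV).
  apply: (place_idealMr placeV) => //; apply: (place_exp placeV).
  exact: place_ideal_sub overP.
pose d := (size p).-1; exists (phi p%:F * pi ^+ d); last first.
  by rewrite -mulrA exprnP -expfzDr // subrr expr0z mulr1.
have [q pE sq] : exists2 q, p = lead_coef p *: 'X^d + q & (size q <= d)%N.
  exists (p - lead_coef p *: 'X^d); first by rewrite addrCA subrr addr0.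
  apply/leq_sizeP => i le_di; rewrite coefB coefZ coefXn lead_coefE -/d.
  have [->|ni] := eqVneq i d; first by rewrite mulr1 subrr.
  rewrite mulr0 subr0 nth_default //; move: le_di; rewrite leq_eqVlt eq_sym (negPf ni) /=.
  by rewrite /d prednK ?size_poly_gt0.
rewrite pE tofracD rmorphD mulrDl; apply: (place_unitD placeV); last exact: small.
rewrite -mul_polyC tofracM tofracXn rmorphM rmorphXn -mulrA -exprMn Xpi expr1n mulr1.
by apply: (place_unit_const placeV); rewrite lead_coef_eq0.
Qed.

End PolynomialsAtPlaces.

Section TameCubicCovers.

Variables (K : closedFieldType) (lam : K).
Hypotheses (pchar3 : 3%N \in [pchar K]) (lam0 : lam != 0) (lam1 : lam != 1).

Local Notation F := {fraction {poly K}}.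
Local Notation f := (branch_poly lam).

Variables (r : nat) (Q : 'I_r -> option K) (L : fieldExtType F).
Hypothesis tameL : tame_cover Q L.

Let phi : {rmorphism F -> L} := in_alg L.
Let char3 : 3 = 0 :> K. Proof. by have /andP[_ /eqP] := pchar3. Qed.
Let char3L : 3 = 0 :> L.
Proof. by have := congr1 (const_emb phi) char3; rewrite rmorph_nat rmorph0. Qed.

Lemma tame_cover_exponent V P (u a b h : L) (m n : int) :
    is_place phi V -> lies_over phi V P -> place_units V a -> place_units V b ->
    phi f%:F = a * phi (local_param P) ^ m -> h = b * phi (local_param P) ^ n ->
    2 * n < 3 * m -> u ^+ 3 - phi f%:F * u = h ->
  (3 %| n)%Z.
Proof.
move=> placeV overP Ua Ub fE hE lt_nm uE.
have [_ /(_ V P placeV overP)[e [t [mt unif [c Uc piE]]] tame_e]] := tameL.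
have e3 : ~~ (3 %| e)%N.
  by move: tame_e; case: asboolP => _; [apply | move->].
have npi : phi (local_param P) != 0.
  by apply/eqP => pi0; apply: (@local_param_not_const K L phi P 0); rewrite rmorph0.
have nt : t != 0.
  apply: contraNneq npi => t0; apply/eqP; apply: (etrans piE); rewrite t0 expr0n.
  by have -> : e == 0 = false; [case: (e) e3 | rewrite mulr0].
exact: (tame_cubic_exponent placeV mt nt unif overP Uc piE e3 Ua fE Ub hE lt_nm uE).
Qed.

(** Each local hypothesis on [A] is [tame_cover_exponent] at a place above the point concerned.
    Keeping [u] outside the base field survives the shifts by elements of [F], so the final root
    still generates a cubic [L]. *)
Lemma tame_cubic_normal_form (u0 : L) (h0 : F) :
    u0 \notin 1%VS -> u0 ^+ 3 - phi f%:F * u0 = phi h0 ->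
  exists kap u, [/\ u \notin 1%VS, u ^+ 3 - phi f%:F * u = phi (kap ^+ 3 *: f ^+ 2)%:F
    & kap = 0 \/ kap ^+ 2 * (1 + lam) = -1].
Proof.
move=> nu0 u0E.
pose A : set F := [set h | exists2 u, u \notin 1%VS & u ^+ 3 - phi f%:F * u = phi h].
have nX1 (a : K) : (phi ('X - a%:P)%:F) != 0.
  by rewrite fmorph_eq0 tofrac_eq0 polyXsubC_eq0.
have f_at a V : is_place phi V -> lies_over phi V (Some a) -> exists m : nat,
    exists2 b, place_units V b & phi f%:F = b * phi (local_param (Some a)) ^ m%:Z /\
      (f.[a] = 0 -> (0 < m)%N).
  move=> placeV overP; have [m [q + fE]] := multiplicity_XsubC f a.
  rewrite branch_poly_neq0 implyTb => nqa; exists m, (phi q%:F).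
    exact: place_unit_poly overP nqa.
  split.
    by rewrite fE tofracM tofracXn rmorphM rmorphXn.
  move=> /eqP fa; case: m fE => // fE; case/negP: nqa; move: fa.
  by rewrite fE expr0 mulr1.
have [|||||kap [[u nu uE] kap_or]] := cubic_cover_normal_form char3 lam0 lam1 (A := A); last first.
  by exists kap, u.
- by exists h0, u0.
- move=> p [u nu uE] p5; have [V placeV overP] := place_lying_over phi None.
  have np : p != 0 by rewrite -size_poly_gt0; apply: leq_trans p5.
  have [b Ub pE] := place_poly_infinity placeV overP np.
  have [a Ua fE] := place_poly_infinity placeV overP (branch_poly_neq0 lam).
  have := tame_cover_exponent placeV overP Ua Ub fE pE _ uE.
  rewrite size_branch_poly dvdzE abszN absz_nat; apply.
  by move: (size p) p5 => [|[|[|[|[|[|n]]]]]] // _; lia.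
- move=> a p fa [u nu uE]; apply/eqP; apply: contrapT => /negP pa.
  have [V placeV overP] := place_lying_over phi (Some a).
  have Up := place_unit_poly placeV overP pa.
  have [m [b Ub [fE m_gt0]]] := f_at _ _ placeV overP.
  have hE : phi (('X - a%:P) * p)%:F = phi p%:F * phi (local_param (Some a)) ^ 1%:Z.
    by rewrite mulrC tofracM rmorphM.
  have := tame_cover_exponent placeV overP Ub Up fE hE _ uE.
  by have := m_gt0 fa; case: (m) => // m' _ H; have: (3 %| 1)%Z by apply: H; lia.
- move=> a n p q h [u nu uE] pa qa hE n_gt0.
  have [V placeV overP] := place_lying_over phi (Some a).
  have Up := place_unit_poly placeV overP pa.
  have Uq := place_unit_poly placeV overP qa.
  have [m [b Ub [fE _]]] := f_at _ _ placeV overP.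
  have hE' : phi h = (phi p%:F / phi q%:F) * phi (local_param (Some a)) ^ (- n%:Z).
    have [nq _ _] := Uq.
    have key (H y z : L) : y != 0 -> z != 0 -> H = H * (y * z) / z * y^-1.
      by move=> ny nz; field; rewrite ny nz.
    rewrite -hE tofracM tofracXn (rmorphM phi) (rmorphM phi) (rmorphXn phi) -exprnN.
    exact: key (expf_neq0 n (nX1 a)) nq.
  have := tame_cover_exponent placeV overP Ub (place_unitM placeV Up (place_unitV Uq)) fE hE' _ uE.
  by rewrite dvdzE abszN absz_nat; apply; lia.
- move=> h s [u nu uE]; exists (u + phi s).
    by apply: contra nu => us; rewrite -[u](addrK (phi s)) rpredB // rpredZ ?mem1v.
  rewrite (rmorphB phi) (rmorphD phi) (rmorphXn phi) (rmorphM phi) -uE.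
  apply: (char3_eq (z := u ^+ 2 * phi s + u * phi s ^+ 2) char3L); ring.
Qed.

End TameCubicCovers.

(** * Depressed cubics in characteristic 3 *)

Section CubicExtensions.

Variables (F : fieldType) (L : fieldExtType F).
Hypothesis dimL : \dim {:L} = 3.

Lemma cubic_adjoin_degree (u : L) : u \notin 1%VS -> adjoin_degree 1 u = 3.
Proof.
move=> nu; have du : (adjoin_degree 1 u %| 3)%N.
  have := @field_dimS _ _ <<1; u>>%AS {:L}%AS (subvf _).
  by rewrite dimL dim_Fadjoin dimv1 muln1.
by apply/(prime_nt_dvdP _ _ du); rewrite // (adjoin_deg_eq1 1%AS).
Qed.

Lemma cubic_generator (u : L) : u \notin 1%VS -> <<1; u>>%VS = fullv.
Proof.
move=> nu; apply/eqP; rewrite eqEdim subvf dimL dim_Fadjoin dimv1 muln1.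
by rewrite (cubic_adjoin_degree nu).
Qed.

Lemma cubic_square_notin (u : L) (g : F) : u \notin 1%VS -> u ^+ 2 != in_alg L g.
Proof.
move=> nu; apply/negP => /eqP u2.
have s3 : size ('X^2 - (in_alg L g)%:P) = 3.
  by rewrite size_XnsubC.
have : root ('X^2 - (in_alg L g)%:P) u by rewrite /root !hornerE u2 subrr.
rewrite (root_small_adjoin_poly (K := 1%AS)) ?s3 ?cubic_adjoin_degree //.
  by rewrite -size_poly_eq0 s3.
by rewrite rpredB ?rpredX ?polyOverX // polyOverC rpredZ ?mem1v.
Qed.

Lemma cubic_equation (u : L) : u \notin 1%VS -> exists a b c : F,
  u ^+ 3 + in_alg L a * u ^+ 2 + in_alg L b * u + in_alg L c = 0.
Proof.
move=> nu; pose M := minPoly 1 u.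
have sM : size M = 4 by rewrite size_minPoly (cubic_adjoin_degree nu).
have coef i : exists c, M`_i = in_alg L c.
  by have /polyOverP /(_ i) /vlineP[c ->] := minPolyOver 1%AS u; exists c.
have [a aE] := coef 2; have [b bE] := coef 1; have [c cE] := coef 0.
exists a, b, c; rewrite -aE -bE -cE.
transitivity M.[u]; last exact/rootP/(root_minPoly 1%AS).
have m3 : M`_3 = 1 by have /monicP := monic_minPoly 1%AS u; rewrite lead_coefE -/M sM.
rewrite horner_coef sM !big_ord_recr big_ord0 /= m3; ring.
Qed.

(** In characteristic 3 a translation cannot remove the quadratic term [a w^2]. If [a = 0],
    separability makes the linear term nonzero. Otherwise the translation by [T = b / a] removes the
    linear term, its new coefficient being [3 b], and [w'^-1] satisfies the reversed, depressed
    equation. *)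
Lemma depressed_cubic : 3%N \in [pchar F] -> separable 1 {:L} ->
  exists (u : L) (p q : F), [/\ u \notin 1%VS, p != 0
    & u ^+ 3 - in_alg L p * u = in_alg L q].
Proof.
move=> pchar3 sepL; pose phi : {rmorphism F -> L} := in_alg L.
have phi1 c : phi c \in 1%VS by rewrite rpredZ ?mem1v.
have char3 : 3 = 0 :> L.
  have /andP[_ /eqP c3] := pchar3.
  by have := congr1 phi c3; rewrite rmorph_nat rmorph0.
have [w _ nw] : exists2 w, w \in {:L} & w \notin 1%VS.
  suff /subvPn[w] : ~~ ({:L} <= 1)%VS by exists w.
  by apply/negP => /dimvS; rewrite dimL dimv1.
have [a [b [c wE]]] := cubic_equation nw.
have {}wE : w ^+ 3 + phi a * w ^+ 2 + phi b * w + phi c = 0 := wE.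
have [a0|na] := eqVneq a 0.
  rewrite a0 (rmorph0 phi) mul0r addr0 in wE.
  exists w, (- b), (- c); split=> //; last first.
    suff : w ^+ 3 - phi (- b) * w = phi (- c) by [].
    by rewrite !(rmorphN phi) mulNr opprK; apply/eqP; rewrite -addr_eq0 wE.
  rewrite oppr_eq0; apply: contraNneq nw => b0.
  rewrite -(separable_inseparable_element 1%AS); apply/andP; split.
    by apply: (separableP sepL); apply: memvf.
  apply/purely_inseparable_elementP_pchar; exists 3%N.
    by rewrite pnatE // inE /= char3.
  rewrite b0 (rmorph0 phi) mul0r addr0 in wE.
  by rewrite (eqP (_ : w ^+ 3 == - phi c)) ?rpredN // -addr_eq0 wE.
have [T aT] : exists T, a * T = b by exists (b / a); rewrite mulrC divfK.
pose w' := w - phi T.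
have nw' : w' \notin 1%VS.
  by apply: contra nw => w1; rewrite -[w](subrK (phi T)) rpredD.
have w'0 : w' != 0 by apply: contraNneq nw' => ->; rewrite rpred0.
pose d := T ^+ 3 + a * T ^+ 2 + b * T + c.
have w'E : w' ^+ 3 + phi a * w' ^+ 2 + phi d = 0.
  have bE : phi b = phi a * phi T by rewrite -(rmorphM phi) aT.
  rewrite -wE /d !(rmorphD phi, rmorphXn phi, rmorphM phi) bE.
  apply: (char3_eq (z := w * phi T ^+ 2 - w ^+ 2 * phi T - phi a * phi T * w +
    phi a * phi T ^+ 2) char3).
  by rewrite /w'; ring.
have nd : d != 0.
  apply: contraNneq nw' => d0; move: w'E; rewrite d0 (rmorph0 phi) addr0.
  rewrite (_ : _ + _ = w' ^+ 2 * (w' + phi a)); last by ring.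
  move/eqP; rewrite mulf_eq0 expf_eq0 (negPf w'0) addr_eq0 => /eqP->.
  by rewrite rpredN.
have nphid : phi d != 0 by rewrite (fmorph_eq0 phi).
exists w'^-1, (- (a / d)), (- d^-1); split.
- by apply: contra nw' => u1; rewrite -[w']invrK rpredV.
- by rewrite oppr_eq0 mulf_neq0 ?invr_eq0.
suff : w'^-1 ^+ 3 - phi (- (a / d)) * w'^-1 = phi (- d^-1) by [].
rewrite !(rmorphN phi) (fmorph_div phi) (fmorphV phi).
apply/eqP; rewrite -subr_eq0; apply/eqP.
rewrite (_ : _ - _ = (w' ^+ 3 + phi a * w' ^+ 2 + phi d) / (phi d * w' ^+ 3)).
  by rewrite w'E mul0r.
by field; rewrite w'0 nphid.
Qed.

End CubicExtensions.

Section DepressedRoots.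

Variables (E : fieldType) (p q : E) (r : 'I_3 -> E).
Hypotheses (char3 : 3 = 0 :> E) (r_inj : injective r).
Hypothesis r_root : forall a, r a ^+ 3 - p * r a = q.

Lemma depressed_root_difference a b : a != b -> (r a - r b) ^+ 2 = p.
Proof.
move=> nab; have nr : r a - r b != 0 by rewrite subr_eq0 (inj_eq r_inj).
apply: (mulfI nr); have := congr2 (fun y z => y - z) (r_root a) (r_root b).
rewrite subrr => e; apply/eqP; rewrite -subr_eq0 -e.
apply/eqP; apply: (char3_eq (z := - (r a ^+ 2 * r b) + r a * r b ^+ 2) char3); ring.
Qed.

Definition root_step : E := r 1 - r 0.

Lemma root_step_square : root_step ^+ 2 = p.
Proof. exact: depressed_root_difference. Qed.

Lemma root_step_neq0 : root_step != 0.
Proof. by rewrite subr_eq0 (inj_eq r_inj). Qed.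

(** The differences of the other two roots with [r 0] are distinct square roots of [p], hence
    opposite, and [- root_step] equals [root_step *+ 2]. *)
Lemma root_stepE a : r a = r 0 + root_step *+ a.
Proof.
have eps0 := root_step_neq0.
have e2 : (r 2 - r 0) ^+ 2 = root_step ^+ 2.
  by rewrite root_step_square; apply: depressed_root_difference.
have r2 : r 2 = r 0 + root_step *+ 2.
  have : (r 2 - r 0 - root_step) * (r 2 - r 0 + root_step) == 0.
    by rewrite -subr_sqr e2 subrr.
  rewrite mulf_eq0 => /orP[/eqP e|/eqP e].
    have: r 2 = r 1 by apply/eqP; rewrite -subr_eq0 -e /root_step; apply/eqP; ring.
    by move/r_inj.
  apply: (char3_eq (z := - root_step) char3).
  by apply/eqP; rewrite -subr_eq0 -[X in _ == X]e; apply/eqP; ring.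
case: a => -[|[|[|//]]] i; rewrite /= ?mulr0n ?mulr1n ?addr0.
- by congr r; apply: val_inj.
- by rewrite /root_step addrC subrK; congr r; apply: val_inj.
- by rewrite -r2; congr r; apply: val_inj.
Qed.

Lemma depressed_roots_complete z : z ^+ 3 - p * z = q -> exists a, z = r a.
Proof.
move=> zE; have : (z - r 0) * (z - r 1) * (z - r 2) == 0.
  have r1 : r 1 = r 0 + root_step by rewrite root_stepE mulr1n.
  have r2 : r 2 = r 0 + root_step *+ 2 by rewrite root_stepE.
  rewrite r1 r2; apply/eqP; set w := z - r 0.
  apply: (char3_eq (z := root_step * w * (root_step - w) + z * r 0 * (r 0 - z)) char3).
  transitivity ((z ^+ 3 - p * z) - (r 0 ^+ 3 - p * r 0) +
    3 * (root_step * w * (root_step - w) + z * r 0 * (r 0 - z))).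
    by rewrite -root_step_square /w; ring.
  by rewrite zE r_root subrr.
by rewrite !mulf_eq0 !subr_eq0 => /orP[/orP[]|] /eqP->; [exists 0 | exists 1 | exists 2].
Qed.

(** [g] sends the step to a square root of [p]. If it fixed the step, it would act on the
    progression of roots as a translation of Z/3, and a translation with a fixed point is the
    identity. *)
Lemma root_step_odd (g : E -> E) (s : 'S_3) :
    zmod_morphism g -> monoid_morphism g -> g p = p ->
    (forall a, g (r a) = r (s a)) -> (exists a, s a = a) -> s != 1%g ->
  g root_step = - root_step.
Proof.
move=> gB [g1 gM] gp gr [c sc] ns; apply/eqP; rewrite -addr_eq0; move: ns.
have : (g root_step - root_step) * (g root_step + root_step) == 0.
  by rewrite -subr_sqr expr2 -gM -expr2 root_step_square gp subrr.
rewrite mulf_eq0 => /orP[|-> //]; rewrite subr_eq0 => /eqP ge.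
case/negP; apply/eqP/permP => a; rewrite perm1; apply: r_inj.
have g0 : g 0 = 0 by have := gB 0 0; rewrite !subrr.
have gN y : g (- y) = - g y by rewrite -sub0r gB g0 sub0r.
have gD y z : g (y + z) = g y + g z by rewrite -{1}[z]opprK gB gN opprK.
have gMn n : g (root_step *+ n) = root_step *+ n.
  by elim: n => [|n IHn]; rewrite ?mulr0n // !mulrS gD IHn ge.
have gr0 : g (r 0) = r 0.
  have := gr c; rewrite sc [in LHS]root_stepE [RHS]root_stepE gD gMn.
  by move/addIr.
by rewrite -gr [in LHS]root_stepE gD gMn gr0 -root_stepE.
Qed.

End DepressedRoots.

(** * The tame fundamental group *)

Lemma aut_over_hom (F E : fieldType) (phi : F -> E) (g : aut_over phi) :
  field_hom_over phi phi g.
Proof. by have /asboolP[] := aut_funP g. Qed.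

Lemma subgroup_fixing (F E : fieldType) (phi : F -> E) (z : E) :
  is_subgroup [set g : aut_over phi | g z = z].
Proof.
split=> // g h gz hz; suff : aut_inv_fun h (g z) = z by [].
by rewrite gz -{1}hz (aut_inv_funK h).1.
Qed.

Section TameGaloisGroup.

Variables (K : fieldType) (r : nat) (Q : 'I_r -> option K).
Variables (Omega : closedFieldType) (phi : {rmorphism {fraction {poly K}} -> Omega}).
Hypothesis Omega_algebraic : forall z : Omega, algebraicOver phi z.

Local Notation F := {fraction {poly K}}.
Local Notation pi1 := (pi1_tame Q phi).

(** Composing an embedding of a tame cover with [tau] embeds the same cover, so the preimage under
    [tau] of a subfield containing all tame elements is another such subfield. *)
Lemma tame_compositum_stable tau z : field_hom_over phi phi tau ->
  z \in tame_compositum Q phi -> tau z \in tame_compositum Q phi.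
Proof.
move=> [tauB [tau1 tauM] tauF] /asboolP zT; apply/asboolP => S [[S1 SB SV] sS].
have tauV y : tau y^-1 = (tau y)^-1.
  have tau0 : tau 0 = 0 by have := tauB 0 0; rewrite !subrr.
  have [->|ny] := eqVneq y 0; first by rewrite invr0 tau0 invr0.
  have e : tau y^-1 * tau y = 1 by rewrite -tauM mulVf.
  have nty : tau y != 0 by apply: contra_eq_neq e => ->; rewrite mulr0 eq_sym oner_eq0.
  by apply: (mulIf nty); rewrite e mulVf.
apply: (zT [set y | S (tau y)]); split.
  split=> [|x y Sx Sy|x y Sx Sy] /=; first by rewrite tau1.
    by rewrite tauB; apply: SB.
  by rewrite tauM tauV; apply: SV.
move=> y [[c _ <-]|[L [h [tameL [hB [h1 hM] hF] [x _ <-]]]]] /=.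
  by rewrite tauF; apply: sS; left; exists c.
apply: sS; right; exists L, (tau \o h); split; [exact: tameL | | by exists x].
split=> [a b||c]; rewrite /= ?hB ?hF ?tauB ?tauF //.
by split=> [|a b]; rewrite /= ?h1 ?hM ?tau1 ?tauM.
Qed.

Lemma automorphism_restricts tau : field_hom_over phi phi tau -> bijective tau ->
  exists g : pi1, forall z, tame_val (g z) = tau (tame_val z).
Proof.
move=> tau_hom [tau' tauK tau'K]; have [tauB [tau1 tauM] tauF] := tau_hom.
have tau'_hom : field_hom_over phi phi tau'.
  split=> [a b||c]; last by rewrite -{1}(tauF c) tauK.
    by apply: (can_inj tauK); rewrite tauB !tau'K.
  split=> [|a b]; first by rewrite -{1}tau1 tauK.
  by apply: (can_inj tauK); rewrite tauM !tau'K.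
pose g (z : tame_closure Q phi) := TameClosure (tame_compositum_stable tau_hom (tame_valP z)).
pose g' (z : tame_closure Q phi) := TameClosure (tame_compositum_stable tau'_hom (tame_valP z)).
have gP : `[< is_aut_over (tame_in Q phi) g >].
  apply/asboolP; split.
    split=> [a b||c]; first by apply: val_inj; rewrite /= tauB.
      by split=> [|a b]; apply: val_inj; rewrite /= ?tau1 ?tauM.
    by apply: val_inj; rewrite /= tauF.
  by exists g' => z; apply: val_inj; rewrite /= ?tauK ?tau'K.
by exists (AutOver gP).
Qed.

Lemma tame_embedding_lift (L : fieldExtType F) (h : L -> Omega) :
    tame_cover Q L -> field_hom_over (in_alg L) phi h ->
  exists2 h' : L -> tame_closure Q phi, field_hom_over (in_alg L) (tame_in Q phi) h' &
    forall x, tame_val (h' x) = h x.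
Proof.
move=> tameL h_hom; have [hB [h1 hM] hF] := h_hom.
have hT x : h x \in tame_compositum Q phi.
  by apply/asboolP => S [_ sS]; apply: sS; right; exists L, h; split=> //; exists x.
exists (fun x => TameClosure (hT x)) => //.
split=> [a b||c]; first by apply: val_inj; rewrite /= hB.
  by split=> [|a b]; apply: val_inj; rewrite /= ?h1 ?hM.
by apply: val_inj; rewrite /= hF.
Qed.

Variable gamma : 'I_r -> pi1.
Hypothesis gamma_gen :
  krull_closure (smallest (@is_subgroup pi1) (range gamma)) = setT.

Lemma topological_generation (H : set pi1) (s : seq (tame_closure Q phi)) (g : pi1) :
    is_subgroup H -> (forall i, H (gamma i)) ->
  exists2 h, H h & {in s, aut_fun h =1 aut_fun g}.
Proof.
move=> subH Hgamma.
have : krull_closure (smallest (@is_subgroup pi1) (range gamma)) g by rewrite gamma_gen.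
move=> /(_ s)[h sh hg]; exists h => //.
by apply: sh; split=> // _ [i _ <-].
Qed.

Lemma fixed_by_generators z : (forall i, gamma i z = z) -> forall g : pi1, g z = z.
Proof.
move=> gz g.
have [h hz hg] := topological_generation [:: z] g (subgroup_fixing (tame_in Q phi) z) gz.
by rewrite -hg ?inE.
Qed.

(** If [d] were not a square, an automorphism of [Omega] would send [z] to [- z] and restrict to the
    tame closure; but an element fixed by topological generators is fixed by the whole group. *)
Lemma quadratic_descent z d : 2 != 0 :> Omega -> z ^+ 2 = tame_in Q phi d ->
  (forall i, gamma i z = z) -> exists s, z = tame_in Q phi s.
Proof.
move=> char2 z2 gz.
have [[s dE]|nsq] := pselect (exists s, d = s ^+ 2).
  move: z2; rewrite dE rmorphXn => /eqP; rewrite eqf_sqr => /orP[/eqP->|/eqP->].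
    by exists s.
  by exists (- s); rewrite rmorphN.
have irr : irreducible_poly ('X^2 - d%:P).
  apply: cubic_irreducible => [|s]; first by rewrite size_XnsubC.
  apply/negP => /rootP; rewrite !hornerE => /eqP; rewrite subr_eq0 => /eqP e.
  by apply: nsq; exists s.
have rootE w : root (map_poly phi ('X^2 - d%:P)) w = (w ^+ 2 == phi d).
  by rewrite rmorphB /= map_polyXn map_polyC /root !hornerE subr_eq0.
have vz2 : tame_val z ^+ 2 = phi d by have /(congr1 (@tame_val _ _ _ _ _)) := z2.
have [||tau [tau_hom tau_bij tauz]] :=
    automorphism_extension Omega_algebraic (a := tame_val z) (b := - tame_val z) irr.
- by rewrite rootE vz2.
- by rewrite rootE sqrrN vz2.
have [g gE] := automorphism_restricts tau_hom tau_bij.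
have := congr1 (@tame_val _ _ _ _ _) (fixed_by_generators gz g).
rewrite gE tauz => /eqP; rewrite eq_sym -addr_eq0 -mulr2n -mulr_natl mulf_eq0 (negPf char2) /=.
move=> /eqP z0; exists 0; by apply: val_inj; rewrite /= rmorph0.
Qed.

(** Some automorphism carries the first root to any given one. Density of the subgroup generated by
    the [gamma i] replaces it, on this one root, by an element acting through the generated
    permutation group. *)
Lemma monodromy_transitive (d : nat) (p : {poly F}) (root_of : 'I_d.+1 -> tame_closure Q phi)
    (sigma : 'I_r -> 'S_d.+1) :
    irreducible_poly p -> injective root_of ->
    (forall a, root (map_poly phi p) (tame_val (root_of a))) ->
    (forall i a, gamma i (root_of a) = root_of (sigma i a)) ->
    (size p <= d.+2)%N ->
  [transitive <<[set sigma i | i : 'I_r]>>%g, on [set: 'I_d.+1]%SET | 'P].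
Proof.
move=> irr root_inj rootP gr sp; set G := <<_>>%g.
pose H : set pi1 := [set g | exists2 s, s \in G & forall a, g (root_of a) = root_of (s a)].
have subH : is_subgroup H.
  split; first by exists 1%g; [exact: group1 | move=> a; rewrite perm1].
  move=> g h [s sG gs] [u uG hu]; exists (s * u^-1)%g; first by rewrite groupM ?groupV.
  move=> a; suff : aut_inv_fun h (g (root_of a)) = root_of ((s * u^-1)%g a) by [].
  by rewrite gs permM -[X in aut_inv_fun h (root_of X)](permKV u) -hu (aut_inv_funK h).1.
have Hgamma i : H (gamma i).
  by exists (sigma i) => [|a]; [apply/mem_gen/imset_f | exact: gr].
apply/imsetP; exists ord0; first by rewrite inE.
apply/setP => b; rewrite inE; apply/esym/orbitP.
have [tau [tau_hom tau_bij tau0]] :=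
  automorphism_extension Omega_algebraic irr (rootP ord0) (rootP b).
have [g gE] := automorphism_restricts tau_hom tau_bij.
have [h [s sG hs] hg] := topological_generation [:: root_of ord0] g subH Hgamma.
exists s => //; apply: root_inj; rewrite -hs hg ?inE //.
by apply: val_inj; rewrite /= gE tau0.
Qed.

End TameGaloisGroup.

(** First divided differences at the three roots eliminate [C], the second one eliminates [B] and
    determines [A]. *)
Lemma monic_cubic_factor (E : fieldType) (A B C w0 w1 w2 z : E) :
    w0 != w1 -> w0 != w2 -> w1 != w2 ->
    w0 ^+ 3 + A * w0 ^+ 2 + B * w0 + C = 0 ->
    w1 ^+ 3 + A * w1 ^+ 2 + B * w1 + C = 0 ->
    w2 ^+ 3 + A * w2 ^+ 2 + B * w2 + C = 0 ->
  z ^+ 3 + A * z ^+ 2 + B * z + C = (z - w0) * (z - w1) * (z - w2).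
Proof.
rewrite -[w0 == w1]subr_eq0 -[w0 == w2]subr_eq0 -[w1 == w2]subr_eq0 => n01 n02 n12 e0 e1 e2.
have d01 : w0 ^+ 2 + w0 * w1 + w1 ^+ 2 + A * (w0 + w1) + B = 0.
  apply: (mulfI n01); rewrite mulr0 -[RHS](subrr 0) -{1}e0 -e1; ring.
have d02 : w0 ^+ 2 + w0 * w2 + w2 ^+ 2 + A * (w0 + w2) + B = 0.
  apply: (mulfI n02); rewrite mulr0 -[RHS](subrr 0) -{1}e0 -e2; ring.
have AE : A = - (w0 + w1 + w2).
  apply/eqP; rewrite -addr_eq0; apply/eqP; apply: (mulfI n12).
  rewrite mulr0 -[RHS](subrr 0) -{1}d01 -d02; ring.
have BE : B = - (w0 ^+ 2 + w0 * w1 + w1 ^+ 2 + A * (w0 + w1)).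
  by apply/eqP; rewrite -addr_eq0 -d01; apply/eqP; ring.
have CE : C = - (w0 ^+ 3 + A * w0 ^+ 2 + B * w0).
  by apply/eqP; rewrite -addr_eq0 -e0; apply/eqP; ring.
rewrite CE BE AE; ring.
Qed.

(** * Inertia fixes a point of the fiber of the explicit cover *)

Section InertiaFixesALabel.

Variables (K : closedFieldType) (lam kap : K).
Hypotheses (pchar3 : 3%N \in [pchar K]) (lam0 : lam != 0) (lam1 : lam != 1).
Hypothesis kapE : kap ^+ 2 * (1 + lam) = -1.

Local Notation F := {fraction {poly K}}.
Local Notation f := (branch_poly lam).

Variables (E : fieldType) (psi : {rmorphism F -> E}).
Variables (V : set E) (placeV : is_place psi V) (P : option K).
Hypothesis overP : lies_over psi V P.
Hypothesis branchP : if P is Some a then f.[a] = 0 else True.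

Variable g : E -> E.
Hypotheses (g_hom : field_hom_over psi psi g).
Hypotheses (gV : forall x, V (g x) <-> V x).
Hypothesis g_inertia : forall x, V x -> place_ideal V (g x - x).

Variables (v : 'I_3 -> E) (s : 'S_3).
Hypothesis v_inj : injective v.
Hypothesis v_root : forall a, v a ^+ 3 - psi f%:F * v a = psi (kap ^+ 3 *: f ^+ 2)%:F.
Hypothesis g_perm : forall a, g (v a) = v (s a).

Let iota := const_emb psi.
Let x := psi 'X%:F.
Let char3 : 3 = 0 :> K. Proof. by have /andP[_ /eqP] := pchar3. Qed.

Let w a := - (iota (kap ^+ 3) * psi f%:F / v a).

Let w_eq a : w a ^+ 3 - w a ^+ 2 + iota (kap ^+ 6) * psi f%:F = 0.
Proof. exact: (reduced_root_eq kapE (v_root a)). Qed.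

Let w_inj : injective w.
Proof.
have nk : iota (kap ^+ 3) * psi f%:F != 0.
  by rewrite mulf_neq0 ?branch_poly_emb_neq0 // (fmorph_eq0 iota) expf_neq0 ?(kap_neq0 kapE).
by move=> a b /oppr_inj/(mulfI nk)/invr_inj/v_inj.
Qed.

Let g_w a : g (w a) = w (s a).
Proof.
have [gB [g1 gM] gF] := g_hom.
have g0 : g 0 = 0 by have := gB 0 0; rewrite !subrr.
have nv b : v b != 0 := cubic_root_neq0 kapE (v_root b).
have gVv : g (v a)^-1 = (v (s a))^-1.
  by apply: (mulIf (nv (s a))); rewrite mulVf // -g_perm -gM mulVf.
rewrite /w -[- _]sub0r gB g0 sub0r !gM gVv gF.
by rewrite (gF (((kap ^+ 3)%:P)%:F)).
Qed.

Let prod_in_ideal y0 y1 y2 : V y0 -> V y1 -> V y2 -> place_ideal V (y0 * y1 * y2) ->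
  place_ideal V y0 \/ place_ideal V y1 \/ place_ideal V y2.
Proof.
move=> V0 V1 V2 /(place_ideal_prime placeV (place_mul placeV V0 V1) V2) [|]; last by right; right.
by case/(place_ideal_prime placeV V0 V1); [left | right; left].
Qed.

Let ord_neq (a b : 'I_3) : a != b -> w a != w b.
Proof. by rewrite (inj_eq w_inj). Qed.

(* Modulo the place, the cubic of the [w a] is [T^2 (T - 1)]; inertia fixes
   the root which reduces to the simple root [1]. *)
Let fixed_finite a : P = Some a -> exists b, s b = b.
Proof.
move=> Pa; move: overP branchP; rewrite Pa => overa fa.
pose h := iota (kap ^+ 6) * psi f%:F.
have w_eqh a' : w a' ^+ 3 - w a' ^+ 2 + h = 0 by exact: w_eq.
have mh : place_ideal V h.
  apply: (place_idealMl placeV); first exact: (place_const placeV).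
  exact: (place_ideal_poly placeV overa).
have V1 := place_const1 placeV.
have Vw b : V (w b).
  apply: contrapT => nVw; have mw := place_idealV placeV nVw.
  have nw : w b != 0 by apply: contra_notN nVw => /eqP->; apply: (place_const0 placeV).
  apply: (place_unit_not_ideal (place_unit1 placeV)).
  (* No [w b] has a pole: the equation divided by [w^3] would put 1 in the ideal. *)
  have -> : 1 = (w b)^-1 - h * (w b)^-1 ^+ 3.
    apply/eqP; rewrite -subr_eq0; apply/eqP.
    transitivity ((w b ^+ 3 - w b ^+ 2 + h) / w b ^+ 3); first by field.
    by rewrite w_eqh mul0r.
  apply: (place_idealB placeV) => //; apply: (place_idealMr placeV) => //.
  by apply: (place_exp placeV); case: mw.
have V1w b : V (1 - w b) by apply: (place_sub placeV).
have w_eq' b : w b ^+ 3 + (-1) * w b ^+ 2 + 0 * w b + h = 0.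
  by transitivity (w b ^+ 3 - w b ^+ 2 + h); [ring | exact: w_eqh].
(* [h] is the value of [T^3 - T^2 + h] at [T = 1]. *)
have prodE : h = (1 - w 0) * (1 - w 1) * (1 - w 2).
  rewrite -(monic_cubic_factor 1 _ _ _ (w_eq' 0) (w_eq' 1) (w_eq' 2)) ?ord_neq //.
  by ring.
have [b mb] : exists b, place_ideal V (1 - w b).
  by move: mh; rewrite prodE => /prod_in_ideal[||||[|]]; eauto.
exists b; apply: contrapT => nsb.
have mb' : place_ideal V (1 - w (s b)).
  rewrite -g_w (_ : _ - _ = (1 - w b) - (g (w b) - w b)); last by ring.
  by apply: (place_idealB placeV) => //; apply: g_inertia.
have nd : w (s b) - w b != 0 by rewrite subr_eq0 (inj_eq w_inj); apply/eqP.
set e := 1 - w b in mb; set e' := 1 - w (s b) in mb'.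
apply: (place_unit_not_ideal (place_unit1 placeV)).
(* The divided difference of [T^3 - T^2] at two distinct roots is 0, but it reduces to [3 - 2 = 1]
   if both roots reduce to 1. *)
have -> : 1 = e * (2 - e - e') + e' * (2 - e').
  apply: (mulfI nd); apply/eqP; rewrite -subr_eq0; apply/eqP.
  transitivity ((w (s b) ^+ 3 - w (s b) ^+ 2 + h) - (w b ^+ 3 - w b ^+ 2 + h)).
    by rewrite /e /e'; ring.
  by rewrite !w_eqh subrr.
have V2 : V 2 by apply: (place_add placeV).
have [Ve _] := mb; have [Ve' _] := mb'.
by apply: (place_idealD placeV); apply: (place_idealMr placeV) => //;
  do !apply: (place_sub placeV).
Qed.

(* At infinity exactly one of the parameters [t] is finite. *)
Let fixed_infinity : P = None -> exists b, s b = b.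
Proof.
move=> PN; move: overP; rewrite PN => overN.
pose c := kap ^+ 2; pose b := lam * c ^+ 2.
pose t a := cubic_parameter lam kap psi (v a).
have tw a : t a = iota c * x + w a by [].
have tE a : t a ^+ 3 - t a ^+ 2 = iota c * (t a - iota b) * x.
  exact: (cubic_parameter_eq char3 kapE (v_root a)).
have xpi : x^-1 = psi (local_param None) by rewrite /x -fmorphV.
have mx : place_ideal V x^-1 by rewrite xpi.
have nx : x != 0 by rewrite fmorph_eq0 tofrac_eq0 polyX_eq0.
have nVx : ~ V x.
  by move=> Vx; case: mx => VxV []; split; rewrite ?invr_eq0 ?invrK.
have nc : iota c != 0 by rewrite (fmorph_eq0 iota) expf_neq0 ?(kap_neq0 kapE).
have bE : b = lam * (kap ^+ 2) ^+ 2 by [].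
have Ub : place_units V (iota (b ^+ 2 * (b - 1))).
  apply: (place_unit_const placeV); rewrite mulf_neq0 ?expf_neq0 ?subr_eq0 //.
    exact: simple_pole_neq0 lam0 kapE bE.
  exact: simple_pole_neq1 char3 lam1 kapE bE.
have t_neq a a' : a != a' -> t a != t a'.
  by move=> na; rewrite !tw (inj_eq (addrI _)) ord_neq.
have g_t a : g (t a) = t (s a).
  have [gB [g1 gM] gF] := g_hom.
  have gD y z : g (y + z) = g y + g z.
    have g0 : g 0 = 0 by have := gB 0 0; rewrite !subrr.
    by rewrite -{1}[z]opprK gB -[- z]sub0r gB g0 sub0r opprK.
  have gc : g (iota c) = iota c := gF _.
  by rewrite !tw gD g_w gM gc /x gF.
have t_eq' a : t a ^+ 3 + (-1) * t a ^+ 2 + (- (iota c * x)) * t a + iota c * x * iota b = 0.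
  transitivity (t a ^+ 3 - t a ^+ 2 - iota c * (t a - iota b) * x); first by ring.
  by rewrite tE subrr.
(* The value of the cubic at [T = b], where the terms in [x] cancel. It is a constant unit, which is
   incompatible with poles of all three [t a]. *)
have prodE : iota (b ^+ 2 * (b - 1)) = (iota b - t 0) * (iota b - t 1) * (iota b - t 2).
  rewrite -(monic_cubic_factor (iota b) _ _ _ (t_eq' 0) (t_eq' 1) (t_eq' 2)) ?t_neq //.
  by rewrite !(rmorphM iota, rmorphB iota, rmorphXn iota, rmorph1 iota); ring.
have [a Va] : exists a, V (t a).
  apply: contrapT => nVt.
  have nt a : t a != 0.
    by apply/eqP => ta; apply: nVt; exists a; rewrite ta; apply: (place_const0 placeV).
  have mt a : place_ideal V (t a)^-1 by apply: (place_idealV placeV) => Va; apply: nVt; exists a.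
  have U1 a : place_units V (1 - iota b * (t a)^-1).
    apply/(place_unit1D placeV)/(place_idealN placeV).
    by apply: (place_idealMl placeV) => //; apply: (place_const placeV).
  apply: (place_unit_not_ideal (place_unitM placeV (place_unitM placeV (U1 0) (U1 1)) (U1 2))).
  rewrite (_ : _ * _ = - (iota (b ^+ 2 * (b - 1)) * ((t 0)^-1 * (t 1)^-1 * (t 2)^-1))).
    apply: (place_idealN placeV); apply: (place_idealMl placeV); first by case: Ub.
    apply: (place_idealMl placeV) => //.
    by apply: (place_mul placeV); apply: place_ideal_sub.
  by rewrite prodE; field; rewrite !nt.
exists a; apply: contrapT => nsa; apply: nVx.
have Vsa : V (t (s a)) by rewrite -g_t; apply/gV.
have nd : t (s a) - t a != 0 by rewrite subr_eq0; apply/t_neq/eqP.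
(* Subtracting the equations of two distinct finite [t] and dividing by their difference expresses
   [x] as an integral element, whereas [x] has a pole. *)
have -> : x = (t (s a) ^+ 2 + t (s a) * t a + t a ^+ 2 - t (s a) - t a) / iota c.
  apply: (mulfI (mulf_neq0 nc nd)).
  transitivity ((t (s a) ^+ 3 - t (s a) ^+ 2) - (t a ^+ 3 - t a ^+ 2)).
    by rewrite !tE; ring.
  by field.
have [_ _ VcV] := place_unit_const placeV (expf_neq0 2 (kap_neq0 kapE)).
apply: (place_mul placeV) VcV.
by do !(apply: (place_sub placeV) => //); do !(apply: (place_add placeV) => //);
  rewrite ?expr2; apply: (place_mul placeV).
Qed.

Lemma inertia_fixes_a_label : exists b, s b = b.
Proof.
by case: (P) fixed_finite fixed_infinity => [a|] fin inf; [apply: fin | apply: inf].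
Qed.

End InertiaFixesALabel.

(** * Generating tuples of reflections of three points *)

(* The reflection [x |-> 2k - x] of Z/3 fixing [k]; the code 3 stands for the
   identity. *)
Definition reflect3 (k x : nat) : nat := if (k < 3)%N then ((2 * k + 2 * x) %% 3)%N else x.

(** By parity the number of reflections is even. If there are none, or two, which are then equal,
    they have a common fixed point; otherwise all four codes are reflections. *)
Lemma reflect3_product_check : all (fun k0 => all (fun k1 => all (fun k2 => all (fun k3 =>
    all (fun x => reflect3 k3 (reflect3 k2 (reflect3 k1 (reflect3 k0 x))) == x) (iota 0 3) ==>
      (has (fun c => all (fun k => reflect3 k c == c) [:: k0; k1; k2; k3]) (iota 0 3)
       || all (fun k => k < 3)%N [:: k0; k1; k2; k3]))
  (iota 0 4)) (iota 0 4)) (iota 0 4)) (iota 0 4).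
Proof. by vm_compute. Qed.

(* Both moves are squares of standard braids, so they are pure; [t] would
   conjugate the moved tuple of reflections back to the original one. *)
Lemma reflect3_conjugation_check : all (fun k0 => all (fun k1 => all (fun k2 => all (fun k3 =>
    all (fun t0 => all (fun t1 => all (fun t2 =>
      [&& all (fun x => reflect3 k3 (reflect3 k2 (reflect3 k1 (reflect3 k0 x))) == x) (iota 0 3),
          ~~ [&& k0 == k1, k1 == k2 & k2 == k3] & uniq [:: t0; t1; t2]] ==>
      let t := nth 0%N [:: t0; t1; t2] in
      let k' := if k0 == k1 then [:: k0; reflect3 k2 k1; reflect3 k2 (reflect3 k1 k2); k3]
                else [:: reflect3 k1 k0; reflect3 k1 (reflect3 k0 k1); k2; k3] in
      map t k' != [:: k0; k1; k2; k3])
  (iota 0 3)) (iota 0 3)) (iota 0 3)) (iota 0 3)) (iota 0 3)) (iota 0 3)) (iota 0 3).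
Proof. by vm_compute. Qed.

Section PermutationsOfThree.

Implicit Types (s : 'S_3) (x y z c : 'I_3).

Lemma ord3_third x y z z' : x != y -> z \notin [:: x; y] -> z' \notin [:: x; y] -> z = z'.
Proof.
move: x y z z' => [[|[|[|//]]] ?] [[|[|[|//]]] ?] [[|[|[|//]]] ?] [[|[|[|//]]] ?] //;
  by move=> *; apply: val_inj.
Qed.

Lemma perm3_reflect s c : s c = c -> s != 1%g -> forall x, s x = reflect3 c x :> nat.
Proof.
move=> sc ns x; have s_inj := @perm_inj _ s.
have [->|nxc] := eqVneq x c.
  by rewrite sc; move: (c) => [[|[|[|//]]] ?].
have nsx : s x != x.
  apply: contra_neq ns => sx; apply/permP => y; rewrite perm1.
  have [->//|nyc] := eqVneq y c; have [->//|nyx] := eqVneq y x.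
  have nsyc : s y != c by rewrite -sc (inj_eq s_inj).
  have nsyx : s y != x by rewrite -sx (inj_eq s_inj).
  apply: (@ord3_third c x); first by rewrite eq_sym.
    by rewrite !inE negb_or nsyc.
  by rewrite !inE negb_or nyc.
have nsc : s x != c by rewrite -sc (inj_eq s_inj).
move: nsx nsc; move: (s x) => z; move: x c z nxc {sc}.
by move=> [[|[|[|//]]] ?] [[|[|[|//]]] ?] [[|[|[|//]]] ?].
Qed.

Lemma perm3_is_cycle s c : s c = c -> exists e, is_cycle s e.
Proof.
move=> sc; have [->|ns] := eqVneq s 1%g.
  by exists #|porbit (1 : 'S_3)%g c|, c => // y _; rewrite perm1.
have [x nsx] : exists x, s x != x.
  apply: contrapT => H; case/eqP: ns; apply/permP => x; rewrite perm1.
  by apply/eqP; apply: contrapT => /negP nsx; apply: H; exists x.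
exists #|porbit s x|, x => // y ny.
suff -> : y = c by [].
have nxy : x != y by apply: contraNneq ny => <-; rewrite porbit_id.
have nsxy : s x != y by apply: contraNneq ny => <-; rewrite (mem_porbit s 1).
have nxc : x != c by apply: contraNneq nsx => ->; rewrite sc.
have nsxc : s x != c by rewrite -sc (inj_eq (@perm_inj _ s)).
apply: (@ord3_third x (s x)); first by rewrite eq_sym.
  by rewrite !inE negb_or ![y == _]eq_sym nxy.
by rewrite !inE negb_or ![c == _]eq_sym nxc.
Qed.

Variable sigma : 'I_4 -> 'S_3.
Hypothesis sigma_fixes : forall i, exists c, sigma i c = c.
Hypothesis sigma_prod : (\prod_(i < 4) sigma i)%g = 1%g.
Hypothesis sigma_trans :
  [transitive <<[set sigma i | i : 'I_4]>>%g, on [set: 'I_3]%SET | 'P].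

Let no_common_fixed_point c : ~ forall i, sigma i c = c.
Proof.
move=> fix_c; have stab s : s \in <<[set sigma i | i : 'I_4]>>%g -> s c = c.
  move=> sG; have /fintype.subsetP/(_ _ sG) : (<<[set sigma i | i : 'I_4]>> \subset 'C[c | 'P])%g.
    by rewrite gen_subG; apply/fintype.subsetP => _ /imsetP[i _ ->]; apply/astab1P; apply: fix_c.
  by move/astab1P.
have [d ndc] : exists d, d != c.
  by exists (c + 1); rewrite -subr_eq0 addrAC subrr add0r.
have /atransP2/(_ c d) := sigma_trans; rewrite !inE => /(_ isT isT)[s sG dE].
by case/eqP: ndc; rewrite dE; apply: stab.
Qed.

Let all4 (P : 'I_4 -> Prop) : P 0 -> P 1 -> P 2 -> P 3 -> forall j, P j.
Proof.
move=> P0 P1 P2 P3 [[|[|[|[|//]]]] lt].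
- by rewrite (_ : Ordinal lt = 0) //; apply: val_inj.
- by rewrite (_ : Ordinal lt = 1) //; apply: val_inj.
- by rewrite (_ : Ordinal lt = 2) //; apply: val_inj.
- by rewrite (_ : Ordinal lt = 3) //; apply: val_inj.
Qed.

Let sigma_prod4 : (sigma 0%R * sigma 1%R * sigma 2%R * sigma 3%R)%g = 1%g.
Proof.
rewrite -sigma_prod !big_ord_recr big_ord0 /= mul1g.
by congr (sigma _ * sigma _ * sigma _ * sigma _)%g; apply: val_inj.
Qed.

Let prod_codes (k : 'I_4 -> nat) : (forall j x, sigma j x = reflect3 (k j) x :> nat) ->
  all (fun n : nat => reflect3 (k 3) (reflect3 (k 2) (reflect3 (k 1) (reflect3 (k 0) n))) == n)
    (iota 0 3).
Proof.
move=> kE; apply/allP => n; rewrite mem_iota => /= n3.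
have := congr1 (fun s : 'S_3 => nat_of_ord (s (Ordinal n3))) sigma_prod4.
by rewrite !permM perm1 !kE /= => ->.
Qed.

Lemma generating_reflections i : sigma i != 1%g.
Proof.
have code j : exists k : nat, (k < 4)%N /\
    ((forall x, sigma j x = reflect3 k x :> nat) /\ (sigma j = 1%g -> k = 3%N)).
  have [c sc] := sigma_fixes j; have [s1|ns] := eqVneq (sigma j) 1%g.
    by exists 3%N; split=> //; split=> // x; rewrite s1 perm1.
  exists c; split; first exact: ltn_trans (ltn_ord c) _.
  by split; [exact: perm3_reflect | move=> s1; rewrite s1 eqxx in ns].
pose k j := projT1 (cid (code j)).
have kP j : (k j < 4)%N /\
    ((forall x, sigma j x = reflect3 (k j) x :> nat) /\ (sigma j = 1%g -> k j = 3%N)).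
  by rewrite /k; case: cid.
have kE j x : sigma j x = reflect3 (k j) x :> nat by have [_ []] := kP j.
have k4 j : k j \in iota 0 4 by rewrite mem_iota; have [] := kP j.
have := reflect3_product_check.
move=> /allP/(_ _ (k4 0))/allP/(_ _ (k4 1))/allP/(_ _ (k4 2))/allP/(_ _ (k4 3)).
rewrite (prod_codes kE) implyTb => /orP[/hasP[c c3 /and5P[c0 c1 c2' c3' _]]|]; last first.
  move=> /and5P[l0 l1 l2 l3 _]; apply/eqP => si1.
  have [_ [_ /(_ si1) ki]] := kP i.
  have : forall j, (k j < 3)%N by apply: all4.
  by move/(_ i); rewrite ki.
rewrite mem_iota in c3; case: (no_common_fixed_point (c := Ordinal c3)).
by apply: all4; apply: val_inj; rewrite /= kE; apply/eqP.
Qed.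

(** The double move conjugates [sigma a] and [sigma b] by their product, a 3-cycle when they differ.
    Positions 0, 1 serve if [sigma 0] and [sigma 1] differ; then [sigma 2] and [sigma 3] differ, the
    total product being 1. Otherwise [sigma 2 = sigma 3] differs from [sigma 1] by transitivity, and
    positions 1, 2 serve. Either way, [t] fixes the distinct fixed points of the two untouched
    reflections, so it is the identity, yet the twisted pair has changed. *)
Lemma double_braid_not_conjugate : exists a b : 'I_4, b = a.+1 :> nat /\
  forall t : 'I_3 -> 'I_3, injective t ->
  ~ (forall i x, t (braid_move a b (braid_move a b sigma) i x) = sigma i (t x)).
Proof.
pose c j := projT1 (cid (sigma_fixes j)).
have cP j : sigma j (c j) = c j by rewrite /c; case: cid.
have cE j x : sigma j x = reflect3 (c j) x :> nat.
  exact: perm3_reflect (cP j) (generating_reflections j) x.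
have c_unique j x : sigma j x = x -> x = c j.
  move=> sx; apply: val_inj; have := cE j x; rewrite sx.
  by move: x (c j) {sx} => [[|[|[|//]]] ?] [[|[|[|//]]] ?].
have conj_fix (s u : 'S_3) y : s y = y -> (u^-1 * s * u)%g (u y) = u y.
  by move=> sy; rewrite !permM permK sy.
have c_conj (a b : 'I_4) : ((sigma b)^-1 * sigma a * sigma b)%g (sigma b (c a)) = sigma b (c a).
  exact: conj_fix.
have c_conj2 (a b : 'I_4) (u := ((sigma b)^-1 * sigma a * sigma b)%g) :
    (u^-1 * sigma b * u)%g (sigma b (sigma a (c b))) = sigma b (sigma a (c b)).
  have uc : u (c b) = sigma b (sigma a (c b)).
    by rewrite /u !permM -{1}[c b]cP permK.
  by rewrite -uc; apply: conj_fix.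
have c3 j : nat_of_ord (c j) \in iota 0 3 by rewrite mem_iota ltn_ord.
have not_all_equal : ~~ [&& c 0 == c 1 :> nat, c 1 == c 2 :> nat & c 2 == c 3 :> nat].
  apply/negP => /and3P[/eqP c01 /eqP c12 /eqP c23].
  apply: (no_common_fixed_point (c := c 0)); apply: all4; first exact: cP.
  - by rewrite (val_inj c01) cP.
  - by rewrite (val_inj c01) (val_inj c12) cP.
  - by rewrite (val_inj c01) (val_inj c12) (val_inj c23) cP.
have reflect3_lt k n : (k < 3)%N -> (reflect3 k n < 3)%N.
  by move=> k3; rewrite /reflect3 k3 ltn_mod.
have check (t : 'I_3 -> 'I_3) : injective t ->
    map (fun n : nat => t (inord n) : nat) (if c 0 == c 1 :> nat then
    [:: c 0 : nat; reflect3 (c 2) (c 1); reflect3 (c 2) (reflect3 (c 1) (c 2)); c 3 : nat]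
    else [:: reflect3 (c 1) (c 0); reflect3 (c 1) (reflect3 (c 0) (c 1)); c 2 : nat; c 3 : nat])
    <> [:: c 0 : nat; c 1 : nat; c 2 : nat; c 3 : nat].
  move=> t_inj; set k' := if _ then _ else _; pose tn (n : nat) : nat := t (inord n : 'I_3).
  have k'3 : all (fun n => n < 3)%N k'.
    by rewrite /k'; case: ifP => _; rewrite /= !ltn_ord !reflect3_lt.
  have t3 n : tn n \in iota 0 3 by rewrite mem_iota ltn_ord.
  have := reflect3_conjugation_check.
  move=> /allP/(_ _ (c3 0))/allP/(_ _ (c3 1))/allP/(_ _ (c3 2))/allP/(_ _ (c3 3)).
  move=> /allP/(_ _ (t3 0%N))/allP/(_ _ (t3 1%N))/allP/(_ _ (t3 2%N)).
  rewrite (prod_codes cE) not_all_equal !andTb -/k'.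
  have -> : uniq [:: tn 0%N; tn 1%N; tn 2%N].
    rewrite -[[:: _; _; _]]/(map tn (iota 0 3)) map_inj_in_uniq ?iota_uniq // => x y.
    rewrite !mem_iota /= => x3 y3 /val_inj/t_inj/(congr1 (@nat_of_ord 3)).
    by rewrite !inordK.
  rewrite implyTb => /eqP + tE; apply; rewrite -tE; apply/eq_in_map => n.
  by move/(allP k'3); case: n => [|[|[|]]].
have move_fix a b (t : 'I_3 -> 'I_3) : a != b -> injective t ->
    (forall i x, t (braid_move a b (braid_move a b sigma) i x) = sigma i (t x)) ->
    [/\ t (sigma b (c a)) = c a, t (sigma b (sigma a (c b))) = c b
      & forall i, i != a -> i != b -> t (c i) = c i].
  move=> nab t_inj tE; rewrite eq_sym in nab; split.
  - apply: c_unique; rewrite -tE /braid_move !(eqxx, negPf nab).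
    by congr t; apply: c_conj.
  - apply: c_unique; rewrite -tE /braid_move !(eqxx, negPf nab).
    by congr t; apply: c_conj2.
  - move=> i /negPf nia /negPf nib; apply: c_unique.
    by rewrite -tE /braid_move !(nia, nib) cP.
have [c01|nc01] := eqVneq (c 0 : nat) (c 1).
  exists 1, 2; split=> // t t_inj tE; apply: (check t t_inj).
  case: ifP => [_|/negP[]]; last exact/eqP.
  have [m1 m2 m3] := move_fix 1 2 t isT t_inj tE.
  by rewrite /= -!cE !inord_val m1 m2 !m3.
exists 0, 1; split=> // t t_inj tE; apply: (check t t_inj); rewrite (negPf nc01) /=.
have [m1 m2 m3] := move_fix 0 1 t isT t_inj tE.
by rewrite -!cE !inord_val m1 m2 !m3.
Qed.

End PermutationsOfThree.

(** * Embeddings of simple extensions and labelings of the fiber *)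

Lemma irreducible_root_transfer (D E E' : fieldType) (i : {rmorphism D -> E})
    (g : {rmorphism D -> E'}) (p q : {poly D}) (z : E) (z' : E') :
    irreducible_poly p -> root (map_poly i p) z -> root (map_poly g p) z' ->
  (map_poly i q).[z] = 0 -> (map_poly g q).[z'] = 0.
Proof.
move=> irr pz pz' qz; have [/dvdpP[s ->]|ndpq] := boolP (p %| q)%R.
  by rewrite rmorphM hornerM (rootP pz') mulr0.
have : coprimep (map_poly i p) (map_poly i q).
  by rewrite coprimep_map irreducible_poly_coprime.
by move=> /coprimep_root/(_ pz); rewrite qz eqxx.
Qed.

Section SimpleExtensionEmbeddings.

Variables (F : fieldType) (L : fieldExtType F) (p : {poly F}) (v : L).
Hypotheses (p_irr : irreducible_poly p) (v_root : root (map_poly (in_alg L) p) v).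
Hypothesis v_gen : <<1; v>>%VS = fullv.

Lemma simple_extension_embedding (E : fieldType) (phi : {rmorphism F -> E}) (z : E) :
  root (map_poly phi p) z -> exists2 h : L -> E, field_hom_over (in_alg L) phi h & h v = z.
Proof.
move=> pz; have rep y : exists q : {poly F}, y = (map_poly (in_alg L) q).[v].
  by have /Fadjoin1_polyP : y \in <<1; v>>%VS by rewrite v_gen memvf.
pose q y := projT1 (cid (rep y)).
have qE y : y = (map_poly (in_alg L) (q y)).[v] by rewrite /q; case: cid.
pose h y := (map_poly phi (q y)).[z].
have hE y s : y = (map_poly (in_alg L) s).[v] -> h y = (map_poly phi s).[z].
  move=> ys; apply/eqP; rewrite -subr_eq0 -hornerN -hornerD -rmorphB; apply/eqP.
  apply: (irreducible_root_transfer p_irr v_root pz).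
  by rewrite rmorphB hornerD hornerN -ys -qE subrr.
exists h; last by rewrite (hE v 'X) ?map_polyX ?hornerX.
split=> [a b||c].
- by rewrite (hE _ (q a - q b)) ?rmorphB ?hornerD ?hornerN // -!qE.
- split=> [|a b]; first by rewrite (hE 1 1) ?rmorph1 ?hornerC.
  by rewrite (hE _ (q a * q b)) ?rmorphM ?hornerM // -!qE.
- by rewrite (hE _ c%:P) ?map_polyC ?hornerC.
Qed.

Lemma embeddings_agree (E : fieldType) (phi : {rmorphism F -> E}) (h h' : L -> E) :
    field_hom_over (in_alg L) phi h -> field_hom_over (in_alg L) phi h' ->
  h v = h' v -> h = h'.
Proof.
move=> [hB [h1 hM] hF] [h'B [h'1 h'M] h'F] hv; apply/funext => y.
have hV (k : L -> E) (w : L) : zmod_morphism k -> monoid_morphism k -> k w^-1 = (k w)^-1.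
  move=> kB [k1 kM]; have k0 : k 0 = 0 by have := kB 0 0; rewrite !subrr.
  have [->|nw] := eqVneq w 0; first by rewrite invr0 k0 invr0.
  have e : k w^-1 * k w = 1 by rewrite -kM mulVf.
  have nkw : k w != 0 by apply: contra_eq_neq e => ->; rewrite mulr0 eq_sym oner_eq0.
  by apply: (mulIf nkw); rewrite e mulVf.
apply: (primitive_subfield (S := fun y => h y = h' y) v_gen) => //.
- split=> [|a b ha hb|a b ha hb]; first by rewrite h1 h'1.
    by rewrite hB h'B ha hb.
  by rewrite hM h'M !hV // ha hb.
- by move=> c; rewrite hF h'F.
Qed.

End SimpleExtensionEmbeddings.

Section Labelings.

Variables (K : fieldType) (r : nat) (Q : 'I_r -> option K).
Variables (Omega : fieldType) (phi : {rmorphism {fraction {poly K}} -> Omega}).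
Local Notation F := {fraction {poly K}}.
Local Notation pi1 := (pi1_tame Q phi).

Variables (L : fieldExtType F) (d : nat) (label : 'I_d -> (L -> tame_closure Q phi)).
Hypothesis labeling : is_labeling label.

Lemma label_hom a : field_hom_over (in_alg L) (tame_in Q phi) (label a).
Proof.
have [_ rangeE] := labeling; have : range label (label a) by exists a.
by rewrite rangeE.
Qed.

Lemma monodromy_permutation (g : pi1) : exists s : 'S_d, forall a, label (s a) = g \o label a.
Proof.
have [label_inj rangeE] := labeling.
have next a : exists b, label b = g \o label a.
  have : range label (g \o label a).
    rewrite rangeE; have [hB [h1 hM] hF] := label_hom a.
    have [gB [g1 gM] gF] := aut_over_hom g.
    split=> [y z||c]; rewrite /= ?hB ?gB ?hF ?gF //.
    by split=> [|y z]; rewrite /= ?h1 ?g1 ?hM ?gM.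
  by case=> b _ <-; exists b.
pose b a := projT1 (cid (next a)).
have bE a : label (b a) = g \o label a by rewrite /b; case: cid.
have b_inj : injective b.
  move=> a a' ab; apply: label_inj; apply/funext => y.
  have /(congr1 (@^~ y)) : label (b a) = label (b a') by rewrite ab.
  by rewrite !bE /= => /(congr1 (aut_inv_fun g)); rewrite !(aut_inv_funK g).1.
by exists (perm b_inj) => a; rewrite permE.
Qed.

Lemma monodromy_prod (n : nat) (gamma : 'I_n -> pi1) (sigma : 'I_n -> 'S_d) :
    (forall i a, label (sigma i a) = gamma i \o label a) ->
    (\prod_(i < n) gamma i)%g = 1%g ->
  (\prod_(i < n) sigma i)%g = 1%g.
Proof.
move=> gs gamma1; apply/permP => a; rewrite perm1; have [label_inj _] := labeling.
apply: label_inj; suff -> : label ((\prod_(i < n) sigma i)%g a) =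
    (\prod_(i < n) gamma i)%g \o label a by rewrite gamma1.
pose R (s : 'S_d) (g : pi1) := forall a, label (s a) = g \o label a.
suff : R (\prod_(i < n) sigma i)%g (\prod_(i < n) gamma i)%g by apply.
apply: big_ind2.
- by move=> b; rewrite perm1.
- by move=> s g u h sg uh b; rewrite permM uh sg.
- by move=> i _ b.
Qed.

End Labelings.

(** * Monodromy of the cubic covers *)

Lemma depressed_cubic_splits (E : closedFieldType) (p q : E) :
    3 = 0 :> E -> 2 != 0 :> E -> p != 0 ->
  exists2 r : 'I_3 -> E, injective r & forall a, r a ^+ 3 - p * r a = q.
Proof.
move=> char3 char2 np.
have [y y2] : exists y, y ^+ 2 = p.
  have /closed_rootP[y] : size ('X^2 - p%:P) != 1 by rewrite size_XnsubC.
  by rewrite /root !hornerE subr_eq0 => /eqP; exists y.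
have ny : y != 0 by apply: contraNneq np => y0; rewrite -y2 y0 expr0n.
have [z zE] : exists z, z ^+ 3 - p * z = q.
  have /closed_rootP[z] : size ('X^3 - (p *: 'X + q%:P)) != 1.
    rewrite size_polyDl size_polyXn // size_polyN.
    exact: leq_ltn_trans (size_cubic_tail _ _) _.
  rewrite /root !hornerE opprD addrA subr_eq0 => /eqP; by exists z.
exists (fun a : 'I_3 => z + y *+ a) => [a b|a].
  move/addrI/eqP; have ny2 : y *+ 2 != 0 by rewrite -mulr_natl mulf_neq0.
  case: a b => [[|[|[|//]]] ?] [[|[|[|//]]] ?] /= ab; apply: val_inj => //=; move: ab;
    rewrite ?mulr0n ?mulr1n.
  - by rewrite eq_sym (negPf ny).
  - by rewrite eq_sym (negPf ny2).
  - by rewrite (negPf ny).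
  - by rewrite mulr2n -subr_eq0 opprD addrA subrr add0r oppr_eq0 (negPf ny).
  - by rewrite (negPf ny2).
  - by rewrite mulr2n -subr_eq0 addrK (negPf ny).
rewrite -zE -y2; case: a => [[|[|[|//]]] ?] /=.
- by rewrite mulr0n addr0.
- by rewrite mulr1n; apply: (char3_eq (z := z ^+ 2 * y + z * y ^+ 2) char3); ring.
- apply: (char3_eq (z := 2 * z ^+ 2 * y + 4 * z * y ^+ 2 + 2 * y ^+ 3) char3); ring.
Qed.

Lemma hom_depressed (F L E : fieldType) (i : F -> L) (phi : F -> E) (h : L -> E)
    (u : L) (p q : F) :
  field_hom_over i phi h -> u ^+ 3 - i p * u = i q ->
  h u ^+ 3 - phi p * h u = phi q.
Proof.
move=> [hB [h1 hM] hF] uE.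
by rewrite -!hF -uE hB !exprS expr0 !mulr1 !hM.
Qed.

Section Monodromy.

Variables (K : closedFieldType) (lam kap : K).
Hypotheses (pchar3 : 3%N \in [pchar K]) (lam0 : lam != 0) (lam1 : lam != 1).
Hypothesis kapE : kap ^+ 2 * (1 + lam) = -1.
Variables (Q : 'I_4 -> option K).
Hypothesis branchQ : forall P, range Q P <->
  P = None \/ (exists2 a, P = Some a & a * (a - 1) * (a - lam) = 0).

Local Notation F := {fraction {poly K}}.
Local Notation f := (branch_poly lam).
Local Notation h0 := (kap ^+ 3 *: f ^+ 2)%:F.

Variables (Omega : closedFieldType) (phi : {rmorphism F -> Omega}).
Hypothesis Omega_algebraic : forall z : Omega, algebraicOver phi z.

Local Notation E := (tame_closure Q phi).
Local Notation psi := (tame_in Q phi).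
Local Notation pi1 := (pi1_tame Q phi).

Let char3 (R : nzRingType) (i : {rmorphism F -> R}) : 3 = 0 :> R.
Proof.
have /andP[_ /eqP c3] := pchar3.
have := congr1 (i \o (@FracField.tofrac _ \o polyC)) c3.
by rewrite rmorph_nat rmorph0.
Qed.

Section Cover.

Variables (L : fieldExtType F) (v : L).
Hypotheses (dimL : \dim {:L} = 3)
  (v_root : root (map_poly (in_alg L) (cubic_poly lam kap)) v)
  (v_gen : <<1; v>>%VS = fullv).

Let tameL : tame_cover Q L.
Proof. by apply: (cubic_extension_tame pchar3 lam0 lam1 kapE v_root v_gen) => P /branchQ. Qed.

Let irr : irreducible_poly (cubic_poly lam kap).
Proof. exact: cubic_poly_irreducible lam0 lam1 kapE. Qed.

(** The three roots of the cubic in [Omega] give three embeddings of [L], which land in the tame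
    closure because the cover is tame; any embedding sends [v] to one of these roots. *)
Lemma cover_labeling : exists label : 'I_3 -> (L -> E), is_labeling label.
Proof.
have char3O : 3 = 0 :> Omega := char3 phi.
have char2O : 2 != 0 :> Omega.
  apply/eqP => c2; have : 1 = 3 - 2 :> Omega by ring.
  by rewrite char3O c2 subrr => /eqP; rewrite oner_eq0.
have nf : phi f%:F != 0 := branch_poly_emb_neq0 lam phi.
have [rho rho_inj rhoE] := depressed_cubic_splits (phi h0) char3O char2O nf.
have rho_root a : root (map_poly phi (cubic_poly lam kap)) (rho a).
  by apply/rootP; rewrite horner_cubic_poly -(rhoE a); ring.
have lift a : exists h : L -> E, field_hom_over (in_alg L) psi h /\ tame_val (h v) = rho a.
  have [h h_hom hv] := simple_extension_embedding irr v_root v_gen (rho_root a).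
  have [h' h'_hom h'E] := tame_embedding_lift tameL h_hom.
  by exists h'; split=> //; rewrite h'E.
pose label a := projT1 (cid (lift a)).
have labelP a : field_hom_over (in_alg L) psi (label a) /\ tame_val (label a v) = rho a.
  by rewrite /label; case: cid.
exists label; split.
  move=> a b ab; apply: rho_inj; rewrite -(labelP a).2 -(labelP b).2.
  by rewrite ab.
apply/seteqP; split=> [_ [a _ <-]|h h_hom]; first exact: (labelP a).1.
have hv : h v ^+ 3 - psi f%:F * h v = psi h0.
  exact: hom_depressed h_hom (cubic_extension_root v_root).
have [a hva] := depressed_roots_complete char3O rho_inj rhoE
  (congr1 (@tame_val _ _ _ _ _) hv).
exists a => //; apply: (embeddings_agree v_gen (labelP a).1 h_hom).
by apply: val_inj; rewrite /= (labelP a).2 hva.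
Qed.

Variable label : 'I_3 -> (L -> E).
Hypothesis labeling : is_labeling label.

Let r a := label a v.

Lemma cover_root_inj : injective r.
Proof.
move=> a b ab; have [label_inj _] := labeling; apply: label_inj.
exact: (embeddings_agree v_gen (label_hom labeling a) (label_hom labeling b) ab).
Qed.

Lemma cover_root_eq a : r a ^+ 3 - psi f%:F * r a = psi h0.
Proof. exact: hom_depressed (label_hom labeling a) (cubic_extension_root v_root). Qed.

Variables (gamma : 'I_4 -> pi1) (sigma : 'I_4 -> 'S_3).
Hypothesis lgs : local_generating_system gamma.
Hypothesis mono : forall i a, label (sigma i a) = gamma i \o label a.

Let gamma_r i a : gamma i (r a) = r (sigma i a).
Proof. by rewrite /r mono. Qed.

Lemma cover_monodromy_fixes i : exists c, sigma i c = c.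
Proof.
have [_ _ /(_ i)[V [placeV overV inertiaE]]] := lgs.
(* [gamma i] lies in the closed subgroup that it generates. *)
have : inertia psi V (gamma i).
  by rewrite -inertiaE => s; exists (gamma i) => //= H [_]; apply.
move=> [gV g_inertia].
apply: (inertia_fixes_a_label pchar3 lam0 lam1 kapE placeV overV _
  (aut_over_hom (gamma i)) gV g_inertia cover_root_inj cover_root_eq (gamma_r i)).
have : range Q (Q i) by exists i.
by move/branchQ; case: (Q i) => // a [//|[_ [<-]]]; rewrite horner_branch_poly.
Qed.

Lemma cover_monodromy_prod : (\prod_(i < 4) sigma i)%g = 1%g.
Proof. by have [_ gamma1 _] := lgs; apply: (monodromy_prod labeling mono gamma1). Qed.

Lemma cover_monodromy_transitive :
  [transitive <<[set sigma i | i : 'I_4]>>%g, on [set: 'I_3]%SET | 'P].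
Proof.
have [gamma_gen _ _] := lgs.
apply: (monodromy_transitive Omega_algebraic gamma_gen irr cover_root_inj _ gamma_r).
  move=> a; apply/rootP; rewrite horner_cubic_poly.
  have e : tame_val (r a) ^+ 3 - phi f%:F * tame_val (r a) = phi h0 :=
    congr1 (@tame_val _ _ _ _ _) (cover_root_eq a).
  by rewrite -e; ring.
by rewrite size_cubic_poly.
Qed.

Lemma cover_occurs : occurring_hurwitz gamma (existT _ 3%N sigma).
Proof.
split; last by exists L, label; split.
split=> [i||]; last exact: cover_monodromy_transitive.
  by have [c sc] := cover_monodromy_fixes i; apply: perm3_is_cycle sc.
exact: cover_monodromy_prod.
Qed.

Lemma cover_monodromy_nontrivial i : sigma i != 1%g.
Proof.
exact: generating_reflections cover_monodromy_fixes cover_monodromy_prod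
  cover_monodromy_transitive i.
Qed.

(* The discriminant classes of two cubic covers whose monodromy consists of
   reflections agree, since the product of the square roots of the two
   discriminants is fixed by every [gamma i].  Hence the second cover is also
   given by an equation [u^3 - f u = h], and it has the same normal form. *)
Lemma reflection_monodromy_conjugate (L' : fieldExtType F) (label' : 'I_3 -> (L' -> E))
    (sigma' : 'I_4 -> 'S_3) :
    tame_cover Q L' -> \dim {:L'} = 3 -> is_labeling label' ->
    (forall i a, label' (sigma' i a) = gamma i \o label' a) ->
    (forall i, exists c, sigma' i c = c) -> (forall i, sigma' i != 1%g) ->
  exists2 t : 'I_3 -> 'I_3, injective t & forall i x, t (sigma' i x) = sigma i (t x).
Proof.
move=> tameL' dimL' labeling' mono' fix' nt'.
pose phi' : {rmorphism F -> L'} := in_alg L'.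
have pchar3F : 3%N \in [pchar F].
  by rewrite inE /=; apply/eqP; exact: (char3 idfun).
have char3E : 3 = 0 :> E := char3 psi.
have hom' a := label_hom labeling' a.
have inj' u : u \notin 1%VS -> injective (fun a => label' a u).
  move=> nu a b ab; have [label'_inj _] := labeling'; apply: label'_inj.
  exact: (embeddings_agree (cubic_generator dimL' nu) (hom' a) (hom' b) ab).
have [sepL' _] := tameL'.
have [u [p [q [nu np uE]]]] := depressed_cubic dimL' pchar3F sepL'.
have root_u a : label' a u ^+ 3 - psi p * label' a u = psi q := hom_depressed (hom' a) uE.
have gamma_u i a : gamma i (label' a u) = label' (sigma' i a) u by rewrite mono'.
have gamma_hom i := aut_over_hom (gamma i).
pose eps := root_step (fun a => label' a u); pose eps0 := root_step r.
have eps_odd i : gamma i eps = - eps.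
  have [gB gM gF] := gamma_hom i.
  exact: (root_step_odd char3E (inj' u nu) root_u gB gM (gF p) (gamma_u i) (fix' i) (nt' i)).
have eps0_odd i : gamma i eps0 = - eps0.
  have [gB gM gF] := gamma_hom i.
  exact: (root_step_odd char3E cover_root_inj cover_root_eq gB gM (gF _) (gamma_r i)
    (cover_monodromy_fixes i) (cover_monodromy_nontrivial i)).
have eps2 : eps ^+ 2 = psi p := root_step_square char3E (inj' u nu) root_u.
have eps02 : eps0 ^+ 2 = psi f%:F := root_step_square char3E cover_root_inj cover_root_eq.
have [gamma_gen _ _] := lgs.
have char2O : 2 != 0 :> Omega.
  apply/eqP => c2; have : 1 = 3 - 2 :> Omega by ring.
  by rewrite (char3 phi) c2 subrr => /eqP; rewrite oner_eq0.
have [||s sE] := quadratic_descent Omega_algebraic gamma_gen (z := eps * eps0)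
    (d := p * f%:F) char2O.
- by rewrite exprMn eps2 eps02; exact/esym/(rmorphM (tame_in Q phi)).
- by move=> i; have [_ [_ gM] _] := gamma_hom i; rewrite gM eps_odd eps0_odd mulrNN.
have s2 : s ^+ 2 = p * f%:F.
  suff : psi (s ^+ 2) = psi (p * f%:F) by exact: fmorph_inj.
  transitivity (psi s ^+ 2); first exact: (rmorphXn (tame_in Q phi)).
  rewrite -sE exprMn eps2 eps02; exact/esym/(rmorphM (tame_in Q phi)).
have nf : f%:F != 0 :> F by rewrite tofrac_eq0 branch_poly_neq0.
have ns : s != 0.
  apply: contraNneq np => s0; move: s2; rewrite s0 expr0n => /esym/eqP.
  by rewrite mulf_eq0 (negPf nf) orbF.
have scale (k : F) (y : L') : k != 0 -> y \notin 1%VS -> phi' k * y \notin 1%VS.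
  move=> nk; apply: contra => ky; rewrite -[y](mulKf (_ : phi' k != 0)) ?(fmorph_eq0 phi') //.
  by rewrite rpredM ?rpredV // rpredZ ?mem1v.
(* Since [s^2 = p f], the factor [k = f / s] satisfies [k^2 p = f]; rescaling [u] by [k] changes the
   coefficient [p] into [f]. *)
have nfs : f%:F / s != 0 := mulf_neq0 nf (invr_neq0 ns).
have u1E : (phi' (f%:F / s) * u) ^+ 3 - phi' f%:F * (phi' (f%:F / s) * u) =
    phi' ((f%:F / s) ^+ 3 * q).
  have k2 : (f%:F / s) ^+ 2 * p = f%:F.
    have key (M : fieldType) (a b c : M) : a != 0 -> b != 0 -> c ^+ 2 = b * a ->
        (a / c) ^+ 2 * b = a.
      by move=> na nb c2; rewrite expr_div_n c2; field; rewrite na nb.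
    exact: key nf np s2.
  move: (f%:F / s) k2 => k k2; rewrite -[in phi' f%:F]k2.
  have uE' : u ^+ 3 - phi' p * u = phi' q := uE.
  by rewrite !(rmorphXn phi', rmorphM phi') -uE'; ring.
have [kap' [w [nw wE kap'_or]]] :=
  tame_cubic_normal_form pchar3 lam0 lam1 tameL' (scale _ _ nfs nu) u1E.
have [w' nw' w'E] : exists2 w' : L', w' \notin 1%VS & w' ^+ 3 - phi' f%:F * w' = phi' h0.
  (* For [kap' = 0] the equation is [w (w^2 - f) = 0], impossible for a generator of degree 3.
     Otherwise [kap'] is [kap] or [- kap], and [w |-> - w] absorbs the sign. *)
  case: kap'_or => [kap'0|kap'2].
    move: wE; rewrite kap'0 expr0n scale0r tofrac0 (rmorph0 phi') => /eqP.
    have -> : w ^+ 3 - phi' f%:F * w = w * (w ^+ 2 - phi' f%:F) by ring.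
    rewrite mulf_eq0 subr_eq0 => /orP[/eqP w0|w2].
      by move: nw; rewrite w0 rpred0.
    by case/negP: (cubic_square_notin dimL' f%:F nw).
  have n1l : 1 + lam != 0.
    apply: contra_eq_neq kapE => ->; rewrite mulr0 eq_sym oppr_eq0; exact: oner_neq0.
  have : kap' ^+ 2 == kap ^+ 2 by rewrite -(inj_eq (mulIf n1l)) kap'2 kapE.
  rewrite eqf_sqr => /orP[] /eqP kap'E; first by exists w; rewrite -?kap'E.
  exists (- w); first by rewrite rpredN.
  transitivity (- (w ^+ 3 - phi' f%:F * w)); first by ring.
  have wE' : w ^+ 3 - phi' f%:F * w = phi' (kap' ^+ 3 *: f ^+ 2)%:F := wE.
  have kap3 : kap' ^+ 3 = - kap ^+ 3 by rewrite kap'E; ring.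
  by rewrite wE' kap3 scaleNr tofracN (rmorphN phi') opprK.
have root_w' a : label' a w' ^+ 3 - psi f%:F * label' a w' = psi h0.
  exact: hom_depressed (hom' a) w'E.
(* Both covers now have the same roots in the tame closure, so matching roots relabels one fiber by
   the other, compatibly with every [gamma i]. *)
have match_root a : exists b, label' a w' = r b.
  exact: (depressed_roots_complete char3E cover_root_inj cover_root_eq (root_w' a)).
pose t a := projT1 (cid (match_root a)).
have tP a : label' a w' = r (t a) by rewrite /t; case: cid.
exists t => [a b ab|i x].
  by apply: (inj' w' nw'); rewrite !tP ab.
by apply: cover_root_inj; rewrite -gamma_r -!tP mono'.
Qed.

End Cover.
End Monodromy.

(** * The marked points and the final comparison *)

Lemma generic_pointsP (k K : fieldType) (j : {rmorphism {fraction {poly k}} -> K}) P :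
  range (generic_points j) P <->
  P = None \/ (exists2 a, P = Some a & a * (a - 1) * (a - j 'X%:F) = 0).
Proof.
split=> [[i _ <-]|].
  case: i => [[|[|[|[|//]]]] ?]; rewrite /generic_points (tnth_nth None) /=;
    [right|right|left|right] => //.
  - by exists 0; rewrite ?mul0r.
  - by exists 1; rewrite ?subrr ?mulr0 ?mul0r.
  - by exists (j 'X%:F); rewrite ?subrr ?mulr0.
case=> [->|[a -> /eqP]]; first by exists 2; rewrite // /generic_points (tnth_nth None).
rewrite !mulf_eq0 !subr_eq0 => /orP[/orP[]|] /eqP->.
- by exists 0; rewrite // /generic_points (tnth_nth None).
- by exists 1; rewrite // /generic_points (tnth_nth None).
- by exists 3; rewrite // /generic_points (tnth_nth None).
Qed.

Lemma monodromy_braid_move (K : fieldType) (r d : nat) (Q : 'I_r -> option K)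
    (Omega : fieldType) (phi : {rmorphism {fraction {poly K}} -> Omega})
    (L : fieldExtType {fraction {poly K}}) (label : 'I_d -> (L -> tame_closure Q phi))
    (gamma : 'I_r -> pi1_tame Q phi) (sigma : 'I_r -> 'S_d) (a b : 'I_r) :
    (forall i x, label (sigma i x) = gamma i \o label x) ->
  forall i x, label (braid_move a b sigma i x) = braid_move a b gamma i \o label x.
Proof.
move=> mono i x; rewrite /braid_move; case: ifP => _; first exact: mono.
case: ifP => _; last exact: mono.
have monoV y : label ((sigma b)^-1%g y) = aut_inv_fun (gamma b) \o label y.
  apply/funext => z; rewrite -[in RHS](permKV (sigma b) y) mono /=.
  by rewrite (aut_inv_funK (gamma b)).1.
by rewrite !permM !mono monoV.
Qed.

Theorem proposition1p5
  (k : closedFieldType) (k_char3 : 3%N \in [pchar k])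
  (K : closedFieldType) (j : {rmorphism {fraction {poly k}} -> K})
  (K_algebraic : forall z : K, algebraicOver j z)
  (Omega : closedFieldType) (phi : {rmorphism {fraction {poly K}} -> Omega})
  (Omega_algebraic : forall z : Omega, algebraicOver phi z)
  (Sigma : set ('I_4 -> pi1_tame (generic_points j) phi))
  (Sigma_nonempty : Sigma !=set0)
  (Sigma_lgs : forall gamma, Sigma gamma -> local_generating_system gamma)
  (Sigma_braid : pure_braid_closed Sigma) :
  (exists gamma gamma' : 'I_4 -> pi1_tame (generic_points j) phi,
     [/\ Sigma gamma, Sigma gamma'
       & occurring_hurwitz gamma <> occurring_hurwitz gamma']) /\
  ~ (exists H : set (permutation_tuple 4),
       H `<=` @hurwitz_factorization 4 /\
       forall gamma, Sigma gamma -> occurring_hurwitz gamma = H).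
Proof.
suff main : exists gamma gamma' : 'I_4 -> pi1_tame (generic_points j) phi,
    [/\ Sigma gamma, Sigma gamma' & occurring_hurwitz gamma <> occurring_hurwitz gamma'].
  split=> //; have [gamma [gamma' [Sg Sg' neq]]] := main.
  by move=> [H [_ HE]]; apply: neq; rewrite !HE.
have [gamma Sg] := Sigma_nonempty; have lgs := Sigma_lgs _ Sg.
have pchar3 : 3%N \in [pchar K].
  exact: (rmorph_pchar (j \o (@FracField.tofrac _ \o polyC)) k_char3).
pose lam : K := j 'X%:F.
have X_neq (c : k) : 'X%:F != (c%:P)%:F :> {fraction {poly k}}.
  rewrite tofrac_eq; apply/eqP => /(congr1 (fun p : {poly k} => size p)).
  by rewrite size_polyX size_polyC; case: (c != 0).
have lam_neq (c : k) : lam != j (c%:P)%:F by rewrite (inj_eq (fmorph_inj j)).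
have lam0 : lam != 0 by have := lam_neq 0; rewrite polyC0 !rmorph0.
have lam1 : lam != 1 by have := lam_neq 1; rewrite polyC1 !rmorph1.
(* The value [lam = -1], for which [kap] would not exist, is the supersingular one for [y^2 = f];
   transcendence of [lam] excludes it. *)
have lamN1 : 1 + lam != 0.
  by have := lam_neq (-1); rewrite polyCN polyC1 !rmorphN !rmorph1 addrC addr_eq0.
have [kap kapE] : exists kap, kap ^+ 2 * (1 + lam) = -1.
  have /closed_rootP[kap] : size ('X^2 - (- (1 + lam)^-1)%:P) != 1 by rewrite size_XnsubC.
  rewrite /root !hornerE subr_eq0 => /eqP kap2; exists kap.
  by rewrite kap2 mulNr mulVf.
have branchQ := generic_pointsP j.
have [L [v [dimL v_root v_gen]]] := generic_cubic_extension lam0 lam1 kapE.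
have [label labeling] :=
  cover_labeling pchar3 lam0 lam1 kapE branchQ phi v_root v_gen.
pose sigma i := projT1 (cid (monodromy_permutation labeling (gamma i))).
have mono i a : label (sigma i a) = gamma i \o label a.
  by rewrite /sigma; case: cid => s sE /=; apply: sE.
have fixes := cover_monodromy_fixes pchar3 lam0 lam1 kapE branchQ v_root v_gen labeling lgs mono.
have prod1 := cover_monodromy_prod labeling lgs mono.
have trans := cover_monodromy_transitive lam0 lam1 kapE Omega_algebraic
  v_root v_gen labeling lgs mono.
have [a [b [ba not_conj]]] := double_braid_not_conjugate fixes prod1 trans.
pose gamma' := braid_move a b (braid_move a b gamma).
pose sigma' := braid_move a b (braid_move a b sigma).
have mono' i x : label (sigma' i x) = gamma' i \o label x.
  by apply: monodromy_braid_move => {}i {}x; apply: monodromy_braid_move.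
have Sg' : Sigma gamma'.
  apply: (Sigma_braid _ _ Sg); rewrite -(tperm2 a b) -[X in (X * _)%g]mul1g.
  by do 2!apply: braid_step => //; apply: braid_refl.
have lgs' := Sigma_lgs _ Sg'.
exists gamma, gamma'; split=> // occ_eq.
(* The moved tuple occurs around [gamma'] through the original cover and labeling; the assumed
   equality provides a possibly different cover realizing it around [gamma]. *)
have : occurring_hurwitz gamma (existT _ 3%N sigma').
  rewrite occ_eq.
  exact: (cover_occurs pchar3 lam0 lam1 kapE branchQ Omega_algebraic
    dimL v_root v_gen labeling lgs' mono').
move=> [_ [L' [label' [tameL' dimL' labeling' mono'']]]].
have fixes' := cover_monodromy_fixes pchar3 lam0 lam1 kapE branchQ v_root v_gen labeling lgs' mono'.
have nt' := cover_monodromy_nontrivial pchar3 lam0 lam1 kapE branchQ Omega_algebraic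
  v_root v_gen labeling lgs' mono'.
have [t t_inj tE] := reflection_monodromy_conjugate pchar3 lam0 lam1 kapE branchQ
  Omega_algebraic v_root v_gen labeling lgs mono tameL' dimL' labeling' mono'' fixes' nt'.
exact: not_conj t t_inj tE.
Qed.
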